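(* Let $p\in(0,1)$ be a constant and let $G(n,p)$ be the binomial random graph. Then $G(n,p)$ obeys the $\mathcal{E}_1^2$ zero-one law (i.e. for every sentence $\varphi\in\mathcal{E}_1^2$, $\lim_{n\to\infty}{\sf P}(G(n,p)\models\varphi)$ exists and belongs to $\{0,1\}$) if and only if $p\notin\{\frac{3-\sqrt{5}}{2},\frac{\sqrt{5}-1}{2}\}$. Moreover, if $p\in\{\frac{3-\sqrt{5}}{2},\frac{\sqrt{5}-1}{2}\}$, then $G(n,p)$ does not obey the $\mathcal{E}_1^2$ convergence law, i.e. there is a sentence $\varphi\in\mathcal{E}_1^2$ such that ${\sf P}(G(n,p)\models\varphi)$ does not converge as $n\to\infty$.
   Context: $G(n,p)$ is the random graph on vertex set $\{1,\ldots,n\}$ in which each pair of vertices is joined by an edge independently with probability $p$. Sentences are about undirected graphs, built from the relations $\sim$ (adjacency) and $=$. $\mathcal{E}_1^2$ is the class of existential monadic second order sentences of the form $\exists X\,\phi(X)$, where $X$ is a single monadic (set) variable ranging over subsets of the vertex set and $\phi(X)$ is a first order sentence in $\sim,=$ and the unary predicate $X$ of quantifier depth $2$ (the maximum number of nested first order quantifiers is 2). *)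

(* Defs.v *)
From HB Require Import structures.
From mathcomp Require Import all_boot all_order all_algebra.
From mathcomp Require Import all_classical all_reals.
From mathcomp Require Import topology.
From mathcomp Require Import Rstruct Rstruct_topology.
From Stdlib Require Import Rdefinitions.
Set Implicit Arguments. Unset Strict Implicit. Unset Printing Implicit Defensive.
Import Order.TTheory GRing.Theory Num.Theory.

(* First-order formulas over the signature {~, =} plus a unary predicate X.
   Variables are de Bruijn indices (index 0 = innermost binder). *)
Inductive fo : Type :=
  | FAdj of nat & nat
  | FEq  of nat & nat
  | FInX of nat
  | FNot of fo
  | FAnd of fo & fo
  | FOr  of fo & fo
  | FEx  of fo
  | FAll of fo.

Fixpoint qdepth (f : fo) : nat :=
  match f with
  | FAdj _ _ | FEq _ _ | FInX _ => 0
  | FNot g => qdepth g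
  | FAnd g h | FOr g h => maxn (qdepth g) (qdepth h)
  | FEx g | FAll g => (qdepth g).+1
  end.

Fixpoint closed_at (k : nat) (f : fo) : bool :=
  match f with
  | FAdj i j | FEq i j => (i < k) && (j < k)
  | FInX i => i < k
  | FNot g => closed_at k g
  | FAnd g h | FOr g h => closed_at k g && closed_at k h
  | FEx g | FAll g => closed_at k.+1 g
  end.

Definition fo_sentence (f : fo) : bool := closed_at 0 f.

(* Graphs on vertex set 'I_n: an edge set E of ordered pairs (i,j) with i < j. *)
Definition pairs (n : nat) : {set 'I_n * 'I_n} := [set e : 'I_n * 'I_n | (val e.1 < val e.2)%N].

Definition adj (n : nat) (E : {set 'I_n * 'I_n}) (x y : 'I_n) : bool :=
  ((x, y) \in E) || ((y, x) \in E).

Fixpoint eval (n : nat) (E : {set 'I_n * 'I_n}) (X : {set 'I_n})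
    (env : seq 'I_n) (f : fo) : bool :=
  match f with
  | FAdj i j => if (onth env i, onth env j) is (Some x, Some y) then adj E x y else false
  | FEq i j => if (onth env i, onth env j) is (Some x, Some y) then x == y else false
  | FInX i => if onth env i is Some x then x \in X else false
  | FNot g => ~~ eval E X env g
  | FAnd g h => eval E X env g && eval E X env h
  | FOr g h => eval E X env g || eval E X env h
  | FEx g => [exists x : 'I_n, eval E X (x :: env) g]
  | FAll g => [forall x : 'I_n, eval E X (x :: env) g]
  end.

(* The E_1^2 class: sentences  exists X, phi(X)  with phi a first-order
   sentence of quantifier depth (at most) 2.  We represent such a sentence by phi. *)
Definition E12 (phi : fo) : bool := fo_sentence phi && (qdepth phi <= 2)%N.

Definition models_E12 (n : nat) (E : {set 'I_n * 'I_n}) (phi : fo) : bool :=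
  [exists X : {set 'I_n}, eval E X [::] phi].

Local Open Scope classical_set_scope.
Local Open Scope ring_scope.

(* P(G(n,p) |= exists X phi): each of the n choose 2 possible edges is present
   independently with probability p. *)
Definition probE12 (p : R) (phi : fo) (n : nat) : R :=
  \sum_(E : {set 'I_n * 'I_n} | (E \subset pairs n) && models_E12 E phi)
     p ^+ #|E| * (1 - p) ^+ (#|pairs n| - #|E|).

Definition zero_one_law_E12 (p : R) : Prop :=
  forall phi : fo, E12 phi ->
    exists c : R, (c = 0 \/ c = 1) /\ (probE12 p phi @ \oo --> c).

Definition convergence_law_E12 (p : R) : Prop :=
  forall phi : fo, E12 phi -> cvgn (probE12 p phi).

(* Main.v *)
From HB Require Import structures.
From mathcomp Require Import all_classical all_reals.
From mathcomp Require Import topology normedtype sequences exp.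
From mathcomp Require Import Rstruct Rstruct_topology.
From Stdlib Require Import Rdefinitions.
From mathcomp Require Import all_boot all_order all_algebra.
From mathcomp Require Import lra zify ring.
Set Implicit Arguments. Unset Strict Implicit. Unset Printing Implicit Defensive.
Import Order.TTheory GRing.Theory Num.Theory.
Require Import Defs.

(** A depth-2 sentence about [(G, X)] only sees the set of vertex types of [(G, X)]: membership in
    [X], together with the pairs (adjacent?, in [X]?) realised by the other vertices.  The finite
    extension axioms, which hold with high probability, decide for every set of types whether some
    [X] realises it, except when [X] is a clique or (passing to the complement) an independent set.
    For cliques the only questions are whether a clique can be maximal or not, and dominating or not.

    Put [q = 1 - p].  Cliques reach size [2 log n / log (1/p)] and dominate from size
    [log n / log (1/q)] on, so dominating cliques exist with high probability when [q^2 < p] (second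
    moment) and do not when [p < q^2] (first moment); maximal nondominating cliques always exist.
    When [p = q^2] the expected number of nonmaximal dominating [k]-cliques is about
    [m^(k+1) e^-m / k!] with [m = n q^k].  It is bounded below, and the second moment method applies,
    if [m] is close to [k + 1]; the sum over all [k] tends to [0] along those [n] for which the ratio
    [m / k] stays away from [1].  Hence the probability that such a clique exists oscillates.  The
    case [q = p^2] follows by complementation. *)

(** * Types of vertices and depth-2 sentences *)

(** With n of order t^-k, a given set of size k typically dominates if q < t and fails to if t < q,
    while k-cliques abound if t < sqrt p and disappear if sqrt p < t. When sqrt p and q differ, a
    [t] strictly between them leaves exponential room in both estimates, and crude bounds suffice.

    At p = q^2 this room is gone. The clique probability is then itself a power of q^k, so the
    expectation is governed by m and k alone; with r = m / k, Stirling makes it about sqrt k (r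
    e^(1-r))^k, exponentially small in k unless r is near 1. Passing from k to k + 1 multiplies m by
    q. Hence n can be chosen so that r jumps over 1, from theta > 1 to about theta q < 1, and also
    so that r lands near 1.

    The delicate point of the lower bound is the correlation of two cliques: they share edges, and
    there are vertices that both fail to dominate. For nearly equal cliques the second effect costs
    a factor of order e^k, and only the e^-k in Stirling's formula for k! absorbs it. *)

Section Evaluation.
Variables (V : finType) (e : rel V) (X : {set V}).

(** The semantics for an arbitrary relation, so that a graph and its complement fall under the same
    lemmas. *)
Fixpoint reval (env : seq V) (f : fo) : bool :=
  match f with
  | FAdj i j => if (onth env i, onth env j) is (Some x, Some y) then e x y else false
  | FEq i j => if (onth env i, onth env j) is (Some x, Some y) then x == y else false
  | FInX i => if onth env i is Some x then x \in X else false
  | FNot g => ~~ reval env g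
  | FAnd g h => reval env g && reval env h
  | FOr g h => reval env g || reval env h
  | FEx g => [exists x, reval (x :: env) g]
  | FAll g => [forall x, reval (x :: env) g]
  end.

Definition vtype (x : V) : bool * {set bool * bool} :=
  (x \in X, [set ab | [exists y, (y != x) && ((e x y, y \in X) == ab)]]).

Definition vtypes : {set bool * {set bool * bool}} := [set vtype x | x in V].

Lemma vtypeP (x : V) ab :
  reflect (exists2 y, y != x & (e x y, y \in X) = ab) (ab \in (vtype x).2).
Proof.
rewrite inE; apply: (iffP existsP) => [[y /andP[yx /eqP]]|[y yx E]]; exists y => //.
by rewrite yx E eqxx.
Qed.

End Evaluation.

Lemma eval_reval n (E : {set 'I_n * 'I_n}) X env f :
  eval E X env f = reval (adj E) X env f.
Proof.
elim: f env => //= [g IHg|g IHg h IHh|g IHg h IHh|g IHg|g IHg] env;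
  rewrite ?IHg ?IHh //.
- by apply: eq_existsb => x.
- by apply: eq_forallb => x.
Qed.

Section Transfer.
Variables (V V' : finType) (e : rel V) (e' : rel V').
Hypotheses (sym_e : symmetric e) (irr_e : irreflexive e).
Hypotheses (sym_e' : symmetric e') (irr_e' : irreflexive e').
Variables (X : {set V}) (X' : {set V'}).

Lemma reval_depth0 x y x' y' f :
    (x \in X) = (x' \in X') -> (y \in X) = (y' \in X') ->
    (x == y) = (x' == y') -> e x y = e' x' y' ->
    closed_at 2 f -> (qdepth f <= 0)%N ->
  reval e X [:: y; x] f = reval e' X' [:: y'; x'] f.
Proof.
move=> xX yX xy exy; elim: f => //=.
- case=> [|[|i]] [|[|j]] //= _ _; rewrite ?irr_e ?irr_e' //.
  by rewrite sym_e sym_e'.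
- by case=> [|[|i]] [|[|j]] //= _ _; rewrite ?eqxx // eq_sym xy eq_sym.
- by case=> [|[|i]].
- by move=> g IH *; rewrite IH.
- by move=> g IHg h IHh /andP[? ?]; rewrite geq_max => /andP[? ?]; rewrite IHg ?IHh.
- by move=> g IHg h IHh /andP[? ?]; rewrite geq_max => /andP[? ?]; rewrite IHg ?IHh.
Qed.

(** Second round of the Ehrenfeucht-Fraisse game: after first moves of equal type every second move
    has an answer, a repeated vertex being answered by repetition. *)
Lemma vtype_forth x x' y : vtype e X x = vtype e' X' x' ->
  exists y', [/\ (y \in X) = (y' \in X'), (x == y) = (x' == y') & e x y = e' x' y'].
Proof.
move=> E; have [<-|xy] := eqVneq x y.
  by exists x'; split; rewrite ?eqxx ?irr_e ?irr_e' //; case: E.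
have : (e x y, y \in X) \in (vtype e X x).2 by apply/vtypeP; exists y; rewrite // eq_sym.
rewrite E => /vtypeP[y' yx' [E1 E2]]; exists y'.
by rewrite E1 E2 eq_sym (negPf yx').
Qed.

End Transfer.

Section Transfer2.
Variables (V V' : finType) (e : rel V) (e' : rel V').
Hypotheses (sym_e : symmetric e) (irr_e : irreflexive e).
Hypotheses (sym_e' : symmetric e') (irr_e' : irreflexive e').
Variables (X : {set V}) (X' : {set V'}).

Lemma reval_depth1 x x' f : vtype e X x = vtype e' X' x' ->
  closed_at 1 f -> (qdepth f <= 1)%N -> reval e X [:: x] f = reval e' X' [:: x'] f.
Proof.
move=> E; have xX : (x \in X) = (x' \in X') by case: E.
have forth y := @vtype_forth _ _ e e' irr_e irr_e' X X' x x' y E.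
have back y := @vtype_forth _ _ e' e irr_e' irr_e X' X x' x y (esym E).
elim: f => //=.
- by case=> [|i] [|j] //= _ _; rewrite irr_e irr_e'.
- by case=> [|i] [|j] //= _ _; rewrite !eqxx.
- by case=> [|i].
- by move=> g IH *; rewrite IH.
- by move=> g IHg h IHh /andP[? ?]; rewrite geq_max => /andP[? ?]; rewrite IHg ?IHh.
- by move=> g IHg h IHh /andP[? ?]; rewrite geq_max => /andP[? ?]; rewrite IHg ?IHh.
- move=> g _ cg dg; apply/existsP/existsP => -[y Hy].
  + have [y' [yX xy exy]] := forth y; exists y'.
    by rewrite -(reval_depth0 sym_e irr_e sym_e' irr_e' xX yX xy exy).
  + have [y' [yX xy exy]] := back y; exists y'.
    by rewrite -(reval_depth0 sym_e' irr_e' sym_e irr_e (esym xX) yX xy exy).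
- move=> g _ cg dg; apply/forallP/forallP => Hy y.
  + have [y' [yX xy exy]] := back y.
    by rewrite (reval_depth0 sym_e' irr_e' sym_e irr_e (esym xX) yX xy exy).
  + have [y' [yX xy exy]] := forth y.
    by rewrite (reval_depth0 sym_e irr_e sym_e' irr_e' xX yX xy exy).
Qed.

(** First round of the game: any first vertex is answered by one of the same type, and
    [reval_depth1] takes over. *)
Lemma reval_depth2 f : vtypes e X = vtypes e' X' ->
  closed_at 0 f -> (qdepth f <= 2)%N -> reval e X [::] f = reval e' X' [::] f.
Proof.
move=> E.
have forth x : exists x', vtype e X x = vtype e' X' x'.
  have : vtype e X x \in vtypes e X by apply: imset_f.
  by rewrite E => /imsetP[x' _ ->]; exists x'.
have back x : exists x', vtype e X x' = vtype e' X' x.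
  have : vtype e' X' x \in vtypes e' X' by apply: imset_f.
  by rewrite -E => /imsetP[x' _ ->]; exists x'.
elim: f => //=.
- by move=> g IH *; rewrite IH.
- by move=> g IHg h IHh /andP[? ?]; rewrite geq_max => /andP[? ?]; rewrite IHg ?IHh.
- by move=> g IHg h IHh /andP[? ?]; rewrite geq_max => /andP[? ?]; rewrite IHg ?IHh.
- move=> g _ cg dg; apply/existsP/existsP => -[x Hx].
  + by have [x' xx'] := forth x; exists x'; rewrite -(reval_depth1 xx').
  + by have [x' xx'] := back x; exists x'; rewrite (reval_depth1 xx').
- move=> g _ cg dg; apply/forallP/forallP => H x.
  + by have [x' xx'] := back x; rewrite -(reval_depth1 xx').
  + by have [x' xx'] := forth x; rewrite (reval_depth1 xx').
Qed.

End Transfer2.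

Lemma vtypes_sub (V V' : finType) (e : rel V) (e' : rel V') X X' :
  (forall x, exists x', vtype e X x = vtype e' X' x') ->
  vtypes e X \subset vtypes e' X'.
Proof.
move=> H; apply/subsetP => _ /imsetP[x _ ->]; have [x' ->] := H x.
exact: imset_f.
Qed.

(** Complementing [X] acts on types by a fixed map, so a transfer for the complement of [X] yields
    one for [X]; [flip_vtype] does the same for the complement graph. *)
Definition swap_vtype (t : bool * {set bool * bool}) : bool * {set bool * bool} :=
  (~~ t.1, [set ab | (ab.1, ~~ ab.2) \in t.2]).

Lemma vtypes_setC (V : finType) (e : rel V) X :
  vtypes e (~: X) = swap_vtype @: vtypes e X.
Proof.
rewrite /vtypes -imset_comp; apply: eq_imset => x.
rewrite /swap_vtype /vtype /= inE; congr pair; apply/setP => -[a b].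
rewrite !inE; apply: eq_existsb => y; rewrite inE !xpair_eqE /=.
by case: (y \in X); case: b.
Qed.

Definition crel (V : finType) (e : rel V) : rel V := [rel x y | (x != y) && ~~ e x y].

Definition flip_vtype (t : bool * {set bool * bool}) : bool * {set bool * bool} :=
  (t.1, [set ab | (~~ ab.1, ab.2) \in t.2]).

Lemma vtypes_crel (V : finType) (e : rel V) X :
  vtypes (crel e) X = flip_vtype @: vtypes e X.
Proof.
rewrite /vtypes -imset_comp; apply: eq_imset => x.
rewrite /flip_vtype /vtype /=; congr pair; apply/setP => -[a b].
rewrite !inE; apply: eq_existsb => y; rewrite !xpair_eqE /= eq_sym.
by rewrite /crel /=; case: (x != y) => //=; case: (e x y); case: a.
Qed.

Lemma crelK (V : finType) (e : rel V) : irreflexive e -> crel (crel e) =2 e.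
Proof.
by move=> irr x y; rewrite /crel /= negb_and !negbK; case: eqVneq => [->|] //=; rewrite irr.
Qed.

Lemma crel_sym (V : finType) (e : rel V) : symmetric e -> symmetric (crel e).
Proof. by move=> sym x y; rewrite /crel /= eq_sym sym. Qed.

Lemma crel_irr (V : finType) (e : rel V) : irreflexive (crel e).
Proof. by move=> x; rewrite /crel /= eqxx. Qed.

Lemma eq_vtypes (V : finType) (e e' : rel V) X : e =2 e' -> vtypes e X = vtypes e' X.
Proof.
move=> E; apply: eq_imset => x; congr pair; apply/setP => ab; rewrite !inE.
by apply: eq_existsb => y; rewrite E.
Qed.

(** * Extension axioms *)

Section Extension.
Variables (V : finType) (e : rel V).

Definition extension_axiom k : bool :=
  [forall s : k.-tuple (V * bool), uniq (unzip1 s) ==>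
     [exists v, all (fun ab => (v != ab.1) && (e v ab.1 == ab.2)) s]].

(** Six vertices suffice: [exists_flagged] prescribes adjacency to five named vertices and at most
    one more. *)
Definition extension6 : bool := [forall k : 'I_7, extension_axiom k].

Lemma extension6P (s : seq (V * bool)) : extension6 -> (size s <= 6)%N ->
  uniq (unzip1 s) -> exists v, all (fun ab => (v != ab.1) && (e v ab.1 == ab.2)) s.
Proof.
move=> /forallP ext ss us; have /= := ext (Ordinal (ss : size s < 7)%N).
by move=> /forallP/(_ (in_tuple s))/implyP/(_ us)/existsP.
Qed.

Definition relF (X : {set V}) x := [forall y in X, (y != x) ==> e x y].
Definition relE (X : {set V}) x := [forall y in X, (y != x) ==> ~~ e x y].

(** Vertices outside a tame set show both adjacencies to every vertex, so a type retains only
    [rtype]: membership, and whether the other members of [X] are all adjacent (full) or all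
    nonadjacent (empty) to the vertex. *)
Definition tame (X : {set V}) :=
  forall x c, exists y, [/\ y != x, y \notin X & e x y = c].

Definition rtype (X : {set V}) x := (x \in X, relF X x, relE X x).

Lemma relFPn (X : {set V}) x :
  reflect (exists y, [/\ y \in X, y != x & ~~ e x y]) (~~ relF X x).
Proof.
rewrite negb_forall_in; apply: (iffP exists_inP) => [[y yX]|[y [yX yx xy]]].
  by rewrite negb_imply => /andP[]; exists y.
by exists y; rewrite // yx (negPf xy).
Qed.

Lemma relEPn (X : {set V}) x :
  reflect (exists y, [/\ y \in X, y != x & e x y]) (~~ relE X x).
Proof.
rewrite negb_forall_in; apply: (iffP exists_inP) => [[y yX]|[y [yX yx xy]]].
  by rewrite negb_imply negbK => /andP[]; exists y.
by exists y; rewrite // yx xy.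
Qed.

Lemma relFP (X : {set V}) x :
  reflect (forall y, y \in X -> y != x -> e x y) (relF X x).
Proof. by apply: (iffP forall_inP) => H y yX; apply/implyP/H. Qed.

Lemma relEP (X : {set V}) x :
  reflect (forall y, y \in X -> y != x -> ~~ e x y) (relE X x).
Proof. by apply: (iffP forall_inP) => H y yX; apply/implyP/H. Qed.

Lemma tame_vtype X x : tame X ->
  vtype e X x = (x \in X, [set ab | ~~ ab.2 || (if ab.1 then ~~ relE X x else ~~ relF X x)]).
Proof.
move=> tX; congr pair; apply/setP => -[a b]; rewrite [RHS]inE /=.
apply/(vtypeP e X x (a, b))/idP => [[y yx [<- <-]]|].
  case yX: (y \in X) => //=; case: ifP => exy; [apply/relEPn|apply/relFPn]; exists y.
    by rewrite exy.
  by rewrite exy.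
case: b => /= [|_].
  by case: a => [/relEPn|/relFPn] [y [yX yx exy]]; exists y; rewrite ?yX ?exy ?(negPf exy).
by have [y [yx yX exy]] := tX x a; exists y; rewrite ?exy ?(negPf yX).
Qed.

(* [b1]: the clique is not maximal; [b2]: the clique is not dominating. *)
Definition kclq b1 b2 : bool := [exists X : {set V},
  [&& (1 < #|X|)%N, [forall x in X, relF X x],
      [exists z in ~: X, relF X z] == b1 & [exists z in ~: X, relE X z] == b2]].

Hypotheses (sym_e : symmetric e) (irr_e : irreflexive e) (ext : extension6).

Lemma ext2 x y a b : x != y ->
  exists v, [/\ v != x, v != y, e v x = a & e v y = b].
Proof.
move=> xy; have [|v] := @extension6P [:: (x, a); (y, b)] ext isT.
  by rewrite /= inE xy.
by rewrite /= andbT => /andP[/andP[vx /eqP ?] /andP[vy /eqP ?]]; exists v.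
Qed.

Lemma ext1 x a : exists v, [/\ v != x & e v x = a].
Proof.
have [//|v] := @extension6P [:: (x, a)] ext isT.
by rewrite /= andbT => /andP[vx /eqP ?]; exists v.
Qed.

Lemma ext3 x y z a b c : x != y -> x != z -> y != z ->
  exists v, [/\ v != x, v != y & v != z] /\ [/\ e v x = a, e v y = b & e v z = c].
Proof.
move=> xy xz yz; have [|v] := @extension6P [:: (x, a); (y, b); (z, c)] ext isT.
  by rewrite /= !inE negb_or xy xz yz.
rewrite /= andbT => /and3P[/andP[vx /eqP ?] /andP[vy /eqP ?] /andP[vz /eqP ?]].
by exists v.
Qed.

(** A vertex nonadjacent to some other member lies outside the clique, and its adjacency to [y] is
    still free. *)
Lemma clique_tame (X : {set V}) : (1 < #|X|)%N -> (forall x, x \in X -> relF X x) -> tame X.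
Proof.
move=> /card_gt1P[x1 [x2 [x1X x2X x12]]] cl y c.
have [x [xX xy]] : exists x, x \in X /\ x != y.
  by have [<-|] := eqVneq x1 y; [exists x2; rewrite eq_sym|exists x1].
have [v [vx vy evx evy]] := @ext2 x y false c xy.
exists v; split; rewrite // 1?sym_e //; apply/negP => vX.
by move/relFP: (cl x xX) => /(_ v vX vx); rewrite sym_e evx.
Qed.

(** If neither set is tame, some [x] has one fixed adjacency to all vertices outside [X], and some
    [y] to all vertices inside. For distinct [x] and [y], a vertex violating both could be neither
    inside nor outside. So they coincide, and [X] is a neighbourhood or nonneighbourhood up to [x]
    itself. *)
Lemma tame_trichotomy (X : {set V}) : tame X \/ tame (~: X) \/
  exists x d, forall y, y != x -> (y \in X) = (e x y == d).
Proof.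
have dec (Y : {set V}) : tame Y \/ exists x c, forall y, y != x -> y \notin Y -> e x y = c.
  have [/existsP[[x c] /forallP H]|/existsPn H] :=
      boolP [exists xc : V * bool, forall y, (y != xc.1) && (y \notin Y) ==> (e xc.1 y == xc.2)].
    by right; exists x, c => y yx yY; apply/eqP; move: (H y); rewrite yx yY.
  left=> x c; move: (H (x, ~~ c)) => /forallPn[y]; rewrite negb_imply => /andP[/andP[yx yY] /= exy].
  by exists y; split=> //; move: exy; case: (e x y); case: (c).
have [|[x [c Hx]]] := dec X; first by left.
have [|[y [d Hy]]] := dec (~: X); first by right; left.
have {}Hy v : v != y -> v \in X -> e y v = d by move=> vy vX; rewrite Hy ?inE ?negbK.
right; right; have [xy|xy] := eqVneq x y; last first.
  have [v [vx vy evx evy]] := @ext2 x y (~~ c) (~~ d) xy.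
  case: (boolP (v \in X)) => vX.
    by move: (Hy v vy vX); rewrite sym_e evy; case: (d).
  by move: (Hx v vx vX); rewrite sym_e evx; case: (c).
subst y; have cd : c = ~~ d.
  have [v [vx evx]] := @ext1 x (~~ c).
  have := Hx v vx; have := Hy v vx; rewrite sym_e evx.
  by case: (v \in X) => /= [/(_ isT) <- _|_ /(_ isT)]; rewrite ?negbK //; case: (c).
exists x, d => y yx; case: (boolP (y \in X)) => yX; first by rewrite (Hy _ yx yX) eqxx.
by rewrite (Hx _ yx yX) cd; case: (d).
Qed.

Lemma vtypes_neighborhood (X : {set V}) x d : (forall y, y != x -> (y \in X) = (e x y == d)) ->
  vtypes e X = [set (x \in X, [set (true, d); (false, ~~ d)]);
                    (true, setT); (false, setT)].
Proof.
move=> HX.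
have tx : vtype e X x = (x \in X, [set (true, d); (false, ~~ d)]).
  congr pair; apply/setP => -[a b]; apply/(vtypeP e X x)/idP.
    move=> [y yx [<- <-]]; rewrite HX // !inE !xpair_eqE.
    by case: (e x y); case: (d).
  rewrite !inE !xpair_eqE => H; have [v [vx evx]] := @ext1 x a.
  exists v => //; rewrite sym_e evx HX // sym_e evx.
  by congr pair; move: H; case: a {evx}; case: b; case: (d).
have ty y : y != x -> vtype e X y = (y \in X, setT).
  move=> yx; congr pair; apply/setP => -[a b]; rewrite [RHS]inE.
  apply/(vtypeP e X y); have [v [vy vx evy evx]] := @ext2 y x a (if b then d else ~~ d) yx.
  by exists v => //; rewrite sym_e evy HX // sym_e evx; case: b {evx}; case: (d).
apply/setP => t; apply/imsetP/idP => [[y _ ->]|].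
  have [->|/ty->] := eqVneq y x; first by rewrite tx !inE eqxx.
  by rewrite !inE !xpair_eqE !eqxx !andbT; case: (y \in X); rewrite !orbT.
have exin c : exists y, y != x /\ (y \in X) = c.
  have [v [vx evx]] := @ext1 x (if c then d else ~~ d); exists v; split=> //.
  by rewrite HX // sym_e evx; case: c {evx}; case: (d).
rewrite !inE -orbA => /or3P[] /eqP->; first by exists x.
  by have [y [yx yX]] := exin true; exists y; rewrite // ty // yX.
by have [y [yx yX]] := exin false; exists y; rewrite // ty // yX.
Qed.

(** Take any [z] outside [X], and two vertices that separate [x1] from [x2], one adjacent to [z] and
    one not. If either is outside [X], it is mixed itself; if both are members, they make [z]
    mixed. *)
Lemma exists_mixed_outside (X : {set V}) x1 x2 : tame X -> x1 \in X -> x2 \in X -> x1 != x2 ->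
  exists z, rtype X z = (false, false, false).
Proof.
move=> tX x1X x2X x12.
suff [z [zX zF zE]] : exists z, [/\ z \notin X, ~~ relF X z & ~~ relE X z].
  by exists z; rewrite /rtype (negPf zX) (negPf zF) (negPf zE).
have [z [zx1 zX _]] := tX x1 true.
have neX w x : w \notin X -> x \in X -> x != w by move=> /negP wX xX; apply/eqP => E; apply: wX; rewrite -E.
have mix w : e w x1 -> ~~ e w x2 -> w \notin X ->
    exists z, [/\ z \notin X, ~~ relF X z & ~~ relE X z].
  move=> w1 w2 wX; exists w; split=> //.
    by apply/relFPn; exists x2; rewrite x2X neX.
  by apply/relEPn; exists x1; rewrite x1X neX.
have sep c : exists w, e w x1 /\ ~~ e w x2 /\ w != z /\ e w z = c.
  have [w [[_ _ wz] [w1 w2 w3]]] :=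
    @ext3 x1 x2 z true false c x12 (neX _ _ zX x1X) (neX _ _ zX x2X).
  by exists w; rewrite w1 w2 w3.
have [w [w1 [w2 [wz ewz]]]] := sep true.
have [w' [w1' [w2' [wz' ewz']]]] := sep false.
case: (boolP (w \in X)) => wX; last exact: (mix w).
case: (boolP (w' \in X)) => wX'; last exact: (mix w').
exists z; split=> //.
  by apply/relFPn; exists w'; rewrite wX' wz' sym_e ewz'.
by apply/relEPn; exists w; rewrite wX wz sym_e ewz.
Qed.

(** The flags tell whether members ([fa], [ea]) and nonmembers ([fb], [eb]) that are full or empty
    to [X] occur. Mixed types always occur, and types both full and empty never do. *)
Definition flagged (fa ea fb eb : bool) (t : bool * bool * bool) : bool :=
  let: (c, f, g) := t in
  ~~ (f && g) && (f ==> if c then fa else fb) && (g ==> if c then ea else eb).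

(** [X] is defined by adjacency to five vertices: [xa] is the only one that can be a member, [xF]
    and [xE] are candidates for full and empty nonmembers, and [z], [z'] provide tameness and mixed
    types. Since [xa] is adjacent to [xF] and not to [xE], its membership respects their roles. *)
Lemma exists_flagged fa ea fb eb : ~~ (fa && ea) ->
  exists2 X, tame X & forall t, (exists x, rtype X x = t) <-> flagged fa ea fb eb t.
Proof.
move=> fea.
have [xa _] := @extension6P [::] ext isT isT.
have [xF [F1 FF]] := @ext1 xa true.
have [xE [E1 E2 EE _]] := @ext2 xa xF false true ltac:(by rewrite eq_sym).
have [z [[z1 z2 z3] _]] := @ext3 xa xF xE true true true ltac:(by rewrite eq_sym)
   ltac:(by rewrite eq_sym) ltac:(by rewrite eq_sym).
have [|z'] := @extension6P [:: (xa, true); (xF, true); (xE, true); (z, true)] ext isT.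
  by rewrite /= !inE !negb_or; repeat (apply/andP; split); rewrite // eq_sym.
rewrite /= andbT => /and4P[/andP[y1 _] /andP[y2 _] /andP[y3 _] /andP[y4 _]].
pose five := [:: xa; xF; xE; z; z'].
have u5 : uniq five.
  by rewrite /= !inE !negb_or; repeat (apply/andP; split); rewrite // eq_sym.
have G5 a f g h k : exists v, v \notin five /\
    [/\ e v xa = a, e v xF = f, e v xE = g, e v z = h & e v z' = k].
  have [//|v] := @extension6P [:: (xa, a); (xF, f); (xE, g); (z, h); (z', k)] ext isT.
  rewrite /= andbT => /and5P[/andP[v1 /eqP ?] /andP[v2 /eqP ?] /andP[v3 /eqP ?]].
  move=> /andP[v4 /eqP ?] /andP[v5 /eqP ?].
  by exists v; rewrite !inE !negb_or v1 v2 v3 v4 v5.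
have G6 u c a f g h k : u \notin five -> exists v, v != u /\ e v u = c /\ v \notin five /\
    [/\ e v xa = a, e v xF = f, e v xE = g, e v z = h & e v z' = k].
  move=> uN.
  have [|v] := @extension6P [:: (u, c); (xa, a); (xF, f); (xE, g); (z, h); (z', k)] ext isT.
    by rewrite /unzip1 [map _ _]/= cons_uniq uN.
  rewrite /= andbT => /andP[/andP[v0 /eqP ?]] /and5P[/andP[v1 /eqP ?] /andP[v2 /eqP ?] /andP[v3 /eqP ?]].
  move=> /andP[v4 /eqP ?] /andP[v5 /eqP ?].
  by exists v; rewrite !inE !negb_or v1 v2 v3 v4 v5.
(* [xa] joins [X] exactly when a full or empty member is wanted; the other members are then all
   adjacent ([fa]) or all nonadjacent ([ea]) to it. *)
pose ca := fa || ea.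
(* Agreeing on [z] and [z'] keeps a vertex out of [X] whatever its other adjacencies, whence
   tameness; the exclusive or also gives each of [z], [z'] both neighbours and nonneighbours in
   [X]. *)
pose X := [set v | if v \in five then (v == xa) && ca else
  [&& ca ==> (e v xa == fa), fb ==> e v xF, eb ==> ~~ e v xE & e v z (+) e v z']].
have inX v : v \notin five -> (v \in X) =
  [&& ca ==> (e v xa == fa), fb ==> e v xF, eb ==> ~~ e v xE & e v z (+) e v z'].
  by move=> vN; rewrite inE (negPf vN).
have in5 v : v \in five -> (v \in X) = (v == xa) && ca by move=> vN; rewrite inE vN.
have ne5 u v : u \in five -> v \notin five -> v != u.
  by move=> u5' /negP v5; apply/eqP => E; apply: v5; rewrite E.
have [m1 m2 m3 m4 m5] : [/\ xa \in five, xF \in five, xE \in five, z \in five & z' \in five].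
  by rewrite !inE !eqxx !orbT.
have tX : tame X.
  move=> x c; case: (boolP (x \in five)) => x5; last first.
    have [v [vx [evx [vN [_ _ _ vz vz']]]]] := @G6 x c true true true true true x5.
    by exists v; rewrite inX // vz vz' /= !andbF sym_e.
  have [v [v5 [V1 V2 V3 V4 V5]]] := @G5 c c c c c.
  exists v; split; first exact: ne5.
    by rewrite inX // V4 V5 addbb !andbF.
  rewrite sym_e; move: x5; rewrite !inE.
  by case/or4P=> [/eqP->|/eqP->|/eqP->|/orP[]/eqP->].
have out x : x \notin five -> rtype X x = (x \in X, false, false).
  move=> xN; congr (_, _, _); apply/negbTE.
    have [v [vx [evx [vN [v1 v2 v3 v4 v5]]]]] := @G6 x false fa true false true false xN.
    by apply/relFPn; exists v; rewrite vx sym_e evx inX // v1 v2 v3 v4 v5 eqxx /= !implybT.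
  have [v [vx [evx [vN [v1 v2 v3 v4 v5]]]]] := @G6 x true fa true false true false xN.
  by apply/relEPn; exists v; rewrite vx sym_e evx inX // v1 v2 v3 v4 v5 eqxx /= !implybT.
have notF x v : x \in five -> v \notin five -> v \in X -> e v x = false -> relF X x = false.
  by move=> x5 v5 vX evx; apply/negbTE/relFPn; exists v; rewrite vX sym_e evx ne5.
have notE x v : x \in five -> v \notin five -> v \in X -> e v x = true -> relE X x = false.
  by move=> x5 v5 vX evx; apply/negbTE/relEPn; exists v; rewrite vX sym_e evx ne5.
have rz : rtype X z = (false, false, false).
  have [v [v5 [V1 V2 V3 V4 V5]]] := @G5 fa true false true false.
  have [w [w5 [W1 W2 W3 W4 W5]]] := @G5 fa true false false true.
  rewrite /rtype in5 // (negPf z1) /= (notF z w) ?(notE z v) //.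
    by rewrite inX // V1 V2 V3 V4 V5 eqxx /= !implybT.
  by rewrite inX // W1 W2 W3 W4 W5 eqxx /= !implybT.
have rz' : rtype X z' = (false, false, false).
  have [v [v5 [V1 V2 V3 V4 V5]]] := @G5 fa true false true false.
  have [w [w5 [W1 W2 W3 W4 W5]]] := @G5 fa true false false true.
  rewrite /rtype in5 // (negPf y1) /= (notF z' v) ?(notE z' w) //.
    by rewrite inX // W1 W2 W3 W4 W5 eqxx /= !implybT.
  by rewrite inX // V1 V2 V3 V4 V5 eqxx /= !implybT.
have rF : rtype X xF = (false, fb, false).
  have [v [v5 [V1 V2 V3 V4 V5]]] := @G5 fa true false true false.
  have [w [w5 [W1 W2 W3 W4 W5]]] := @G5 fa false false false true.
  rewrite /rtype in5 // (negPf F1) /= (notE xF v) //; last first.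
    by rewrite inX // V1 V2 V3 V4 V5 eqxx /= !implybT.
  case: (boolP fb) => b; last first.
    by rewrite (notF xF w) // inX // (negPf b) W1 W2 W3 W4 W5 eqxx /= !implybT.
  congr (_, _, _); apply/relFP => y; case: (boolP (y \in five)) => y5'.
    by rewrite in5 // => /andP[/eqP-> _]; rewrite FF.
  by rewrite inX // b /= (sym_e xF) => /and4P[].
have rE : rtype X xE = (false, false, eb).
  have [v [v5 [V1 V2 V3 V4 V5]]] := @G5 fa true false true false.
  have [w [w5 [W1 W2 W3 W4 W5]]] := @G5 fa true true false true.
  rewrite /rtype in5 // (negPf E1) /= (notF xE v) //; last first.
    by rewrite inX // V1 V2 V3 V4 V5 eqxx /= !implybT.
  case: (boolP eb) => b; last first.
    by rewrite (notE xE w) // inX // (negPf b) W1 W2 W3 W4 W5 eqxx /= !implybT.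
  congr (_, _, _); apply/relEP => y; case: (boolP (y \in five)) => y5'.
    by rewrite in5 // => /andP[/eqP-> _]; rewrite EE.
  by rewrite inX // b /= (sym_e xE) => /and4P[].
have ra : rtype X xa = (ca, fa, ea).
  have [v [v5 [V1 V2 V3 V4 V5]]] := @G5 true true false true false.
  have [w [w5 [W1 W2 W3 W4 W5]]] := @G5 false true false false true.
  have caX y : ca -> y \in X -> y != xa -> e xa y = fa.
    move=> c; case: (boolP (y \in five)) => y5'; first by rewrite in5 // => /andP[-> _].
    by rewrite inX // c /= (sym_e xa) => /and4P[/eqP].
  rewrite /rtype in5 // eqxx /=; congr (_, _, _).
    case: (boolP fa) => b; last first.
      by apply: (notF xa w) => //; rewrite inX // W1 W2 W3 W4 W5 (negPf b) /= !implybT.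
    by apply/relFP => y yX yx; rewrite caX /ca ?b.
  case: (boolP ea) => b; last first.
    apply: (notE xa v) => //; rewrite inX // V1 V2 V3 V4 V5 /ca (negPf b) orbF /=.
    by case: (fa); rewrite /= !implybT.
  move: fea; rewrite b andbT => fa0.
  by apply/relEP => y yX yx; rewrite caX /ca ?b ?orbT // (negPf fa0).
exists X => // -[[c f] g]; split=> [[x]|].
  case: (boolP (x \in five)) => [|/out-> [<- <- <-] //].
  rewrite !inE; case/or4P=> [/eqP->|/eqP->|/eqP->|/orP[]/eqP->];
    rewrite ?rz ?rz' ?rF ?rE ?ra => -[<- <- <-] //=.
  - by move: fea; rewrite /ca; case: (fa); case: (ea).
  - by rewrite andbF; case: (fb).
  - by case: (eb).
have [v [v5 [V1 V2 V3 V4 V5]]] := @G5 fa true false true false.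
have vX : v \in X by rewrite inX // V1 V2 V3 V4 V5 eqxx /= !implybT.
case: c f g => [] [] [] //=; rewrite ?andbT ?implybT //= => b.
- by exists xa; rewrite ra /ca b; move: fea; rewrite b /= => /negPf->.
- by exists xa; rewrite ra /ca b orbT; move: fea; rewrite b andbT => /negPf->.
- by exists v; rewrite out // vX.
- by exists xF; rewrite rF b.
- by exists xE; rewrite rE b.
- by exists z.
Qed.

End Extension.

Lemma rtypes_vtypes (V V' : finType) (e : rel V) (e' : rel V') X X' :
  tame e X -> tame e' X' ->
  (forall t, (exists x, rtype e X x = t) <-> (exists x, rtype e' X' x = t)) ->
  vtypes e X = vtypes e' X'.
Proof.
move=> tX tX' H; apply/eqP; rewrite eqEsubset; apply/andP; split; apply: vtypes_sub => x.
  have [x' [xX xF xE]] := (H (rtype e X x)).1 (ex_intro _ x erefl).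
  by exists x'; rewrite !tame_vtype // xX xF xE.
have [x' [xX xF xE]] := (H (rtype e' X' x)).2 (ex_intro _ x erefl).
by exists x'; rewrite !tame_vtype // xX xF xE.
Qed.

(** * Empty sets, singletons and cliques *)

Section SmallSets.
Variables (V : finType) (e : rel V).
Hypotheses (sym_e : symmetric e) (irr_e : irreflexive e) (ext : extension6 e).

Lemma set0_rtypes : tame e set0 /\
  forall t, (exists x, rtype e set0 x = t) <-> t = (false, true, true).
Proof.
split=> [x c|t].
  by have [v [vx <-]] := ext1 ext x c; exists v; rewrite vx inE.
have r0 x : rtype e set0 x = (false, true, true).
  rewrite /rtype inE; congr (_, _, _); first by apply/relFP => y; rewrite inE.
  by apply/relEP => y; rewrite inE.
split=> [[x <-]|->]; first by rewrite r0.
by have [x _] := @extension6P _ e [::] ext isT isT; exists x; rewrite r0.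
Qed.

Lemma set1_rtypes x : tame e [set x] /\
  forall t, (exists y, rtype e [set x] y = t) <->
    t \in [:: (true, true, true); (false, true, false); (false, false, true)].
Proof.
split=> [y c|t].
  have [->|yx] := eqVneq y x.
    by have [v [vx <-]] := ext1 ext x c; exists v; rewrite vx inE.
  have [v [vy vx vc _]] := ext2 ext c c yx.
  by exists v; rewrite vy inE vx sym_e.
have rx : rtype e [set x] x = (true, true, true).
  rewrite /rtype inE eqxx; congr (_, _, _); first by apply/relFP => y; rewrite inE => ->.
  by apply/relEP => y; rewrite inE => ->.
have ry y : y != x -> rtype e [set x] y = (false, e y x, ~~ e y x).
  move=> yx; rewrite /rtype inE (negPf yx); congr (_, _, _).
    apply/relFP/idP => [H|exy z]; first by apply: H; rewrite ?inE // eq_sym.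
    by rewrite inE => /eqP->.
  apply/relEP/idP => [H|exy z]; first by apply: H; rewrite ?inE // eq_sym.
  by rewrite inE => /eqP->.
split=> [[y <-]|].
  by have [->|/ry->] := eqVneq y x; rewrite ?rx !inE //; case: (e y x).
have nb c : exists y, y != x /\ e y x = c by have [v [? ?]] := ext1 ext x c; exists v.
rewrite !inE => /or3P[]/eqP->; first by exists x.
  by have [y [yx E]] := nb true; exists y; rewrite ry // E.
by have [y [yx E]] := nb false; exists y; rewrite ry // E.
Qed.

(** With two members no vertex is both full and empty, and a mixed outside vertex always exists;
    only maximality and domination stay open. *)
Lemma clique_rtypes (X : {set V}) : (1 < #|X|)%N -> (forall x, x \in X -> relF e X x) ->
  tame e X /\ forall t, (exists x, rtype e X x = t) <->
    [|| t == (true, true, false), t == (false, false, false),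
        (t == (false, true, false)) && [exists z in ~: X, relF e X z] |
        (t == (false, false, true)) && [exists z in ~: X, relE e X z]].
Proof.
move=> X2 cl; have tX := clique_tame sym_e ext X2 cl; split=> // t.
have [x1 [x2 [x1X x2X x12]]] := card_gt1P X2.
have other y : exists x, x \in X /\ x != y.
  by have [<-|] := eqVneq x1 y; [exists x2; rewrite eq_sym|exists x1].
have FE y : relF e X y -> relE e X y = false.
  have [x [xX xy]] := other y.
  by move=> /relFP/(_ x xX xy) exy; apply/negbTE/relEPn; exists x.
split=> [[x <-]|].
  case: (boolP (x \in X)) => xX; first by rewrite /rtype xX cl // FE // cl.
  rewrite /rtype (negPf xX); case F: (relF e X x).
    by rewrite FE // !xpair_eqE /= orbF; apply/existsP; exists x; rewrite inE xX F.
  case E: (relE e X x) => //; rewrite !xpair_eqE /=.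
  by apply/existsP; exists x; rewrite inE xX E.
case/or4P=> [/eqP->|/eqP->|/andP[/eqP-> /existsP[x]]|/andP[/eqP-> /existsP[x]]].
- by exists x1; rewrite /rtype x1X cl // FE // cl.
- exact: (exists_mixed_outside sym_e ext tX x1X x2X x12).
- by rewrite inE => /andP[xX F]; exists x; rewrite /rtype (negPf xX) F FE.
rewrite inE => /andP[xX E]; exists x; rewrite /rtype (negPf xX) E.
by case F: (relF e X x) => //; rewrite FE in E.
Qed.

(** A single edge is a witness: its ends have a common neighbour and a common nonneighbour. *)
Lemma kclq_edge : kclq e true true.
Proof.
have [x _] := @extension6P _ e [::] ext isT isT.
have [y [yx exy]] := ext1 ext x true.
have xy : x != y by rewrite eq_sym.
have [u [ux uy eux euy]] := ext2 ext true true xy.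
have [w [wx wy ewx ewy]] := ext2 ext false false xy.
apply/existsP; exists [set x; y]; rewrite cards2 xy /=.
apply/and3P; split; rewrite ?eqb_id.
- apply/forall_inP => z; rewrite !inE => /orP[]/eqP->; apply/relFP => t;
    rewrite !inE => /orP[]/eqP->; rewrite ?eqxx //.
  by rewrite sym_e exy.
- apply/existsP; exists u; rewrite !inE negb_or ux uy /=.
  by apply/relFP => t; rewrite !inE => /orP[]/eqP->.
- apply/existsP; exists w; rewrite !inE negb_or wx wy /=.
  by apply/relEP => t; rewrite !inE => /orP[]/eqP->; rewrite ?ewx ?ewy.
Qed.

End SmallSets.

(** One bit [b] is enough since, away from p = (1 - p)^2, maximal and nonmaximal dominating cliques
    appear together or are both absent with high probability. The remaining kind is covered by
    [kclq_edge]. *)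
Definition kclq_typical (V : finType) (b : bool) (e : rel V) :=
  [&& extension6 e, kclq e false true, kclq e false false == b & kclq e true false == b].

Definition typical (V : finType) (b1 b2 : bool) (e : rel V) :=
  kclq_typical b1 e && kclq_typical b2 (crel e).

(** * Transfer of type sets between typical graphs *)

Section TypicalTransfer.
Variables (V V' : finType) (e : rel V) (e' : rel V').
Hypotheses (sym_e : symmetric e) (irr_e : irreflexive e).
Hypotheses (sym_e' : symmetric e') (irr_e' : irreflexive e').

Lemma clique_transfer b (X : {set V}) : kclq_typical b e -> kclq_typical b e' ->
  (1 < #|X|)%N -> (forall x, x \in X -> relF e X x) ->
  exists X', vtypes e X = vtypes e' X'.
Proof.
move=> /and4P[ext cFT /eqP cFF /eqP cTF] /and4P[ext' cFT' /eqP cFF' /eqP cTF'] X2 cl.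
have : kclq e [exists z in ~: X, relF e X z] [exists z in ~: X, relE e X z].
  by apply/existsP; exists X; rewrite X2 !eqxx !andbT; apply/forall_inP.
set b1 := [exists _ in _, _]; set b2 := [exists _ in _, _] => cX.
have : kclq e' b1 b2.
  move: cX; case: (b1); case: (b2) => //; first by rewrite (kclq_edge sym_e' ext').
  - by rewrite cTF cTF'.
  - by rewrite cFF cFF'.
move=> /existsP[X' /and4P[X2' /forall_inP cl' /eqP E1 /eqP E2]]; exists X'.
have [tX HX] := clique_rtypes sym_e ext X2 cl.
have [tX' HX'] := clique_rtypes sym_e' ext' X2' cl'.
apply: rtypes_vtypes => // t; apply: (iff_trans (HX t)); apply: iff_sym.
by apply: (iff_trans (HX' t)); rewrite E1 E2.
Qed.

End TypicalTransfer.

(** Beyond sets of size at most 1: if some member is mixed, [exists_flagged] realises the flags read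
    off from [X]. Otherwise every member is full or empty, the two kinds cannot coexist, and [X] is
    a clique or an independent set, the latter being a clique of the complement graph. *)
Lemma typical_transfer_tame (V V' : finType) (e : rel V) (e' : rel V')
    (b1 b2 : bool) (X : {set V}) :
  symmetric e -> irreflexive e -> symmetric e' -> irreflexive e' ->
  typical b1 b2 e -> typical b1 b2 e' -> tame e X ->
  exists X', vtypes e X = vtypes e' X'.
Proof.
move=> sym irr sym' irr' /andP[te tc] /andP[te' tc'] tX.
have ext : extension6 e by case/and4P: te.
have ext' : extension6 e' by case/and4P: te'.
have [X0|[x xX]] := set_0Vmem X.
  exists set0; rewrite X0; have [t0 H0] := set0_rtypes sym ext; have [t0' H0'] := set0_rtypes sym' ext'.
  by apply: rtypes_vtypes => // t; apply: (iff_trans (H0 t)); apply: iff_sym.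
have [X1|X2] := leqP #|X| 1.
  have -> : X = [set x] by apply/eqP; rewrite eq_sym eqEcard sub1set xX cards1 X1.
  have [x' _] := @extension6P _ e' [::] ext' isT isT; exists [set x'].
  have [t1 H1] := set1_rtypes sym ext x; have [t1' H1'] := set1_rtypes sym' ext' x'.
  by apply: rtypes_vtypes => // t; apply: (iff_trans (H1 t)); apply: iff_sym.
have [x1 [x2 [x1X x2X x12]]] := card_gt1P X2.
have other y : exists x, x \in X /\ x != y.
  by have [<-|] := eqVneq x1 y; [exists x2; rewrite eq_sym|exists x1].
have FE y : ~~ (relF e X y && relE e X y).
  apply/negP => /andP[/relFP F /relEP E]; have [z [zX zy]] := other y.
  by have := E _ zX zy; rewrite F.
have noFE a b : a \in X -> b \in X -> relF e X a -> relE e X b -> False.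
  move=> aX bX Fa Eb; have [E|ab] := eqVneq a b; first by move: (FE a); rewrite Fa E Eb.
  by move/relFP: Fa => /(_ b bX); rewrite eq_sym ab => /(_ isT); apply/negP;
     rewrite sym; move/relEP: Eb => /(_ a aX ab).
case: (boolP [exists a in X, ~~ relF e X a && ~~ relE e X a]) => [|/exists_inPn pure].
  move=> /exists_inP[a aX /andP[aF aE]].
  pose fa := [exists a in X, relF e X a]; pose ea := [exists a in X, relE e X a].
  pose fb := [exists a in ~: X, relF e X a]; pose eb := [exists a in ~: X, relE e X a].
  have fea : ~~ (fa && ea).
    by apply/negP => /andP[/exists_inP[u uX uF] /exists_inP[w wX wE]]; apply: (noFE u w).
  have [X' tX' HX'] := exists_flagged sym' ext' fb eb fea.
  exists X'; apply: rtypes_vtypes => // t; apply: iff_sym; apply: (iff_trans (HX' t)).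
  case: t => -[c f] g; split=> /= [|[z [<- <- <-]]]; last first.
    rewrite FE /=; apply/andP; split; apply/implyP => H; case: ifP => zX;
      by apply/exists_inP; exists z; rewrite ?inE ?zX.
  case: c f g => [] [] [] //=; rewrite ?andbT //=.
  - move=> /exists_inP[z zX zF]; exists z; rewrite /rtype zX zF.
    by move: (FE z); rewrite zF /= => /negPf->.
  - move=> /exists_inP[z zX zE]; exists z; rewrite /rtype zX zE.
    by move: (FE z); rewrite zE andbT => /negPf->.
  - by move=> _; exists a; rewrite /rtype aX (negPf aF) (negPf aE).
  - move=> /exists_inP[z]; rewrite inE => zX zF; exists z; rewrite /rtype (negPf zX) zF.
    by move: (FE z); rewrite zF /= => /negPf->.
  - move=> /exists_inP[z]; rewrite inE => zX zE; exists z; rewrite /rtype (negPf zX) zE.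
    by move: (FE z); rewrite zE andbT => /negPf->.
  - by move=> _; apply: (exists_mixed_outside sym ext tX x1X x2X x12).
have {}pure a : a \in X -> relF e X a || relE e X a.
  by move=> /pure; rewrite negb_and !negbK.
have [F1|E1] := orP (pure _ x1X).
  apply: (@clique_transfer _ _ e e' sym sym' b1) => // a aX.
  by have [//|Ea] := orP (pure _ aX); case: (noFE x1 a).
have [X' HX'] : exists X', vtypes (crel e) X = vtypes (crel e') X'.
  apply: (@clique_transfer _ _ _ _ (crel_sym sym) (crel_sym sym') b2) => // a aX.
  have [Fa|/relEP Ea] := orP (pure _ aX); first by case: (noFE a x1).
  by apply/relFP => y yX ya; rewrite /crel /= eq_sym ya Ea.
exists X'; rewrite -(eq_vtypes X (crelK irr)) -(eq_vtypes X' (crelK irr')).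
by rewrite [LHS]vtypes_crel HX' -vtypes_crel.
Qed.

Lemma typical_transfer (V V' : finType) (e : rel V) (e' : rel V')
    (b1 b2 : bool) (X : {set V}) :
  symmetric e -> irreflexive e -> symmetric e' -> irreflexive e' ->
  typical b1 b2 e -> typical b1 b2 e' -> exists X', vtypes e X = vtypes e' X'.
Proof.
move=> sym irr sym' irr' te te'.
have ext : extension6 e by case/andP: te => /and4P[].
have ext' : extension6 e' by case/andP: te' => /and4P[].
have [tX|[tX|[x [d HX]]]] := tame_trichotomy sym ext X.
- exact: (typical_transfer_tame sym irr sym' irr' te te' tX).
- have [X' HX'] := typical_transfer_tame sym irr sym' irr' te te' tX.
  by exists (~: X'); rewrite vtypes_setC -HX' -vtypes_setC setCK.
have [x' _] := @extension6P _ e' [::] ext' isT isT.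
(* Any vertex [x'] will do, since the types depend only on [d] and on the membership of the
   centre. *)
pose X' := [set y | if y == x' then x \in X else e' x' y == d].
exists X'; rewrite (vtypes_neighborhood sym ext HX) (@vtypes_neighborhood _ _ sym' ext' X' x' d).
  by rewrite inE eqxx.
by move=> y yx; rewrite inE (negPf yx).
Qed.

Lemma adj_sym n (E : {set 'I_n * 'I_n}) : symmetric (adj E).
Proof. by move=> x y; rewrite /adj orbC. Qed.

Lemma adj_irr n (E : {set 'I_n * 'I_n}) : E \subset pairs n -> irreflexive (adj E).
Proof.
move=> sE x; rewrite /adj orbb; apply/negbTE/negP => /(subsetP sE).
by rewrite inE ltnn.
Qed.

Lemma typical_models n n' (E : {set 'I_n * 'I_n}) (E' : {set 'I_n' * 'I_n'}) b1 b2 phi :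
  E \subset pairs n -> E' \subset pairs n' ->
  typical b1 b2 (adj E) -> typical b1 b2 (adj E') -> E12 phi ->
  models_E12 E phi -> models_E12 E' phi.
Proof.
move=> sE sE' tE tE' /andP[clo dep] /existsP[X]; rewrite eval_reval => HX.
have [X' E1] := typical_transfer X (adj_sym E) (adj_irr sE) (adj_sym E') (adj_irr sE') tE tE'.
apply/existsP; exists X'; rewrite eval_reval -(reval_depth2 _ _ _ _ E1) //;
  by [exact: adj_sym | exact: adj_irr].
Qed.

Local Open Scope ring_scope.

(** * Random subsets *)

Section RandomSubset.
Variables (R : realType) (T : finType) (p : R).

Definition mu (E : {set T}) : R := \prod_(e : T) (if e \in E then p else 1 - p).

Definition Pr (Q : pred {set T}) : R := \sum_(E | Q E) mu E.

Lemma Pr_pattern (A B : {set T}) : [disjoint A & B] ->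
  Pr (fun E => (A \subset E) && [disjoint B & E]) = p ^+ #|A| * (1 - p) ^+ #|B|.
Proof.
move=> dAB.
transitivity (\sum_(E : {set T}) \prod_(e : T)
    (if e \in E then (if e \in B then 0 else p) else (if e \in A then 0 else 1 - p))).
  rewrite /Pr big_mkcond; apply: eq_bigr => E _; case: ifP => [/andP[AE BE]|].
    apply: eq_bigr => e _; case: ifP => eE.
      by case: ifP => // eB; move: (disjointFr BE eB); rewrite eE.
    by case: ifP => // /(subsetP AE); rewrite eE.
  move=> /negbT; rewrite negb_and => /orP[/subsetPn[e eA eE]|].
    by rewrite (bigD1 e) //= (negPf eE) eA mul0r.
  rewrite -setI_eq0 => /set0Pn[e]; rewrite inE => /andP[eB eE].
  by rewrite (bigD1 e) //= eB eE mul0r.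
rewrite -bigA_distr.
transitivity (\prod_(e : T) ((if e \in A then p else 1) * (if e \in B then 1 - p else 1))).
  apply: eq_bigr => e _ /=; case: ifP => eB; case: ifP => eA; rewrite ?mulr1 ?mul1r ?addr0 ?add0r //.
    by move: (disjointFr dAB eA); rewrite eB.
  by rewrite addrC subrK.
by rewrite big_split /= -!big_mkcond !prodr_const.
Qed.

Lemma Pr_predT : Pr xpredT = 1.
Proof.
rewrite -[RHS](_ : p ^+ #|@set0 T| * (1 - p) ^+ #|@set0 T| = 1); last by rewrite cards0 mulr1.
rewrite -Pr_pattern ?disjoint0 //; last by rewrite -setI_eq0 setI0.
apply: eq_bigl => E; rewrite sub0set; apply/esym; rewrite -setI_eq0 set0I eqxx //.
Qed.

Definition depends (S : {set T}) (Q : pred {set T}) := forall E, Q (E :&: S) = Q E.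

Lemma dependsE (S E F : {set T}) Q : depends S Q -> E :&: S = F :&: S -> Q E = Q F.
Proof. by move=> dQ EF; rewrite -dQ EF dQ. Qed.

Lemma dependsS (S S' : {set T}) Q : S \subset S' -> depends S Q -> depends S' Q.
Proof. by move=> sS dQ E; apply: (dependsE dQ); rewrite -setIA (setIidPr sS). Qed.

Lemma eq_Pr Q Q' : Q =1 Q' -> Pr Q = Pr Q'.
Proof. exact: eq_bigl. Qed.

(* Exchanging the two configurations inside [S] preserves the product measure. *)
Lemma Pr_indep (S S' : {set T}) Q Q' : depends S Q -> depends S' Q' -> [disjoint S & S'] ->
  Pr (fun E => Q E && Q' E) = Pr Q * Pr Q'.
Proof.
move=> dQ dQ' dS; rewrite /Pr big_distrl /=.
under [RHS]eq_bigr do rewrite big_distrr /=.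
rewrite pair_big /=.
pose h (EF : {set T} * {set T}) :=
  ((EF.1 :&: S) :|: (EF.2 :\: S), (EF.2 :&: S) :|: (EF.1 :\: S)).
have hK : involutive h.
  move=> [E F]; rewrite /h /=; congr pair; apply/setP => x; rewrite !inE;
  by case: (x \in S); rewrite ?andbF ?andbT ?orbF ?orbT.
rewrite (reindex_inj (inv_inj hK)) /=.
transitivity (\sum_(EF : {set T} * {set T} | Q EF.1 && Q' EF.1) mu EF.1 * mu EF.2).
  transitivity (\sum_(E | Q E && Q' E) \sum_F mu E * mu F).
    by apply: eq_bigr => E _; rewrite -big_distrr /= -/(Pr xpredT) Pr_predT mulr1.
  by rewrite pair_big /=; apply: eq_bigl => EF; rewrite andbT.
apply: eq_big => [[E F]|[E F] _] /=.
  congr andb.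
    apply: (dependsE dQ); apply/setP => x; rewrite !inE.
    by case: (x \in S); rewrite ?andbF ?andbT ?orbF ?orbT.
  apply: (dependsE dQ'); apply/setP => x; rewrite !inE.
  case: (boolP (x \in S')) => xS'; rewrite ?andbF // !andbT.
  by rewrite (disjointFl dS xS') !andbF.
rewrite /mu -!big_split; apply: eq_bigr => x _ /=; rewrite !inE.
by case: (x \in S); rewrite ?andbF ?andbT ?orbF // mulrC.
Qed.

Lemma depends_all (I : eqType) (r : seq I) (S : {set T}) (Q : I -> pred {set T}) :
  (forall i, i \in r -> depends S (Q i)) -> depends S (fun E => all (Q^~ E) r).
Proof.
elim: r => // i r IH dQ E /=; rewrite dQ ?mem_head //; congr andb.
by apply: IH => j jr; apply: dQ; rewrite inE jr orbT.
Qed.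

Lemma Pr_indep_all (I : eqType) (r : seq I) (S : I -> {set T}) (Q : I -> pred {set T}) :
  uniq r -> (forall i, i \in r -> depends (S i) (Q i)) ->
  (forall i j, i \in r -> j \in r -> i != j -> [disjoint S i & S j]) ->
  Pr (fun E => all (Q^~ E) r) = \prod_(i <- r) Pr (Q i).
Proof.
elim: r => [|i r IH] /=; first by rewrite big_nil Pr_predT.
move=> /andP[ir ur] dQ dS; rewrite big_cons -IH //; first last.
- by move=> a b ar br; apply: dS; rewrite inE ?ar ?br orbT.
- by move=> a ar; apply: dQ; rewrite inE ar orbT.
apply: (@Pr_indep (S i) [set x | has (fun j => x \in S j) r]).
- by apply: dQ; rewrite mem_head.
- apply: depends_all => j jr; apply: (@dependsS (S j)); last by apply: dQ; rewrite inE jr orbT.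
  by apply/subsetP => x xj; rewrite inE; apply/hasP; exists j.
- apply/pred0P => x /=; apply/negbTE/negP => /andP[xi]; rewrite inE => /hasP[j jr xj].
  have /disjointFr/(_ xi) : [disjoint S i & S j].
    by apply: dS; rewrite ?mem_head ?inE ?jr ?orbT //; apply: contraNneq ir => ->.
  by rewrite xj.
Qed.

Hypotheses (p0 : 0 <= p) (p1 : p <= 1).

Lemma mu_ge0 E : 0 <= mu E.
Proof. by apply: prodr_ge0 => e _; case: ifP => _ //; rewrite subr_ge0. Qed.

Lemma Pr_ge0 Q : 0 <= Pr Q.
Proof. by apply: sumr_ge0 => E _; exact: mu_ge0. Qed.

Lemma le_Pr (Q Q' : pred {set T}) : (forall E, Q E -> Q' E) -> Pr Q <= Pr Q'.
Proof.
move=> QQ'; rewrite /Pr big_mkcond [leRHS]big_mkcond; apply: ler_sum => E _.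
by case: ifP => [/QQ'->//|_]; case: ifP => _ //; exact: mu_ge0.
Qed.

Lemma Pr_le1 Q : Pr Q <= 1.
Proof. by rewrite -Pr_predT; apply: le_Pr. Qed.

Lemma PrC Q : Pr (fun E => ~~ Q E) = 1 - Pr Q.
Proof. by rewrite -Pr_predT /Pr [in RHS](bigID Q) /= addrC addrK. Qed.

Lemma Pr_cup (I : finType) (P : pred I) (A : I -> pred {set T}) (Q : pred {set T}) :
  (forall E, Q E -> exists2 i, P i & A i E) -> Pr Q <= \sum_(i | P i) Pr (A i).
Proof.
move=> QA; under eq_bigr do rewrite /Pr big_mkcond; rewrite exchange_big /=.
rewrite /Pr big_mkcond; apply: ler_sum => E _.
have ge0 : 0 <= \sum_(i | P i) (if A i E then mu E else 0).
  by apply: sumr_ge0 => i _; case: ifP => // _; exact: mu_ge0.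
case: ifP => // /QA[i Pi AiE]; rewrite (bigD1 i) //= AiE lerDl.
by apply: sumr_ge0 => j _; case: ifP => // _; exact: mu_ge0.
Qed.

Lemma Pr_cup2 (A B Q : pred {set T}) :
  (forall E, Q E -> A E || B E) -> Pr Q <= Pr A + Pr B.
Proof.
move=> QA; have := @Pr_cup bool xpredT (fun b => if b then A else B) Q.
rewrite big_bool; apply=> E /QA/orP[]; [by exists true|by exists false].
Qed.

Lemma Pr_diff (A B : pred {set T}) :
  Pr A - Pr (fun E => A E && B E) <= Pr (fun E => A E && ~~ B E).
Proof.
by rewrite lerBlDr; apply: Pr_cup2 => E ->; case: (B E).
Qed.

(** Cauchy-Schwarz for the number of occurring events and the indicator that it is positive; the
    product form avoids a division by the second moment. *)
Lemma Pr_second_moment (I : finType) (P : pred I) (A : I -> pred {set T}) :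
  (\sum_(i | P i) Pr (A i)) ^+ 2 <=
  Pr (fun E => [exists i, P i && A i E]) *
  \sum_(i | P i) \sum_(j | P j) Pr (fun E => A i E && A j E).
Proof.
pose Z (E : {set T}) : R := \sum_(i | P i) (A i E)%:R.
have E1 : \sum_(i | P i) Pr (A i) = \sum_E mu E * Z E.
  under eq_bigr do rewrite /Pr big_mkcond.
  rewrite exchange_big; apply: eq_bigr => E _ /=; rewrite /Z big_distrr /=.
  by apply: eq_bigr => i _; case: (A i E); rewrite ?mulr1 ?mulr0.
have E2 : \sum_(i | P i) \sum_(j | P j) Pr (fun E => A i E && A j E) = \sum_E mu E * Z E ^+ 2.
  transitivity (\sum_(i | P i) \sum_E \sum_(j | P j) mu E * ((A i E)%:R * (A j E)%:R)).
    apply: eq_bigr => i _; rewrite exchange_big; apply: eq_bigr => j _; rewrite /Pr big_mkcond.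
    by apply: eq_bigr => E _; case: (A i E); case: (A j E); rewrite ?mulr1 ?mul1r ?mulr0.
  rewrite exchange_big; apply: eq_bigr => E _ /=; rewrite expr2 /Z big_distrl big_distrr /=.
  by apply: eq_bigr => i _; rewrite !big_distrr.
rewrite E1 E2; pose Q (E : {set T}) := [exists i, P i && A i E]; rewrite -/Q.
have Z0 E : ~~ Q E -> Z E = 0.
  move=> /existsPn H; apply: big1 => i Pi; move: (H i); rewrite Pi /= => /negPf->; by [].
pose M1 := \sum_E mu E * Z E; pose M2 := \sum_E mu E * Z E ^+ 2.
have M20 : 0 <= M2 by apply: sumr_ge0 => E _; rewrite mulr_ge0 ?mu_ge0 ?sqr_ge0.
(* nonnegativity of [\sum mu * (a Z - b 1_Q)^2], at [a = Pr Q] and [b = M1] *)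
have key a b : 0 <= a ^+ 2 * M2 - 2 * a * b * M1 + b ^+ 2 * Pr Q.
  have -> : a ^+ 2 * M2 - 2 * a * b * M1 + b ^+ 2 * Pr Q =
      \sum_E mu E * (a * Z E - b * (Q E)%:R) ^+ 2.
    rewrite /M1 /M2 /Pr (big_mkcond Q) !big_distrr -sumrB -big_split /=.
    apply: eq_bigr => E _; case: (boolP (Q E)) => [_|/Z0->]; rewrite /=; ring.
  by apply: sumr_ge0 => E _; rewrite mulr_ge0 ?mu_ge0 ?sqr_ge0.
have [Q0|Qn0] := eqVneq (Pr Q) 0.
  rewrite -/M1; suff -> : M1 = 0 by rewrite Q0 expr0n mul0r.
  apply: big1 => E _; case: (boolP (Q E)) => [QE|/Z0->]; last by rewrite mulr0.
  have /eqP := Q0; rewrite /Pr psumr_eq0; last by move=> *; exact: mu_ge0.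
  by move=> /allP/(_ E (mem_index_enum _)); rewrite QE /= => /eqP->; rewrite mul0r.
have Qp : 0 < Pr Q by rewrite lt_neqAle eq_sym Qn0 Pr_ge0.
have := key (Pr Q) M1; rewrite -/M1 -/M2 => k.
by rewrite -subr_ge0 -(pmulr_rge0 _ Qp); lra.
Qed.

End RandomSubset.

Lemma Pr_setC (R : realType) (T : finType) (p : R) (Q : pred {set T}) :
  Pr p (fun E => Q (~: E)) = Pr (1 - p) Q.
Proof.
rewrite /Pr [RHS](reindex_inj (inv_inj (@setCK T))); apply: eq_bigr => E _.
by apply: eq_bigr => x _; rewrite inE; case: (x \in E); rewrite //= opprB addrC subrK.
Qed.

(** * The random graph *)

Section GraphEdges.
Variable n : nat.
Implicit Types (x y w : 'I_n) (C D : {set 'I_n}) (E : {set 'I_n * 'I_n}).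

Definition edge x y : 'I_n * 'I_n := if (x < y)%N then (x, y) else (y, x).

(** Only the coin of the increasing pair is read, so complementing [E] within all ordered pairs
    gives exactly the complement graph. *)
Definition gadj E : rel 'I_n := [rel x y | (x != y) && (edge x y \in E)].

Lemma edgeC x y : edge x y = edge y x.
Proof. by rewrite /edge; case: ltngtP => // /val_inj->. Qed.

Lemma edge_eq x y x' y' : edge x y = edge x' y' ->
  (x = x' /\ y = y') \/ (x = y' /\ y = x').
Proof. by rewrite /edge; case: ifP; case: ifP => _ _ [-> ->]; [left|right|right|left]. Qed.

Lemma edge_in_pairs x y : x != y -> edge x y \in pairs n.
Proof.
move=> xy; rewrite /edge; case: ltngtP => [lt|lt|/val_inj/eqP]; rewrite ?inE //.
by rewrite (negPf xy).
Qed.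

Lemma gadj_sym E : symmetric (gadj E).
Proof. by move=> x y; rewrite /gadj /= eq_sym edgeC. Qed.

Lemma gadj_irr E : irreflexive (gadj E).
Proof. by move=> x; rewrite /gadj /= eqxx. Qed.

Lemma adj_gadj E : adj (E :&: pairs n) = gadj E.
Proof.
apply/funext => x; apply/funext => y; rewrite /adj /gadj /edge /= !inE /=.
by case: (ltngtP x y) => [lt|lt|/val_inj->]; rewrite ?andbT ?andbF ?orbF ?eqxx //=;
   [rewrite neq_ltn lt|rewrite neq_ltn lt orbT].
Qed.

Lemma gadj_setC E : gadj (~: E) = crel (gadj E).
Proof.
apply/funext => x; apply/funext => y; rewrite /crel /gadj /= inE.
by case: (x != y).
Qed.

Definition edges D : {set 'I_n * 'I_n} := [set a in pairs n | (a.1 \in D) && (a.2 \in D)].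

Definition star w D : {set 'I_n * 'I_n} := [set edge w x | x in D].

Lemma edge_edges x y D : x != y -> (edge x y \in edges D) = (x \in D) && (y \in D).
Proof.
move=> xy; rewrite inE edge_in_pairs //= /edge.
by case: ifP => _ //=; rewrite andbC.
Qed.

Lemma edgesI C D : edges C :&: edges D = edges (C :&: D).
Proof.
apply/setP => a; rewrite !inE; case: (_ < _)%N => //=.
by case: (a.1 \in C); case: (a.2 \in C); rewrite //= andbF.
Qed.

Lemma card_edges D : #|edges D| = 'C(#|D|, 2).
Proof.
rewrite -cards_draws.
pose f (a : 'I_n * 'I_n) := [set a.1; a.2].
rewrite -(@card_in_imset _ _ f (edges D)); last first.
  move=> [a b] [c d]; rewrite !inE /= => /andP[ab _] /andP[cd _] E; move/setP: E => E.
  have := E a; have := E b; have := E c; rewrite !inE !eqxx ?orbT /= => /esym E1 /esym E2 /esym E3.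
  case/orP: E3 => /eqP E3; case/orP: E2 => /eqP E2; subst; rewrite ?ltnn // in ab cd *.
  by move: (ltn_trans ab cd); rewrite ltnn.
apply: eq_card => B; rewrite [RHS]inE; apply/imsetP/idP => [[[a b]]|/andP[BD /cards2P[a [b [ab EB]]]]].
  rewrite !inE /= => /andP[ab /andP[aD bD]] ->; rewrite /f cards2 subUset !sub1set aD bD /=.
  by rewrite neq_ltn ab.
rewrite EB; move: BD; rewrite EB subUset !sub1set => /andP[aD bD].
exists (edge a b); first by rewrite edge_edges // aD bD.
by rewrite /f /edge; case: ifP => _ //=; rewrite setUC.
Qed.

Lemma card_star w D : #|star w D| = #|D|.
Proof. by apply: card_imset => x y /edge_eq[[]//|[-> ->]]. Qed.

Lemma star_sub w C D : D \subset C -> star w D \subset star w C.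
Proof. exact: imsetS. Qed.

Lemma starU w C D : star w (C :|: D) = star w C :|: star w D.
Proof. exact: imsetU. Qed.

Lemma star_edges w C : w \notin C -> [disjoint star w C & edges C].
Proof.
move=> wC; apply/pred0P => a /=; apply/negbTE/negP => /andP[/imsetP[x xC ->]].
by rewrite edge_edges ?(negPf wC) //; apply: contraNneq wC => ->.
Qed.

Lemma star_star w w' C : w \notin C -> w != w' -> [disjoint star w C & star w' C].
Proof.
move=> wC ww'; apply/pred0P => a /=; apply/negbTE/negP => /andP[/imsetP[x xC ->]].
case/imsetP=> x' xC' /edge_eq[[E _]|[E _]]; first by rewrite E eqxx in ww'.
by rewrite E xC' in wC.
Qed.

Lemma relF_star E w D : w \notin D -> relF (gadj E) D w = (star w D \subset E).
Proof.
move=> wD; have ne x : x \in D -> x != w by move=> xD; apply: contraNneq wD => <-.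
apply/relFP/subsetP => [H a /imsetP[x xD ->]|H x xD xw].
  by have /andP[] := H x xD (ne x xD).
by rewrite /gadj /= eq_sym xw; apply: H; apply: imset_f.
Qed.

Lemma relE_star E w D : w \notin D -> relE (gadj E) D w = [disjoint star w D & E].
Proof.
move=> wD; have ne x : x \in D -> x != w by move=> xD; apply: contraNneq wD => <-.
rewrite disjoints_subset; apply/relEP/subsetP => [H a /imsetP[x xD ->]|H x xD xw].
  by have := H x xD (ne x xD); rewrite /gadj /= eq_sym (ne x xD) inE.
rewrite /gadj /= eq_sym xw /=; have := H (edge w x); rewrite inE; apply; exact: imset_f.
Qed.

Lemma clique_edges E D : [forall x in D, relF (gadj E) D x] = (edges D \subset E).
Proof.
apply/forall_inP/subsetP => [H [a b]|H x xD].
  rewrite !inE /= => /andP[ab /andP[aD bD]]; move/relFP: (H a aD) => /(_ b bD).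
  have ba : b != a by rewrite neq_ltn ab orbT.
  by move=> /(_ ba) /andP[_]; rewrite /edge ab.
apply/relFP => y yD yx; rewrite /gadj /= eq_sym yx /=; apply: H.
by rewrite edge_edges ?xD // eq_sym.
Qed.

End GraphEdges.

Lemma depends_sub (T : finType) (A : {set T}) : depends A (fun E => A \subset E).
Proof. by move=> E; rewrite subsetI subxx andbT. Qed.

Lemma depends_disjoint (T : finType) (A : {set T}) : depends A (fun E => [disjoint A & E]).
Proof. by move=> E; rewrite -!setI_eq0 [in RHS]setIC setICA setIid. Qed.

Lemma dependsN (T : finType) (S : {set T}) Q : depends S Q -> depends S (fun E => ~~ Q E).
Proof. by move=> dQ E; rewrite dQ. Qed.

Lemma dependsA (T : finType) (S : {set T}) Q Q' :
  depends S Q -> depends S Q' -> depends S (fun E => Q E && Q' E).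
Proof. by move=> dQ dQ' E; rewrite dQ dQ'. Qed.

Lemma card_setC_ord n (C : {set 'I_n}) : #|~: C| = (n - #|C|)%N.
Proof. by rewrite cardsCs setCK card_ord. Qed.

Section GraphProb.
Variables (R : realType) (n : nat) (p : R).
Implicit Types (x y w : 'I_n) (C D : {set 'I_n}) (E : {set 'I_n * 'I_n}).

Lemma Pr_sub (A : {set 'I_n * 'I_n}) : Pr p (fun E => A \subset E) = p ^+ #|A|.
Proof.
have := @Pr_pattern R _ p A set0; rewrite cards0 mulr1 => <-; last by rewrite -setI_eq0 setI0.
by apply: eq_Pr => E; rewrite -setI_eq0 set0I eqxx andbT.
Qed.

Lemma Pr_disjoint (B : {set 'I_n * 'I_n}) : Pr p (fun E => [disjoint B & E]) = (1 - p) ^+ #|B|.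
Proof.
have := @Pr_pattern R _ p set0 B; rewrite cards0 mul1r => <-; last by rewrite -setI_eq0 set0I.
by apply: eq_Pr => E; rewrite sub0set.
Qed.

(** The edges inside [C] and the stars from distinct outside vertices use disjoint sets of coins. *)
Lemma Pr_stars C (F : {set 'I_n * 'I_n}) (Q : 'I_n -> pred {set 'I_n * 'I_n}) :
  F \subset edges C -> (forall w, w \notin C -> depends (star w C) (Q w)) ->
  Pr p (fun E => (F \subset E) && [forall w in ~: C, Q w E]) =
  p ^+ #|F| * \prod_(w in ~: C) Pr p (Q w).
Proof.
move=> FC dQ; have mC w : w \in enum (~: C) -> w \notin C by rewrite mem_enum inE.
have -> : \prod_(w in ~: C) Pr p (Q w) = Pr p (fun E => all (Q^~ E) (enum (~: C))).
  rewrite (@Pr_indep_all _ _ _ _ _ (fun w => star w C)) ?enum_uniq //.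
  - by rewrite big_enum.
  - by move=> w /mC; apply: dQ.
  - by move=> w w' /mC wC /mC w'C ww'; apply: star_star.
rewrite -Pr_sub -(@Pr_indep _ _ _ (edges C) (~: edges C)).
- apply: eq_Pr => E; congr andb; apply/forall_inP/allP => H w.
    by rewrite mem_enum; apply: H.
  by move=> wC; apply: H; rewrite mem_enum.
- exact: dependsS (@depends_sub _ F).
- apply: depends_all => w /mC wC; apply: (@dependsS _ (star w C)); last exact: dQ.
  by rewrite -disjoints_subset star_edges.
- by rewrite disjoints_subset setCK.
Qed.

Lemma depends_relE D w C : D \subset C -> w \notin C ->
  depends (star w C) (fun E => relE (gadj E) D w).
Proof.
move=> DC wC; have wD : w \notin D by apply: contraNN wC; apply: (subsetP DC).
apply: (@dependsS _ (star w D)); first exact: star_sub.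
by move=> E; rewrite !relE_star //; apply: depends_disjoint.
Qed.

Lemma Pr_relE D w : w \notin D -> Pr p (fun E => relE (gadj E) D w) = (1 - p) ^+ #|D|.
Proof.
by move=> wD; rewrite -(card_star w) -Pr_disjoint; apply: eq_Pr => E; rewrite relE_star.
Qed.

Lemma Pr_relF D w : w \notin D -> Pr p (fun E => relF (gadj E) D w) = p ^+ #|D|.
Proof.
by move=> wD; rewrite -(card_star w) -Pr_sub; apply: eq_Pr => E; rewrite relF_star.
Qed.

(** [C] may exceed [D]: for a nonmaximal clique [D] extended to a clique [C], only vertices outside
    [C] remain to be dominated, and their stars are independent of the edges of [C]. *)
Definition dominates D C E := [forall w in ~: C, ~~ relE (gadj E) D w].

Lemma Pr_clique_dominates C D : D \subset C ->
  Pr p (fun E => (edges C \subset E) && dominates D C E) =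
  p ^+ 'C(#|C|, 2) * (1 - (1 - p) ^+ #|D|) ^+ (n - #|C|).
Proof.
move=> DC; rewrite (@Pr_stars C (edges C) (fun w E => ~~ relE (gadj E) D w)) //; last first.
  by move=> w wC; apply: dependsN; apply: depends_relE.
rewrite card_edges; congr (_ * _).
rewrite (eq_bigr (fun=> 1 - (1 - p) ^+ #|D|)); last first.
  move=> w; rewrite inE => wC; rewrite PrC Pr_relE //.
  by apply: contraNN wC; apply: (subsetP DC).
by rewrite prodr_const card_setC_ord.
Qed.

(** Each outside vertex contributes an inclusion-exclusion factor, since having no neighbour in [D]
    nor in [D'] means having none in the union. Common edges of the cliques count once. *)
Lemma Pr_clique_dominates2 C D C' D' : D \subset C -> D' \subset C' ->
  Pr p (fun E => [&& edges C \subset E, edges C' \subset E &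
                   dominates D (C :|: C') E && dominates D' (C :|: C') E]) =
  p ^+ ('C(#|C|, 2) + 'C(#|C'|, 2) - 'C(#|C :&: C'|, 2)) *
  (1 - (1 - p) ^+ #|D| - (1 - p) ^+ #|D'| + (1 - p) ^+ #|D :|: D'|) ^+ (n - #|C :|: C'|).
Proof.
move=> DC DC'.
have DU : D \subset C :|: C' by apply: subset_trans DC (subsetUl _ _).
have DU' : D' \subset C :|: C' by apply: subset_trans DC' (subsetUr _ _).
have notin (A : {set 'I_n}) w : A \subset C :|: C' -> w \notin C :|: C' -> w \notin A.
  by move=> sA; apply: contraNN; apply: (subsetP sA).
rewrite (@eq_Pr _ _ _ _ (fun E => (edges C :|: edges C' \subset E) &&
   [forall w in ~: (C :|: C'), ~~ relE (gadj E) D w && ~~ relE (gadj E) D' w])); last first.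
  move=> E; rewrite subUset -andbA; do 2!congr andb.
  rewrite /dominates; apply/andP/forall_inP => [[/forall_inP H1 /forall_inP H2] w wC|H].
    by rewrite H1 ?H2.
  by split; apply/forall_inP => w wC; case/andP: (H w wC).
rewrite (@Pr_stars (C :|: C') _ (fun w E => ~~ relE (gadj E) D w && ~~ relE (gadj E) D' w)).
- rewrite cardsU edgesI !card_edges; congr (_ * _).
  rewrite (eq_bigr (fun=> 1 - (1 - p) ^+ #|D| - (1 - p) ^+ #|D'| + (1 - p) ^+ #|D :|: D'|)).
    by rewrite prodr_const card_setC_ord.
  move=> w; rewrite inE => wC; have wD := notin _ _ DU wC; have wD' := notin _ _ DU' wC.
  have wDD : w \notin D :|: D' by rewrite inE negb_or wD wD'.
  have H1 := Pr_relE wD; have H2 := Pr_relE wD'; have H3 := Pr_relE wDD.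
  have E12 E : relE (gadj E) (D :|: D') w = relE (gadj E) D w && relE (gadj E) D' w.
    by rewrite !relE_star // starU -!setI_eq0 setIUl setU_eq0.
  have U : Pr p (fun E => relE (gadj E) D w || relE (gadj E) D' w) =
      (1 - p) ^+ #|D| + (1 - p) ^+ #|D'| - (1 - p) ^+ #|D :|: D'|.
    rewrite -H1 -H2 -H3 /Pr.
    rewrite [X in _ = X + _ - _](bigID (fun E => relE (gadj E) D' w)) /=.
    rewrite [X in _ = _ - X](eq_bigl _ _ (E12)) addrAC [X in _ = X + _]addrAC subrr add0r.
    rewrite (bigID (fun E => relE (gadj E) D' w)) /= addrC; congr (_ + _); apply: eq_bigl => E.
      by case: (relE (gadj E) D w); case: (relE (gadj E) D' w).
    by case: (relE (gadj E) D w); case: (relE (gadj E) D' w).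
  under eq_Pr do rewrite -negb_or.
  by rewrite PrC U; ring.
- by rewrite subUset; apply/andP; split; apply/subsetP => a; rewrite !inE => /and3P[-> -> ->];
    rewrite ?orbT.
- by move=> w wC; apply: dependsA; apply: dependsN; apply: depends_relE.
Qed.

End GraphProb.

(** Sets are grouped by their trace on [pairs n]; the other coins contribute total mass 1. *)
Lemma probE12_Pr (p : R) phi n :
  probE12 p phi n = Pr p (fun E => models_E12 (E :&: pairs n) phi).
Proof.
rewrite /Pr (partition_big (fun E => E :&: pairs n)
   (fun F => (F \subset pairs n) && models_E12 F phi)) /=; last first.
  by move=> E ->; rewrite subsetIr.
apply: eq_bigr => F /andP[FU mF].
transitivity (Pr p (fun E => (F \subset E) && [disjoint pairs n :\: F & E])).
  rewrite Pr_pattern; first by rewrite cardsDS.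
  by rewrite disjoints_subset; apply/subsetP => x xF; rewrite !inE xF.
apply: eq_bigl => E; apply/esym; apply/andP/andP => [[_ /eqP <-]|[FE dE]].
  split; first exact: subsetIl.
  by rewrite -setI_eq0; apply/eqP/setP => x; rewrite !inE; case: (x \in E); case: (_ < _)%N.
have -> : E :&: pairs n = F.
  apply/setP => x; rewrite inE; apply/andP/idP => [[xE xU]|xF].
    by apply/negPn/negP => xF; have := disjointFl dE xE; rewrite inE xF xU.
  by rewrite (subsetP FE) ?(subsetP FU).
by rewrite mF eqxx.
Qed.

(** * Null sequences and counting *)

Section NullSequences.
Variable R : realType.
Implicit Types (u v : nat -> R) (r t c : R).

(* Only upper bounds matter: every sequence used below is nonnegative. *)
Definition null u := forall eps, 0 < eps -> exists N, forall n, (N <= n)%N -> u n <= eps.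

Lemma le_null N0 u v : null v -> (forall n, (N0 <= n)%N -> u n <= v n) -> null u.
Proof.
move=> nv uv eps /nv[N HN]; exists (maxn N N0) => n; rewrite geq_max => /andP[nN nN0].
by apply: le_trans (uv n nN0) (HN n nN).
Qed.

Lemma nullD u v : null u -> null v -> null (fun n => u n + v n).
Proof.
move=> nu nv eps e0; have e2 : 0 < eps / 2 by lra.
have [N HN] := nu _ e2; have [M HM] := nv _ e2.
exists (maxn N M) => n; rewrite geq_max => /andP[nN nM].
by have := HN n nN; have := HM n nM; lra.
Qed.

Lemma nullZ c u : 0 <= c -> null u -> null (fun n => c * u n).
Proof.
move=> c0 nu eps e0; have c1 : 0 < c + 1 by lra.
have [N HN] := nu (eps / (c + 1)) (divr_gt0 e0 c1); exists N => n /HN H.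
apply: (le_trans (ler_wpM2l c0 H)); rewrite mulrA ler_pdivrMr //; nra.
Qed.

Lemma bernoulli t k : 0 <= t -> 1 + k%:R * t <= (1 + t) ^+ k.
Proof.
move=> t0; elim: k => [|k IH]; first by rewrite mul0r addr0 expr0.
rewrite exprS -natr1; have : 0 <= k%:R * t * t by rewrite !mulr_ge0.
by move=> H; have := ler_wpM2l (addr_ge0 ler01 t0) IH; lra.
Qed.

Lemma mulrn_geometric_bounded r : 0 < r < 1 ->
  exists2 c, 0 <= c & forall k : nat, k%:R * r ^+ k <= c.
Proof.
move=> /andP[r0 r1]; have ir : 1 < r^-1 by rewrite invf_gt1.
pose d := r^-1 - 1; have d0 : 0 < d by rewrite /d; lra.
exists d^-1; first by rewrite invr_ge0 ltW.
have dE : 1 + d = r^-1 by rewrite /d; lra.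
move=> k; have := @bernoulli d k (ltW d0); rewrite dE exprVn => H.
have rk : 0 < r ^+ k by rewrite exprn_gt0.
rewrite -(ler_pM2r d0) mulVf ?gt_eqF // mulrAC.
have : (k%:R * d) * r ^+ k <= (r ^+ k)^-1 * r ^+ k by rewrite ler_wpM2r ?(ltW rk) //; lra.
by rewrite mulVf ?gt_eqF.
Qed.

(** With s = sqrt r, one factor s^k pays for k^d and the other for one more k. *)
Lemma natX_geometric_bounded d r : 0 < r < 1 ->
  exists2 c, 0 <= c & forall k : nat, k%:R ^+ d * r ^+ k <= c.
Proof.
elim: d r => [|d IH] r /andP[r0 r1].
  by exists 1 => // k; rewrite expr0 mul1r exprn_ile1 // ltW.
pose s := Num.sqrt r; have s0 : 0 < s by rewrite sqrtr_gt0.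
have ss : s * s = r by rewrite -expr2 sqr_sqrtr // ltW.
have s1 : 0 < s < 1 by rewrite s0 /=; nra.
have [c c0 Hc] := IH s s1; have [c' c0' Hc'] := mulrn_geometric_bounded s1.
exists (c * c'); first exact: mulr_ge0.
move=> k; rewrite -ss exprMn exprSr.
rewrite (_ : _ * _ = (k%:R ^+ d * s ^+ k) * (k%:R * s ^+ k)); last by ring.
by apply: ler_pM => //; rewrite mulr_ge0 // ?exprn_ge0 // ltW.
Qed.

Lemma null_geometric r : 0 < r < 1 -> null (fun k => r ^+ k).
Proof.
move=> r01 eps e0; have [c c0 Hc] := mulrn_geometric_bounded r01.
have ce : 0 <= c / eps by rewrite divr_ge0 // ltW.
exists (Num.truncn (c / eps)).+1 => k Hk.
have ck : c / eps < k%:R.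
  by apply: lt_le_trans (truncnS_gt _) _; rewrite ler_nat.
have k0 : 0 < k%:R :> R by apply: le_lt_trans ck.
rewrite -(ler_pM2l k0); apply: le_trans (Hc k) _; rewrite -ler_pdivrMr //; exact: ltW.
Qed.

Lemma null_natX_geometric d r : 0 < r < 1 -> null (fun k => k%:R ^+ d * r ^+ k).
Proof.
move=> /andP[r0 r1].
pose s := Num.sqrt r; have s0 : 0 < s by rewrite sqrtr_gt0.
have ss : s * s = r by rewrite -expr2 sqr_sqrtr // ltW.
have s1 : 0 < s < 1 by rewrite s0 /=; nra.
have [c c0 Hc] := natX_geometric_bounded d s1.
apply: (@le_null 0 _ (fun k => c * s ^+ k)); first by apply: nullZ => //; apply: null_geometric.
by move=> k _; rewrite -ss exprMn mulrA ler_wpM2r // exprn_ge0 // ltW.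
Qed.

(** [k] is the integer part of log n / log (1/t). *)
Lemma log_scale t n : 0 < t < 1 -> (0 < n)%N ->
  exists k : nat, 1 <= n%:R * t ^+ k /\ n%:R * t ^+ k.+1 < 1.
Proof.
move=> t01 n0; have [t0 t1] := andP t01.
have n0' : 0 < n%:R :> R by rewrite ltr0n.
have i0 : 0 < (n%:R * 2 : R)^-1 by rewrite invr_gt0 mulr_gt0.
have [N HN] := null_geometric t01 i0.
have Hlt k : (N <= k)%N -> n%:R * t ^+ k < 1.
  move=> /HN; rewrite invfM => H; apply: le_lt_trans (ler_wpM2l (ltW n0') H) _.
  by rewrite mulrA divff ?gt_eqF // mul1r; lra.
have ex : exists k, (1 <= n%:R * t ^+ k) by exists 0%N; rewrite expr0 mulr1 ler1n.
have ub k : 1 <= n%:R * t ^+ k -> (k <= N)%N.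
  by move=> H; rewrite leqNgt; apply/negP => /ltnW /Hlt; rewrite ltNge H.
case: (ex_maxnP ex ub) => k Hk max; exists k; split=> //.
by rewrite ltNge; apply/negP => /max; rewrite ltnn.
Qed.

(** The scale [k] of [n] tends to infinity with [n], so a null bound in the clique size [k] is a
    null bound in [n]. *)
Lemma null_log_scale t (u f : nat -> R) N0 : 0 < t < 1 -> null u ->
  (forall n k, (N0 <= n)%N -> (N0 <= k)%N -> 1 <= n%:R * t ^+ k -> n%:R * t ^+ k.+1 < 1 -> f n <= u k) ->
  null f.
Proof.
move=> t01 nu H eps /nu[M HM]; have [t0 t1] := andP t01.
pose M' := maxn M N0; have tM : 0 < t ^+ M' by rewrite exprn_gt0.
exists (maxn N0 (Num.truncn ((t ^+ M')^-1)).+1) => n; rewrite geq_max => /andP[nN0 nM].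
have Hn : (t ^+ M')^-1 < n%:R.
  by apply: lt_le_trans (truncnS_gt _) _; rewrite ler_nat.
have n0 : (0 < n)%N by rewrite (leq_trans _ nM).
have [k [Hk1 Hk2]] := log_scale t01 n0.
have kM : (M' <= k)%N.
  rewrite leqNgt; apply/negP => kM.
  have : n%:R * t ^+ M' <= n%:R * t ^+ k.+1.
    by rewrite ler_wpM2l // ler_wiXn2l // ltW.
  by apply/negP; rewrite -ltNge; apply: lt_trans Hk2 _; rewrite -ltr_pdivrMr // div1r.
move: kM; rewrite geq_max => /andP[kM kN0].
by apply: le_trans (H n k nN0 kN0 Hk1 Hk2) (HM k kM).
Qed.

End NullSequences.

(** * Counting sets by their overlap *)

Section Counting.

Lemma bin_falling_ratio N k j : (j <= k)%N ->
  ('C(N, k - j) * (N - k) ^ j <= 'C(N, k) * k ^_ j)%N.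
Proof.
elim: j => [|j IH] jk; first by rewrite subn0 expn0 ffactn0.
have {}IH := IH (ltnW jk); rewrite expnS ffactnSr.
have E : (k - j = (k - j.+1).+1)%N by rewrite -subSn.
have := mul_bin_left N (k - j.+1); rewrite -E => B.
apply: (@leq_trans ((k - j) * ('C(N, k - j) * (N - k) ^ j))%N); last first.
  by rewrite [leqRHS]mulnA [leqRHS]mulnC leq_mul2l IH orbT.
rewrite mulnA [leqRHS]mulnA B leq_mul2r; apply/orP; right.
by rewrite mulnC leq_mul2r; apply/orP; right; apply: leq_sub2l; exact: leq_subr.
Qed.

(** [K'] is determined by its parts inside and outside [K]. Letting the outside part range over all
    of [U] only enlarges the count. *)
Lemma sum_card_setI_le (R : realType) (n k : nat) (U K : {set 'I_n}) (f : nat -> R) :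
  (forall j, 0 <= f j) ->
  \sum_(K' : {set 'I_n} | (K' \subset U) && (#|K'| == k)) f #|K :&: K'| <=
  \sum_(j < k.+1) ('C(#|K|, j) * 'C(#|U|, k - j))%:R * f j.
Proof.
move=> f0.
rewrite (partition_big (fun K' => inord #|K :&: K'| : 'I_k.+1) xpredT) //=.
apply: ler_sum => j _.
rewrite (eq_bigr (fun=> f j)); last first.
  move=> K' /andP[/andP[_ /eqP cK] /eqP <-]; rewrite inordK // ltnS -cK.
  by rewrite subset_leq_card ?subsetIr.
rewrite sumr_const -[leLHS]mulr_natl ler_wpM2r // ler_nat.
rewrite -(cards_draws K j) -(cards_draws U (k - j)%N) -cardsX.
pose h (K' : {set 'I_n}) := (K :&: K', K' :\: K).
rewrite -(@card_in_imset _ _ h); last first.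
  move=> A B _ _ [E1 E2]; rewrite -(setID A K) -(setID B K) E2; congr (_ :|: _).
  by rewrite setIC E1 setIC.
apply: subset_leq_card; apply/subsetP => _ /imsetP[K' + ->].
rewrite unfold_in => /andP[/andP[KU /eqP cK] /eqP Ej].
have cI : #|K :&: K'| = j :> nat.
  by rewrite -Ej inordK // ltnS -cK subset_leq_card ?subsetIr.
rewrite !inE subsetIl cI eqxx /= (subset_trans (subsetDl _ _) KU) /=.
by rewrite cardsD setIC cI cK.
Qed.

Lemma leq_ffact_expn k j : (k ^_ j <= k ^ j)%N.
Proof.
elim: j => // j IH; rewrite ffactnSr expnSr; apply: leq_mul => //; exact: leq_subr.
Qed.

Lemma leq_bin_expn k j : ('C(k, j) <= k ^ j)%N.
Proof.
by apply: leq_trans (leq_ffact_expn k j); rewrite -bin_ffact leq_pmulr // fact_gt0.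
Qed.

Lemma sum_geometric_le (R : realType) (x : R) m : 0 <= x -> x < 1 ->
  \sum_(j < m) x ^+ j <= (1 - x)^-1.
Proof.
move=> x0 x1; have d : 0 < 1 - x by lra.
rewrite -(ler_pM2l d) divff ?gt_eqF //.
have := subrX1 x m; rewrite -[x - 1]opprB mulNr => E.
have : 0 <= x ^+ m by rewrite exprn_ge0.
by lra.
Qed.

(* [Y] bounds the correlation ratio per common vertex of two [k]-sets. *)
Lemma Pr_second_moment_sets (R : realType) (n k : nat) (p a Y delta : R) (U : {set 'I_n})
    (A A' : {set 'I_n} -> pred {set 'I_n * 'I_n}) :
  0 <= p -> p <= 1 -> 0 < a -> 0 <= Y -> delta <= 1 -> (k < #|U|)%N ->
  (forall K E, A' K E -> A K E) ->
  (forall K : {set 'I_n}, K \subset U -> #|K| = k -> (1 - delta) * a <= Pr p (A' K)) ->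
  (forall K K' : {set 'I_n}, K \subset U -> #|K| = k -> K' \subset U -> #|K'| = k ->
     Pr p (fun E => A K E && A K' E) <= a ^+ 2 * Y ^+ #|K :&: K'|) ->
  k%:R ^+ 2 * Y / (#|U| - k)%:R < 1 ->
  (1 - delta) ^+ 2 * (1 - k%:R ^+ 2 * Y / (#|U| - k)%:R) <=
  Pr p (fun E => [exists K : {set 'I_n}, ((K \subset U) && (#|K| == k)) && A' K E]).
Proof.
move=> p0 p1 a0 Y0 d1 kU AA' PA' PAA; set x := _ / _ => x1.
have Nk : 0 < (#|U| - k)%:R :> R by rewrite ltr0n subn_gt0.
have x0 : 0 <= x by rewrite divr_ge0 ?mulr_ge0 // ?sqr_ge0 // ltW.
pose P := fun K : {set 'I_n} => (K \subset U) && (#|K| == k).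
have := Pr_second_moment p0 p1 P A'.
set Q := Pr _ _; set S1 := (X in X ^+ 2); set S2 := (X in _ * X) => sm.
pose M : R := 'C(#|U|, k)%:R.
have M0 : 0 < M by rewrite ltr0n bin_gt0 ltnW.
have cM : (\sum_(K : {set 'I_n} | P K) 1 = M :> R).
  by rewrite sumr_const /M -cards_draws; congr _%:R; apply: eq_card => K; rewrite inE.
have S1ge : M * ((1 - delta) * a) <= S1.
  rewrite -cM mulr_suml; apply: ler_sum => K /andP[KU /eqP cK].
  by rewrite mul1r; apply: PA'.
have S2le : S2 <= M * (a ^+ 2 * (M * (1 - x)^-1)).
  rewrite -[X in _ <= X * _]cM mulr_suml; apply: ler_sum => K /andP[KU /eqP cK]; rewrite mul1r.
  apply: (@le_trans _ _ (\sum_(K' | P K') a ^+ 2 * Y ^+ #|K :&: K'|)).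
    apply: ler_sum => K' /andP[KU' /eqP cK'].
    apply: le_trans _ (PAA K K' KU cK KU' cK'); apply: le_Pr => // E.
    by move=> /andP[/AA'-> /AA'->].
  rewrite -big_distrr /= ler_wpM2l ?sqr_ge0 //.
  apply: le_trans (sum_card_setI_le k U K (fun j => exprn_ge0 j Y0)) _.
  rewrite cK; apply: le_trans _ (ler_wpM2l (ltW M0) (sum_geometric_le k.+1 x0 x1)).
  rewrite big_distrr /=; apply: ler_sum => j _; rewrite /x.
  have jk : (j <= k)%N by rewrite -ltnS.
  (* Choosing the overlap costs at most k^j, and comparing the two binomials another k^j; hence k^2
     in the ratio [x] of the geometric series. *)
  have B : ('C(k, j) * 'C(#|U|, k - j))%:R * (#|U| - k)%:R ^+ j <= M * k%:R ^+ 2 ^+ j.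
    have -> : k%:R ^+ 2 ^+ j = (k ^ j * k ^ j)%:R :> R by rewrite natrM !natrX expr2 exprMn.
    rewrite -natrX -natrM /M -natrM ler_nat -mulnA.
    apply: (@leq_trans (k ^ j * ('C(#|U|, k) * k ^ j))%N).
      apply: leq_mul (leq_bin_expn _ _) _.
      by apply: leq_trans (bin_falling_ratio _ jk) _; rewrite leq_mul2l leq_ffact_expn orbT.
    by rewrite mulnCA.
  have Nkj : 0 < (#|U| - k)%:R ^+ j :> R by rewrite exprn_gt0.
  rewrite (_ : M * _ = M * k%:R ^+ 2 ^+ j * Y ^+ j / (#|U| - k)%:R ^+ j); last first.
    by rewrite !exprMn exprVn !mulrA.
  by rewrite ler_pdivlMr // mulrAC ler_wpM2r ?exprn_ge0.
have x1' : 0 < 1 - x by lra.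
have c0 : 0 <= M * ((1 - delta) * a) by rewrite !mulr_ge0 ?subr_ge0 // ltW.
have S1M : (M * ((1 - delta) * a)) ^+ 2 <= S1 ^+ 2.
  by rewrite ler_pXn2r // nnegrE ?c0 // (le_trans c0).
have Q0 : 0 <= Q by apply: Pr_ge0.
have H : (M * ((1 - delta) * a)) ^+ 2 <= Q * (M * (a ^+ 2 * (M * (1 - x)^-1))).
  exact: le_trans S1M (le_trans sm (ler_wpM2l Q0 S2le)).
have Ma : 0 < (M * a) ^+ 2 by rewrite exprn_gt0 ?mulr_gt0.
rewrite -(ler_pM2r Ma) -(ler_pM2r (_ : 0 < (1 - x)^-1)) ?invr_gt0 //.
apply: (@le_trans _ _ ((M * ((1 - delta) * a)) ^+ 2)).
  by rewrite le_eqVlt; apply/orP; left; apply/eqP; field; rewrite gt_eqF.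
by apply: le_trans H _; rewrite le_eqVlt; apply/orP; left; apply/eqP; ring.
Qed.

End Counting.

(** * Properties holding with high probability *)

Lemma uniq_unzip1_inj (T S : eqType) (s : seq (T * S)) a b b' :
  uniq (unzip1 s) -> (a, b) \in s -> (a, b') \in s -> b = b'.
Proof.
elim: s => //= -[c d] s IH /andP[cs us]; rewrite !inE !xpair_eqE.
have mem x : (a, x) \in s -> a != c.
  by move=> H; apply: contraNneq cs => <-; apply/mapP; exists (a, x).
case/orP=> [/andP[/eqP ac /eqP->]|ab]; case/orP=> [/andP[/eqP ac' /eqP->]|ab'] //.
- by move: (mem _ ab'); rewrite ac eqxx.
- by move: (mem _ ab); rewrite ac' eqxx.
- exact: IH.
Qed.

Section Whp.
Variable R : realType.
Implicit Types (p t : R).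

Definition whp p (Q : forall n, rel 'I_n -> bool) :=
  null (fun n => Pr p (fun E : {set 'I_n * 'I_n} => ~~ Q n (gadj E))).

Lemma whp_and p Q1 Q2 : 0 <= p -> p <= 1 -> whp p Q1 -> whp p Q2 ->
  whp p (fun n e => Q1 n e && Q2 n e).
Proof.
move=> p0 p1 w1 w2; apply: (le_null (N0 := 0) (nullD w1 w2)) => n _.
by apply: Pr_cup2 => // E; rewrite negb_and.
Qed.

Lemma whp_imply p (Q1 Q2 : forall n, rel 'I_n -> bool) : 0 <= p -> p <= 1 ->
  (forall n (E : {set 'I_n * 'I_n}), Q1 n (gadj E) -> Q2 n (gadj E)) -> whp p Q1 -> whp p Q2.
Proof.
move=> p0 p1 H w1; apply: (le_null (N0 := 0) w1) => n _; apply: le_Pr => // E.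
by apply: contraNN; apply: H.
Qed.

Lemma whp_crel p Q : whp (1 - p) Q -> whp p (fun n e => Q n (crel e)).
Proof.
move=> w; apply: (le_null (N0 := 0) w) => n _; rewrite -Pr_setC.
by under [X in _ <= X]eq_Pr do rewrite gadj_setC.
Qed.

(** The outside vertices fail independently, and each succeeds with probability at least (p (1 -
    p))^k. *)
Lemma Pr_no_extension p n k (s : k.-tuple ('I_n * bool)) : 0 < p -> p < 1 ->
  uniq (unzip1 s) ->
  Pr p (fun E => ~~ [exists v, all (fun ab => (v != ab.1) && (gadj E v ab.1 == ab.2)) s])
  <= (1 - (p * (1 - p)) ^+ k) ^+ (n - k).
Proof.
move=> p0 p1 us; have [p0' p1'] := (ltW p0, ltW p1).
have q0 : 0 < 1 - p by lra.
pose C := [set x in unzip1 s].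
pose At := [set a | (a, true) \in s]; pose Af := [set a | (a, false) \in s].
pose m w (E : {set 'I_n * 'I_n}) := (star w At \subset E) && [disjoint star w Af & E].
have AtC : At \subset C.
  by apply/subsetP => a; rewrite !inE => H; apply/mapP; exists (a, true).
have AfC : Af \subset C.
  by apply/subsetP => a; rewrite !inE => H; apply/mapP; exists (a, false).
have cC : (#|C| <= k)%N.
  rewrite cardsE; apply: leq_trans (card_size _) _; by rewrite size_map size_tuple.
have dAt : [disjoint At & Af].
  apply/pred0P => a /=; apply/negbTE/negP; rewrite !inE => /andP[a1 a2].
  by have := uniq_unzip1_inj us a1 a2.
have mP w E : w \notin C -> m w E -> all (fun ab => (w != ab.1) && (gadj E w ab.1 == ab.2)) s.
  move=> wC /andP[wt wf]; apply/allP => -[a b] ab /=.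
  have wa : w != a by apply: contraNneq wC => ->; rewrite inE; apply/mapP; exists (a, b).
  rewrite wa /gadj /= wa /=; case: b ab => ab.
    by rewrite (subsetP wt) //; apply: imset_f; rewrite inE.
  rewrite (disjointFr wf) //; by apply: imset_f; rewrite inE.
apply: (@le_trans _ _ (Pr p (fun E => (set0 \subset E) && [forall w in ~: C, ~~ m w E]))).
  apply: le_Pr => // E /existsPn H; rewrite sub0set; apply/forall_inP => w; rewrite inE => wC.
  by apply: contraNN (H w); apply: mP.
rewrite Pr_stars ?sub0set //; last first.
  move=> w wC; apply: dependsN; apply: dependsA.
    by apply: (dependsS _ (@depends_sub _ _)); apply: star_sub.
  by apply: (dependsS _ (@depends_disjoint _ _)); apply: star_sub.
rewrite cards0 expr0 mul1r.
have c0 : 0 < p * (1 - p) by rewrite mulr_gt0.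
have c1 : p * (1 - p) <= 1 by nra.
have ck : 0 <= 1 - (p * (1 - p)) ^+ k by rewrite subr_ge0 exprn_ile1 // ltW.
apply: (@le_trans _ _ (\prod_(w in ~: C) (1 - (p * (1 - p)) ^+ k))).
  apply: ler_prod => w; rewrite inE => wC; rewrite Pr_ge0 // PrC lerD2l lerN2.
  rewrite Pr_pattern ?card_star.
    have q0' := ltW q0; have q1' : 1 - p <= 1 by lra.
    rewrite exprMn; apply: ler_pM; rewrite ?exprn_ge0 //; apply: ler_wiXn2l => //.
      by apply: leq_trans cC; apply: subset_leq_card.
    by apply: leq_trans cC; apply: subset_leq_card.
  apply/pred0P => a /=; apply/negbTE/negP => /andP[/imsetP[x xt ->] /imsetP[y yf]].
  case/edge_eq=> [[_ xy]|[wy xw]]; first by move: (disjointFr dAt xt); rewrite xy yf.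
  by move: wC; rewrite wy (subsetP AfC).
rewrite prodr_const card_setC_ord; apply: ler_wiXn2l => //.
  by have := exprn_ge0 k (ltW c0); lra.
exact: leq_sub2l.
Qed.

Lemma whp_extension_axiom p k : 0 < p -> p < 1 ->
  whp p (fun n e => extension_axiom e k).
Proof.
move=> p0 p1; have [p0' p1'] := (ltW p0, ltW p1).
pose r := 1 - (p * (1 - p)) ^+ k.
have c0 : 0 < p * (1 - p) by rewrite mulr_gt0 //; lra.
have c1 : p * (1 - p) < 1 by nra.
(* For k = 0 the base [r] would be 0; that axiom only asks for a vertex. *)
case: (posnP k) => [k0|k0].
  rewrite k0; apply: (@le_null _ 1%N _ (fun n => 0)).
    by move=> eps e0; exists 0%N => n _; exact: ltW.
  move=> n n0; rewrite /Pr big_pred0 // => E; apply/negbTE; rewrite negbK.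
  apply/forallP => s; rewrite tuple0 /=; apply/existsP; by exists (Ordinal n0).
have r01 : 0 < r < 1.
  have ck : 0 < (p * (1 - p)) ^+ k by rewrite exprn_gt0.
  have : (p * (1 - p)) ^+ k < 1 by rewrite exprn_ilt1 ?(ltW c0) // -lt0n.
  by rewrite /r => ?; apply/andP; split; lra.
have [r0 r1] := andP r01.
apply: (@le_null _ k _ (fun n => (2 ^+ k / r ^+ k) * (n%:R ^+ k * r ^+ n))).
  by apply: nullZ; [rewrite divr_ge0 ?exprn_ge0 // ltW|exact: null_natX_geometric].
move=> n nk.
apply: (@le_trans _ _ (\sum_(s : k.-tuple ('I_n * bool) | uniq (unzip1 s)) r ^+ (n - k))).
  apply: le_trans (ler_sum _ (fun s us => Pr_no_extension p0 p1 us)).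
  by apply: Pr_cup => // E /forallPn[s]; rewrite negb_imply => /andP[us H]; exists s.
apply: (@le_trans _ _ (\sum_(s : k.-tuple ('I_n * bool)) r ^+ (n - k))).
  by rewrite big_mkcond; apply: ler_sum => s _; case: ifP => // _; rewrite exprn_ge0 // ltW.
rewrite sumr_const card_tuple card_prod card_ord card_bool -[leLHS]mulr_natl natrX natrM exprMn.
have -> : r ^+ n = r ^+ (n - k) * r ^+ k by rewrite -exprD subnK.
have rk : r ^+ k != 0 by rewrite expf_neq0 // gt_eqF.
rewrite le_eqVlt; apply/orP; left; apply/eqP.
move: (r ^+ k) (r ^+ (n - k)) (n%:R ^+ k) (2%:R ^+ k) rk => a b c d a0.
by field.
Qed.

Lemma whp_extension6 p : 0 < p -> p < 1 -> whp p (fun n e => extension6 e).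
Proof.
move=> p0 p1; have [p0' p1'] := (ltW p0, ltW p1).
have H m : whp p (fun n e => all (extension_axiom e) (iota 0 m)).
  elim: m => [|m IH].
    move=> eps e0; exists 0%N => n _; rewrite /Pr big_pred0 ?ltW //.
  apply: whp_imply (whp_and p0' p1' IH (whp_extension_axiom m p0 p1)) => // n E.
  by rewrite -[m.+1]addn1 iotaD all_cat /= andbT.
apply: whp_imply (H 7) => // n E /allP Ha; apply/forallP => k; apply: Ha.
by rewrite mem_iota /=.
Qed.

End Whp.

(* Cliques [K] whose vertices are moreover all adjacent ([z = Some true]), or all
   nonadjacent ([z = Some false]), to a fixed vertex [v0]. *)
Section CliqueFamilies.
Variables (R : realType) (p : R) (n : nat) (z : option bool) (v0 : 'I_n).
Hypotheses (p0 : 0 < p) (p1 : p < 1).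
Implicit Types (K : {set 'I_n}) (E : {set 'I_n * 'I_n}).

Definition vcond K E : bool :=
  if z is Some b then if b then star v0 K \subset E else [disjoint star v0 K & E] else true.

Definition zeta : R := if z is Some b then if b then p else 1 - p else 1.

Definition kfam K E : bool := (edges K \subset E) && vcond K E.

(** A vertex that would spoil maximality ([bF]) or domination ([bE]). When [z] prescribes the
    adjacency of [v0] to [K], that vertex is the intended exception. *)
Definition kbad (bF bE : bool) K E : bool :=
  [exists u, [&& u \notin K, (z == None) || (u != v0) &
    bF && relF (gadj E) K u || bE && relE (gadj E) K u]].

Lemma zeta_gt0 : 0 < zeta.
Proof. by rewrite /zeta; case: z => [[]|] //=; rewrite subr_gt0. Qed.

Lemma depends_vcond K : depends (star v0 K) (vcond K).
Proof.
by rewrite /vcond; case: z => [[]|]; [exact: depends_sub|exact: depends_disjoint|].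
Qed.

Lemma Pr_vcond K : Pr p (vcond K) = zeta ^+ #|K|.
Proof.
rewrite /vcond /zeta; case: z => [[]|].
- by rewrite Pr_sub card_star.
- by rewrite Pr_disjoint card_star.
- by rewrite Pr_predT expr1n.
Qed.

Lemma vcondU K K' E : vcond (K :|: K') E = vcond K E && vcond K' E.
Proof.
rewrite /vcond; case: z => [[]|] //; rewrite starU ?subUset //.
by rewrite -!setI_eq0 setIUl setU_eq0.
Qed.

Lemma Pr_kfam K : v0 \notin K -> Pr p (kfam K) = p ^+ 'C(#|K|, 2) * zeta ^+ #|K|.
Proof.
move=> vK; rewrite (@Pr_indep _ _ _ (edges K) (star v0 K)).
- by rewrite Pr_sub Pr_vcond card_edges.
- exact: depends_sub.
- exact: depends_vcond.
- by rewrite disjoint_sym star_edges.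
Qed.

(** The shared edges gain a factor p^-C(j,2). As C(j,2) = j (j - 1) / 2 is at most j k / 2, this is
    at most the j-th power of sqrt(p)^-k, the shape a geometric series needs. *)
Lemma Pr_kfam2 k K K' : v0 \notin K -> v0 \notin K' -> #|K| = k -> #|K'| = k ->
  Pr p (fun E => kfam K E && kfam K' E) <=
  (p ^+ 'C(k, 2) * zeta ^+ k) ^+ 2 * ((Num.sqrt p ^+ k * zeta)^-1) ^+ #|K :&: K'|.
Proof.
move=> vK vK' cK cK'; set j := #|K :&: K'|.
have jk : (j <= k)%N by rewrite -cK subset_leq_card ?subsetIl.
have z0 := zeta_gt0.
have s0 : 0 < Num.sqrt p by rewrite sqrtr_gt0.
have s1 : Num.sqrt p <= 1 by rewrite -sqrtr1 ler_sqrt // ltW.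
have -> : Pr p (fun E => kfam K E && kfam K' E) =
    p ^+ ('C(k, 2) + 'C(k, 2) - 'C(j, 2)) * zeta ^+ (k + k - j).
  rewrite (@eq_Pr _ _ _ _ (fun E => (edges K :|: edges K' \subset E) && vcond (K :|: K') E)).
    rewrite (@Pr_indep _ _ _ (edges (K :|: K')) (star v0 (K :|: K'))).
    - by rewrite Pr_sub Pr_vcond !cardsU edgesI !card_edges cK cK'.
    - apply: dependsS (@depends_sub _ _).
      by rewrite subUset; apply/andP; split; apply/subsetP => a;
        rewrite !inE => /and3P[-> -> ->]; rewrite ?orbT.
    - exact: depends_vcond.
    - by rewrite disjoint_sym star_edges // inE negb_or vK vK'.
  move=> E; rewrite /kfam subUset vcondU -!andbA; congr andb.
  by rewrite andbCA.
have cj : ('C(j, 2) <= 'C(k, 2))%N by apply: leq_bin2l.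
have pj : p ^+ 'C(j, 2) = Num.sqrt p ^+ (j * j.-1).
  by rewrite -[X in X ^+ _](sqr_sqrtr (ltW p0)) -exprM -mul_bin_diag bin1.
have pn0 : p ^+ 'C(j, 2) != 0 by rewrite expf_neq0 // gt_eqF.
have zn0 : zeta ^+ j != 0 by rewrite expf_neq0 // gt_eqF.
have E1 : p ^+ ('C(k, 2) + 'C(k, 2) - 'C(j, 2)) = p ^+ 'C(k, 2) * p ^+ 'C(k, 2) / p ^+ 'C(j, 2).
  apply: (mulIf pn0); rewrite divfK // -!exprD subnK //.
  by rewrite (leq_trans cj) // leq_addr.
have E2 : zeta ^+ (k + k - j) = zeta ^+ k * zeta ^+ k / zeta ^+ j.
  apply: (mulIf zn0); rewrite divfK // -!exprD subnK //.
  by rewrite (leq_trans jk) // leq_addr.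
rewrite E1 E2 expr2 exprVn [(_ * zeta) ^+ j]exprMn.
have pk0 : 0 <= p ^+ 'C(k, 2) by rewrite exprn_ge0 // ltW.
have zk0 : 0 <= zeta ^+ k by rewrite exprn_ge0 // ltW.
have sk : 0 < (Num.sqrt p ^+ k) ^+ j by rewrite !exprn_gt0.
have zj : 0 < zeta ^+ j by rewrite exprn_gt0.
rewrite [leLHS](_ : _ = p ^+ 'C(k, 2) * zeta ^+ k * (p ^+ 'C(k, 2) * zeta ^+ k) *
  ((p ^+ 'C(j, 2))^-1 * (zeta ^+ j)^-1)); last first.
  move: (p ^+ 'C(k, 2)) (zeta ^+ k) (p ^+ 'C(j, 2)) (zeta ^+ j) pn0 zn0 => a b c d c0 d0.
  by field; rewrite c0 d0.
rewrite ler_wpM2l ?mulr_ge0 // invfM ler_wpM2r ?invr_ge0 ?(ltW zj) //.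
rewrite lef_pV2 ?posrE // ?exprn_gt0 // pj -exprM; apply: ler_wiXn2l => //; first exact: ltW.
rewrite mulnC leq_mul2r; apply/orP; right; exact: leq_trans (leq_pred _) jk.
Qed.

(** A union bound over [u], whose star to [K] is independent of the edges that [kfam] inspects. *)
Lemma Pr_kfam_kbad bF bE K : v0 \notin K ->
  Pr p (fun E => kfam K E && kbad bF bE K E) <=
  n%:R * (bF%:R * p ^+ #|K| + bE%:R * (1 - p) ^+ #|K|) * Pr p (kfam K).
Proof.
move=> vK; have [p0' p1'] := (ltW p0, ltW p1).
pose W := [pred u : 'I_n | (u \notin K) && ((z == None) || (u != v0))].
pose B u E := bF && relF (gadj E) K u || bE && relE (gadj E) K u.
have d0 : 0 <= bF%:R * p ^+ #|K| + bE%:R * (1 - p) ^+ #|K|.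
  by rewrite addr_ge0 // mulr_ge0 ?ler0n // exprn_ge0 //; lra.
apply: (@le_trans _ _ (\sum_(u | W u) Pr p (fun E => kfam K E && B u E))).
  apply: Pr_cup => // E /andP[fK /existsP[u /and3P[uK uz uB]]].
  by exists u; rewrite /W /= ?uK ?uz ?fK.
apply: (@le_trans _ _ (\sum_(u | W u) (bF%:R * p ^+ #|K| + bE%:R * (1 - p) ^+ #|K|) * Pr p (kfam K))).
  apply: ler_sum => u /andP[uK uz].
  have dF : depends (star u K) (fun E => bF && relF (gadj E) K u).
    by move=> E; rewrite !relF_star // depends_sub.
  have dE : depends (star u K) (fun E => bE && relE (gadj E) K u).
    by move=> E; rewrite !relE_star // depends_disjoint.
  pose S := edges K :|: (if z == None then set0 else star v0 K).
  have dK : depends S (kfam K).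
    apply: dependsA; first by apply: dependsS (@depends_sub _ _); exact: subsetUl.
    rewrite /S; case Ez: (z == None); first by move=> E; rewrite /vcond (eqP Ez).
    by apply: dependsS (@depends_vcond K); exact: subsetUr.
  rewrite (@Pr_indep _ _ _ S (star u K) _ _ dK); first last.
  - rewrite disjoint_sym disjoints_subset /S setCU subsetI -!disjoints_subset star_edges //=.
    move: uz; case: eqP => _ /= uz; last exact: star_star.
    by rewrite -setI_eq0 setI0.
  - by move=> E; rewrite /B dF dE.
  rewrite mulrC ler_wpM2r ?Pr_ge0 //.
  apply: le_trans (@Pr_cup2 _ _ _ p0' p1' (fun E => bF && relF (gadj E) K u)
    (fun E => bE && relE (gadj E) K u) _ _) _ => //.
  apply: lerD.
    case: bF {B dF d0}; first by rewrite mul1r /= Pr_relF.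
    by rewrite mul0r /Pr big_pred0.
  case: bE {B dE d0}; first by rewrite mul1r /= Pr_relE.
  by rewrite mul0r /Pr big_pred0.
rewrite sumr_const -[leLHS]mulr_natl -mulrA ler_wpM2r ?mulr_ge0 ?Pr_ge0 // ler_nat.
by rewrite -[leqRHS]card_ord max_card.
Qed.

End CliqueFamilies.

Lemma null_bool (R : realType) (b : bool) (u : nat -> R) :
  (b -> null u) -> null (fun n => b%:R * u n).
Proof.
case: b => [H|_ eps e0]; first by apply: nullZ => //; exact: H.
by exists 0%N => n _; rewrite mul0r ltW.
Qed.

(** Cliques of size k with n about t^-k. The expected numbers of full and empty vertices are of
    order (p/t)^k and ((1-p)/t)^k, which demands that p or 1 - p be below t when these are excluded;
    the second moment method needs k^2 (t / sqrt p)^k small, hence t < sqrt p. *)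
Lemma whp_kfam (R : realType) (p t : R) (z : option bool) (bF bE : bool)
    (Q : forall n, rel 'I_n -> bool) :
  0 < p -> p < 1 -> 0 < t -> t < Num.sqrt p -> (bF -> p < t) -> (bE -> 1 - p < t) ->
  (forall n (v0 : 'I_n) (K : {set 'I_n}) E, v0 \notin K -> (1 < #|K|)%N ->
     kfam z v0 K E -> ~~ kbad z v0 bF bE K E -> Q n (gadj E)) ->
  whp p Q.
Proof.
move=> p0 p1 t0 ts HF HE HQ; have [p0' p1'] := (ltW p0, ltW p1).
pose s := Num.sqrt p; pose q := 1 - p; pose ze := zeta p z.
have s0 : 0 < s by rewrite sqrtr_gt0.
have s1 : s < 1 by rewrite -sqrtr1 ltr_sqrt.
have t01 : 0 < t < 1 by rewrite t0 (lt_trans ts).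
have ze0 : 0 < ze by apply: zeta_gt0.
have q0 : 0 < q by rewrite /q; lra.
(* [delta] bounds the conditional probability of a bad vertex, by n <= t^-(k+1); [x] bounds the
   overlap ratio, by n >= t^-k, its factor 2 coming from replacing |U| - k by n / 2. *)
pose delta k := t^-1 * (bF%:R * (p / t) ^+ k) + t^-1 * (bE%:R * (q / t) ^+ k).
pose x k := (2 / ze) * (k%:R ^+ 2 * (t / s) ^+ k).
have nd : null delta.
  apply: nullD; (apply: nullZ; first by rewrite invr_ge0 ltW); apply: null_bool => b.
    by apply: null_geometric; rewrite divr_gt0 //= ltr_pdivrMr // mul1r HF.
  by apply: null_geometric; rewrite divr_gt0 //= ltr_pdivrMr // mul1r HE.
have nx : null x.
  apply: nullZ; first by rewrite divr_ge0 // ltW.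
  by apply: null_natX_geometric; rewrite divr_gt0 //= ltr_pdivrMr // mul1r.
have delta0 k : 0 <= delta k.
  by rewrite addr_ge0 // !mulr_ge0 ?ler0n ?invr_ge0 ?exprn_ge0 ?divr_ge0 // ltW.
have nkt : null (fun k => k%:R ^+ 1 * t ^+ k + t ^+ k).
  by apply: nullD; [exact: null_natX_geometric|exact: null_geometric].
have [N1 HN1] := nkt 2^-1 ltac:(lra).
apply: (@null_log_scale _ t (fun k => 2 * delta k + x k) _ (maxn 2 N1)) => //.
  by apply: nullD => //; apply: nullZ.
move=> n k; rewrite !geq_max => /andP[n2 _] /andP[k2 kN1] nk1 nk2.
have nR : 0 < n%:R :> R by rewrite ltr0n (leq_trans _ n2).
have tk : 0 < t ^+ k by rewrite exprn_gt0.
have kn : (k.+1 * 2 <= n)%N.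
  have := HN1 k kN1; rewrite expr1 => H; rewrite -(ler_nat R) natrM -natr1.
  rewrite -(ler_pM2r tk); apply: le_trans nk1; lra.
have kn1 : (n <= (n.-1 - k) * 2)%N by clear -kn; lia.
have kn2 : (k < n.-1)%N by clear -kn; lia.
have v0 : 'I_n by apply: (@Ordinal n 0); rewrite (leq_trans _ n2).
pose U := ~: [set v0].
have cU : #|U| = n.-1 by rewrite card_setC_ord cards1 subn1.
have vU (K : {set 'I_n}) : K \subset U -> v0 \notin K.
  by move=> KU; apply/negP => /(subsetP KU); rewrite !inE eqxx.
pose a := p ^+ 'C(k, 2) * ze ^+ k.
have a0 : 0 < a by rewrite mulr_gt0 ?exprn_gt0.
have ndelta : n%:R * (bF%:R * p ^+ k + bE%:R * q ^+ k) <= delta k.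
  have nt : n%:R <= t^-1 * (t ^+ k)^-1.
    by rewrite -invfM -exprS -(ler_pM2r (exprn_gt0 k.+1 t0)) mulVf ?gt_eqF ?exprn_gt0 // ltW.
  rewrite /delta -mulrDr !exprMn exprVn.
  apply: le_trans (ler_wpM2r _ nt) _.
    by rewrite addr_ge0 // !mulr_ge0 ?ler0n ?exprn_ge0 // ltW.
  by rewrite le_eqVlt; apply/orP; left; apply/eqP; ring.
pose X := k%:R ^+ 2 * (s ^+ k * ze)^-1 / (#|U| - k)%:R.
have sk : 0 < s ^+ k by rewrite exprn_gt0.
have Xx : X <= x k.
  have n2' : n%:R / 2 <= (#|U| - k)%:R :> R.
    by rewrite ler_pdivrMr // -[2]/(2%:R) -natrM ler_nat cU.
  have i2 : ((#|U| - k)%:R)^-1 <= 2 * t ^+ k.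
    apply: (@le_trans _ _ (n%:R / 2)^-1).
      by rewrite lef_pV2 ?posrE ?divr_gt0 // (lt_le_trans _ n2') // divr_gt0.
    rewrite invf_div ler_wpM2l // -[leLHS]mul1r ler_pdivrMr // mulrC //.
  rewrite /X /x invfM exprMn exprVn.
  rewrite [leRHS](_ : _ = k%:R ^+ 2 * ((s ^+ k)^-1 / ze) * (2 * t ^+ k)); last by ring.
  by rewrite ler_wpM2l // !mulr_ge0 ?invr_ge0 ?sqr_ge0 // ltW.
have X0 : 0 <= X by rewrite !mulr_ge0 ?invr_ge0 ?mulr_ge0 ?sqr_ge0 ?ler0n // ltW.
(* If [delta k] or [x k] reaches 1, the claimed bound exceeds every probability. *)
case: (ltP (delta k) 1) => [d1|d1]; last first.
  by apply: le_trans (Pr_le1 p0' p1' _) _; have := le_trans X0 Xx; have := delta0 k; lra.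
case: (ltP (x k) 1) => [x1|x1]; last first.
  by apply: le_trans (Pr_le1 p0' p1' _) _; have := delta0 k; lra.
pose A' K E := kfam z v0 K E && ~~ kbad z v0 bF bE K E.
have H : (1 - delta k) ^+ 2 * (1 - X) <=
    Pr p (fun E => [exists K : {set 'I_n}, ((K \subset U) && (#|K| == k)) && A' K E]).
  apply: (@Pr_second_moment_sets R n k p a _ (delta k) U (kfam z v0) A') => //.
  - by rewrite invr_ge0 mulr_ge0 // ltW.
  - exact: ltW.
  - by rewrite cU.
  - by move=> K E /andP[].
  - move=> K KU cK; apply: le_trans (Pr_diff p0' p1' _ _).
    rewrite mulrBl mul1r; apply: lerB.
      by rewrite Pr_kfam ?vU // cK.
    apply: le_trans (Pr_kfam_kbad z p0 p1 bF bE (vU _ KU)) _.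
    by rewrite Pr_kfam ?vU // cK ler_wpM2r // ltW.
  - by move=> K K' KU cK KU' cK'; apply: Pr_kfam2 => //; apply: vU.
  - exact: le_lt_trans Xx x1.
rewrite PrC; have : (1 - delta k) ^+ 2 * (1 - X) <= Pr p (fun E => Q n (gadj E)).
  apply: le_trans H _; apply: le_Pr => // E /existsP[K /andP[/andP[KU /eqP cK] /andP[fK nK]]].
  by apply: (HQ n v0 K) => //; [exact: vU|rewrite cK].
have := delta0 k; have := mulr_ge0 (delta0 k) X0; have := mulr_ge0 (sqr_ge0 (delta k)) (_ : 0 <= 1 - X).
by nra.
Qed.

(** * The four kinds of cliques away from the critical probability *)

Section TypicalCliques.
Variable R : realType.
Implicit Types p : R.

Lemma sqrt_bounds p : 0 < p -> p < 1 -> p < Num.sqrt p /\ Num.sqrt p < 1.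
Proof.
move=> p0 p1; have s0 : 0 < Num.sqrt p by rewrite sqrtr_gt0.
have ss : Num.sqrt p ^+ 2 = p by rewrite sqr_sqrtr // ltW.
have s1 : Num.sqrt p < 1 by rewrite -[X in _ < X]sqrtr1 ltr_sqrt.
by split=> //; rewrite -[X in X < _]ss expr2; nra.
Qed.

Lemma relE_not_relF (V : finType) (e : rel V) (K : {set V}) v :
  v \notin K -> (0 < #|K|)%N -> relE e K v -> ~~ relF e K v.
Proof.
move=> vK /card_gt0P[x xK] /relEP H; apply/relFPn; exists x; rewrite xK.
by have xv : x != v; [apply: contraNneq vK => <-|rewrite xv H].
Qed.

(** [Some false] makes [v0] the undominated vertex. Only full vertices are excluded, so p < t < sqrt
    p is possible for every p. *)
Lemma whp_kclq_FT p : 0 < p -> p < 1 -> whp p (fun n e => kclq e false true).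
Proof.
move=> p0 p1; have [s1 s2] := sqrt_bounds p0 p1.
apply: (@whp_kfam R p ((p + Num.sqrt p) / 2) (Some false) true false) => //; try lra.
move=> n v0 K E vK K1 /andP[cK /= vE] /existsPn bad.
apply/existsP; exists K; rewrite K1 clique_edges cK /=; rewrite -relE_star // in vE.
apply/andP; split; last by rewrite eqb_id; apply/existsP; exists v0; rewrite inE vK vE.
rewrite eqbF_neg negb_exists; apply/forallP => u; rewrite inE; apply/negP => /andP[uK uF].
have := bad u; rewrite uK uF /= ?orbT ?andbT negbK => /eqP uv.
by move: (relE_not_relF vK (ltnW K1) vE); rewrite -uv uF.
Qed.

(** [Some true] makes [v0] the extending vertex. Excluding empty vertices requires 1 - p < t < sqrt
    p, which is where the hypothesis enters. *)
Lemma whp_kclq_TF p : 0 < p -> p < 1 -> (1 - p) ^+ 2 < p ->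
  whp p (fun n e => kclq e true false).
Proof.
move=> p0 p1 pq; have [s1 s2] := sqrt_bounds p0 p1.
have s0 : 0 < Num.sqrt p by rewrite sqrtr_gt0.
have qs : 1 - p < Num.sqrt p.
  by rewrite -(@ltr_pXn2r _ 2) ?nnegrE ?(ltW s0) ?subr_ge0 ?(ltW p1) // sqr_sqrtr // ltW.
apply: (@whp_kfam R p ((1 - p + Num.sqrt p) / 2) (Some true) false true) => //; try lra.
move=> n v0 K E vK K1 /andP[cK /= vF] /existsPn bad.
apply/existsP; exists K; rewrite K1 clique_edges cK /=; rewrite -relF_star // in vF.
apply/andP; split; first by rewrite eqb_id; apply/existsP; exists v0; rewrite inE vK vF.
rewrite eqbF_neg negb_exists; apply/forallP => u; rewrite inE; apply/negP => /andP[uK uE].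
have := bad u; rewrite uK uE /= ?orbT ?andbT negbK => /eqP uv.
by move: (relE_not_relF uK (ltnW K1) uE); rewrite uv vF.
Qed.

Lemma whp_kclq_FF p : 0 < p -> p < 1 -> (1 - p) ^+ 2 < p ->
  whp p (fun n e => kclq e false false).
Proof.
move=> p0 p1 pq; have [s1 s2] := sqrt_bounds p0 p1.
have s0 : 0 < Num.sqrt p by rewrite sqrtr_gt0.
have qs : 1 - p < Num.sqrt p.
  by rewrite -(@ltr_pXn2r _ 2) ?nnegrE ?(ltW s0) ?subr_ge0 ?(ltW p1) // sqr_sqrtr // ltW.
have [t [t1 t2 t3]] : exists t, [/\ p < t, 1 - p < t & t < Num.sqrt p].
  have [h|h] := leP p (1 - p); first by exists ((1 - p + Num.sqrt p) / 2); split; lra.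
  by exists ((p + Num.sqrt p) / 2); split; lra.
apply: (@whp_kfam R p t None true true) => //; try lra.
move=> n v0 K E vK K1 /andP[cK _] /existsPn bad.
apply/existsP; exists K; rewrite K1 clique_edges cK /= !eqbF_neg !negb_exists.
apply/andP; split; apply/forallP => u; rewrite inE; apply/negP => /andP[uK uE].
  by have := bad u; rewrite uK uE.
by have := bad u; rewrite uK uE /= ?orbT.
Qed.

Lemma expr_le_expR (x : R) m : 0 <= x -> x <= 1 -> (1 - x) ^+ m <= expR (- (m%:R * x)).
Proof.
move=> x0 x1; rewrite -mulrN expRM_natl; apply: lerXn2r; rewrite ?nnegrE ?expR_ge0 //; first lra.
exact: expR_ge1Dx.
Qed.

Lemma Pr_clique_of_size p n k : 0 <= p -> p <= 1 ->
  Pr p (fun E : {set 'I_n * 'I_n} => [exists D : {set 'I_n}, (#|D| == k) && (edges D \subset E)])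
  <= n%:R ^+ k * p ^+ 'C(k, 2).
Proof.
move=> p0 p1.
apply: (@le_trans _ _ (\sum_(D : {set 'I_n} | #|D| == k) p ^+ 'C(k, 2))).
  apply: (@le_trans _ _ (\sum_(D : {set 'I_n} | #|D| == k) Pr p (fun E => edges D \subset E))).
    by apply: Pr_cup => // E /existsP[D /andP[cD DE]]; exists D.
  by apply: ler_sum => D /eqP <-; rewrite Pr_sub card_edges.
rewrite sumr_const -[leLHS]mulr_natl ler_wpM2r ?exprn_ge0 // -natrX ler_nat.
apply: leq_trans (leq_bin_expn n k).
by rewrite -[in leqRHS](card_ord n) -card_draws; apply: subset_leq_card; apply/subsetP => D; rewrite !inE.
Qed.

(** A union bound over at most (k + 1) n^k sets, bounding the clique probability by 1: failure to
    dominate is already likely enough. *)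
Lemma Pr_small_dominating p n k : 0 < p -> p < 1 -> (0 < n)%N -> (k <= n)%N ->
  Pr p (fun E : {set 'I_n * 'I_n} =>
    [exists D : {set 'I_n}, (#|D| <= k)%N && ((edges D \subset E) && dominates D D E)])
  <= k.+1%:R * n%:R ^+ k * expR (- ((n - k)%:R * (1 - p) ^+ k)).
Proof.
move=> p0 p1 n0 kn; have [p0' p1'] := (ltW p0, ltW p1).
have q0 : 0 < 1 - p by lra.
apply: (@le_trans _ _ (\sum_(D : {set 'I_n} | (#|D| <= k)%N) expR (- ((n - k)%:R * (1 - p) ^+ k)))).
  apply: (@le_trans _ _ (\sum_(D : {set 'I_n} | (#|D| <= k)%N)
      Pr p (fun E => (edges D \subset E) && dominates D D E))).
    by apply: Pr_cup => // E /existsP[D /andP[cD DE]]; exists D.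
  apply: ler_sum => D cD; rewrite Pr_clique_dominates //.
  have qk : 0 <= (1 - p) ^+ k by rewrite exprn_ge0 // ltW.
  have qk1 : (1 - p) ^+ k <= 1 by rewrite exprn_ile1 //; lra.
  have qD1 : (1 - p) ^+ #|D| <= 1 by rewrite exprn_ile1 //; lra.
  have qDk : (1 - p) ^+ k <= (1 - p) ^+ #|D| by apply: ler_wiXn2l => //; lra.
  apply: le_trans (expr_le_expR (n - k) qk qk1).
  rewrite -[leRHS]mul1r; apply: ler_pM; rewrite ?exprn_ge0 ?exprn_ile1 ?subr_ge0 //.
  apply: (@le_trans _ _ ((1 - (1 - p) ^+ #|D|) ^+ (n - k))).
    apply: ler_wiXn2l; rewrite ?subr_ge0 //; last exact: leq_sub2l.
    by have := exprn_ge0 #|D| (ltW q0); lra.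
  by apply: lerXn2r; rewrite ?nnegrE ?subr_ge0 //; lra.
rewrite sumr_const -[leLHS]mulr_natl ler_wpM2r ?expR_ge0 // -natrX -natrM ler_nat.
have -> : #|[pred D : {set 'I_n} | (#|D| <= k)%N]| = (\sum_(i < k.+1) 'C(n, i))%N.
  rewrite -sum1_card (partition_big (fun D : {set 'I_n} => inord #|D| : 'I_k.+1) xpredT) //=.
  apply: eq_bigr => i _; rewrite -[in RHS](card_ord n) -card_draws -sum1_card.
  apply: eq_bigl => D; rewrite !inE; apply/andP/eqP => [[Dk /eqP <-]|E].
    by rewrite inordK.
  have Dk : (#|D| <= k)%N by rewrite E -ltnS.
  by split=> //; apply/eqP/val_inj; rewrite /= inordK.
apply: (@leq_trans (\sum_(i < k.+1) n ^ k)%N); last by rewrite sum_nat_const card_ord.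
apply: leq_sum => i _; apply: leq_trans (leq_bin_expn _ _) _.
by rewrite leq_pexp2l // -ltnS.
Qed.

(** Take sqrt p < t < q and n about t^-k. A clique larger than k contains a (k+1)-clique, and at
    most (n sqrt(p)^k)^(k+1) of these are expected. A smaller clique dominates with probability at
    most about exp(-(q/t)^k / 2), which beats the exp(O(k^2)) choices. *)
Lemma whp_no_dominating_clique p : 0 < p -> p < 1 -> p < (1 - p) ^+ 2 ->
  whp p (fun n e => ~~ kclq e false false && ~~ kclq e true false).
Proof.
move=> p0 p1 pq.
have [p0' p1'] := (ltW p0, ltW p1).
have [s1 s2] := sqrt_bounds p0 p1.
pose s := Num.sqrt p; pose q := 1 - p.
have s0 : 0 < s by rewrite sqrtr_gt0.
have q0 : 0 < q by rewrite /q; lra.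
have sq : s < q.
  by rewrite -(@ltr_pXn2r _ 2) ?nnegrE ?(ltW s0) ?(ltW q0) // sqr_sqrtr.
pose t := (s + q) / 2.
have [st tq] : s < t /\ t < q by rewrite /t; lra.
have t0 : 0 < t by lra.
have t01 : 0 < t < 1 by rewrite t0 /=; rewrite /q in tq; lra.
pose L := ln t^-1.
have L0 : 0 <= L by apply: ln_ge0; rewrite invf_ge1 //; rewrite /q in tq; lra.
have LE : expR L = t^-1 by rewrite lnK // posrE invr_gt0.
pose u := q / t.
have u1 : 1 < u by rewrite ltr_pdivlMr // mul1r.
have ui : 0 < u^-1 < 1 by rewrite invr_gt0 (lt_trans ltr01 u1) invf_lt1 ?(lt_trans ltr01 u1).
(* As n^k <= exp(L k (k + 1)), this makes u^k / 2 at least 8 (L + 1) k^2, hence at least L k (k + 1)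
   + 2 k + 1, leaving a bound e^-k. *)
have L1 : 0 < (16 * (L + 1))^-1 by rewrite invr_gt0 mulr_gt0 //; lra.
have [N1 HN1] := null_natX_geometric 2 ui L1.
have st01 : 0 < s / t < 1 by rewrite divr_gt0 //= ltr_pdivrMr // mul1r.
have nst : null (fun k => t^-1 * (s / t) ^+ k).
  by apply: nullZ; [rewrite invr_ge0 ltW|exact: null_geometric].
have [N2 HN2] := nst 1 ltr01.
have nkt : null (fun k => k%:R ^+ 1 * t ^+ k + t ^+ k).
  by apply: nullD; [exact: null_natX_geometric|exact: null_geometric].
have [N3 HN3] := nkt 2^-1 ltac:(lra).
apply: (@null_log_scale _ t (fun k => t^-1 * (s / t) ^+ k + expR (-1) ^+ k) _
   (maxn (maxn 1 N1) (maxn N2 N3))) => //.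
  apply: nullD => //; apply: null_geometric; rewrite expR_gt0 expR_lt1; lra.
move=> n k _; rewrite !geq_max => /andP[/andP[k1 kN1] /andP[kN2 kN3]] nk1 nk2.
have tk : 0 < t ^+ k by rewrite exprn_gt0.
have nR : 0 < n%:R :> R by rewrite -(pmulr_lgt0 _ tk) (lt_le_trans ltr01).
have n0 : (0 < n)%N by rewrite -(ltr0n R).
have kn : (k.+1 * 2 <= n)%N.
  have := HN3 k kN3; rewrite expr1 => H; rewrite -(ler_nat R) natrM -natr1.
  rewrite -(ler_pM2r tk); apply: le_trans nk1; lra.
have kn1 : (k <= n)%N by clear -kn; lia.
have kn2 : (n <= (n - k) * 2)%N by clear -kn; lia.
have nt : n%:R <= t^-1 * (t ^+ k)^-1.
  by rewrite -invfM -exprS -(ler_pM2r (exprn_gt0 k.+1 t0)) mulVf ?gt_eqF ?exprn_gt0 // ltW.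
apply: (@le_trans _ _ (Pr p (fun E : {set 'I_n * 'I_n} =>
    [exists D : {set 'I_n}, (#|D| == k.+1) && (edges D \subset E)]) +
  Pr p (fun E : {set 'I_n * 'I_n} => [exists D : {set 'I_n}, (#|D| <= k)%N &&
    ((edges D \subset E) && dominates D D E)]))).
  apply: Pr_cup2 => // E; rewrite -negb_or negbK => H.
  have [D [cD dD]] : exists D : {set 'I_n}, edges D \subset E /\ dominates D D E.
    have dom D : [exists z in ~: D, relE (gadj E) D z] == false -> dominates D D E.
      by rewrite eqbF_neg negb_exists_in.
    case/orP: H => /existsP[D /and4P[_]]; rewrite clique_edges => cD _ /dom dD;
      by exists D.
  have [Dk|Dk] := leqP #|D| k.
    by apply/orP; right; apply/existsP; exists D; rewrite Dk cD dD.
  have : (0 < #|[set B : {set 'I_n} | B \subset D & #|B| == k.+1]|)%N.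
    by rewrite cards_draws bin_gt0.
  move=> /card_gt0P[B]; rewrite inE => /andP[BD cB].
  apply/orP; left; apply/existsP; exists B; rewrite cB /=; apply: subset_trans cD.
  apply/subsetP => a; rewrite !inE => /andP[-> /andP[aB bB]].
  by rewrite !(subsetP BD).
apply: lerD.
  apply: le_trans (Pr_clique_of_size _ _ p0' p1') _.
  have -> : p ^+ 'C(k.+1, 2) = s ^+ k ^+ k.+1.
    transitivity (s ^+ (2 * 'C(k.+1, 2))); first by rewrite exprM sqr_sqrtr.
    by rewrite -mul_bin_diag bin1 mulnC exprM.
  rewrite -exprMn; set b := n%:R * s ^+ k.
  have b0 : 0 <= b by rewrite mulr_ge0 // exprn_ge0 // ltW.
  have bb : b <= t^-1 * (s / t) ^+ k.
    rewrite [leRHS](_ : _ = t^-1 * (t ^+ k)^-1 * s ^+ k); last first.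
      by rewrite exprMn exprVn mulrAC mulrA.
    by rewrite ler_wpM2r // exprn_ge0 // ltW.
  have b1 : b <= 1 by apply: le_trans bb (HN2 k kN2).
  by apply: le_trans bb; rewrite exprS ler_piMr // exprn_ile1.
apply: le_trans (Pr_small_dominating p0 p1 n0 kn1) _.
have kR : 1 <= k%:R :> R by rewrite ler1n.
have uk : 8 * (L + 1) * k%:R ^+ 2 <= u ^+ k / 2.
  have := HN1 k kN1; rewrite exprVn.
  have uk0 : 0 < u ^+ k by rewrite exprn_gt0 // (lt_trans ltr01).
  rewrite ler_pdivrMr // mulrC ler_pdivlMr; last by rewrite mulr_gt0 //; lra.
  by lra.
have e1 : n%:R ^+ k <= expR (L * (k.+1%:R * k%:R)).
  rewrite -natrM expRM_natr LE exprM; apply: lerXn2r; rewrite ?nnegrE ?ler0n ?exprn_ge0 ?invr_ge0 ?(ltW t0) //.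
  by rewrite exprVn exprS invfM.
have e2 : u ^+ k / 2 <= (n - k)%:R * q ^+ k.
  apply: (@le_trans _ _ (n%:R * q ^+ k / 2)).
    rewrite ler_wpM2r ?invr_ge0 // /u exprMn exprVn ler_pdivrMr // mulrAC.
    by rewrite ler_peMl // exprn_ge0 // ltW.
  rewrite mulrAC ler_wpM2r ?exprn_ge0 ?(ltW q0) // ler_pdivrMr // -[2]/(2%:R) -natrM ler_nat //.
have e3 : k.+1%:R <= expR k.+1%:R :> R by apply: le_trans (expR_ge1Dx _); lra.
apply: (@le_trans _ _ (expR k.+1%:R * expR (L * (k.+1%:R * k%:R)) * expR (- ((n - k)%:R * q ^+ k)))).
  by apply: ler_wpM2r; rewrite ?expR_ge0 //; apply: ler_pM; rewrite ?ler0n ?exprn_ge0.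
rewrite -!exp.expRD -expRM_natr ler_expR -natr1.
move: (k%:R : R) kR uk e2 => x; move: (u ^+ k / 2) ((n - k)%:R * q ^+ k) => y w.
move=> x1 h1 h2; have h3 : 0 <= x * (x - 1) by rewrite mulr_ge0 //; lra.
have h4 := mulr_ge0 L0 h3; have h5 := mulr_ge0 L0 (sqr_ge0 x).
by lra.
Qed.

End TypicalCliques.

(** * The critical probability *)

Definition ndc (V : finType) (e : rel V) : bool := [exists X : {set V},
  [&& [forall x in X, relF e X x], [forall z in ~: X, ~~ relE e X z] &
      [exists z in ~: X, relF e X z]]].

(* "There is a nonmaximal dominating clique", with [A] in the role of adjacency. *)
Definition ndc_sentence (A : fo) : fo :=
  FAnd (FAll (FAll (FOr (FNot (FInX 0)) (FOr (FNot (FInX 1)) (FOr (FEq 0 1) A)))))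
  (FAnd (FAll (FOr (FInX 0) (FEx (FAnd (FInX 0) A))))
        (FEx (FAnd (FNot (FInX 0)) (FAll (FOr (FNot (FInX 0)) A))))).

Lemma reval_ndc_sentence (V : finType) (e e' : rel V) A X :
  symmetric e' -> irreflexive e' ->
  (forall x y, reval e X [:: y; x] A = e' y x) ->
  reval e X [::] (ndc_sentence A) =
  [&& [forall x in X, relF e' X x], [forall z in ~: X, ~~ relE e' X z] &
      [exists z in ~: X, relF e' X z]].
Proof.
move=> sym irr HA /=; congr [&& _, _ & _].
- apply/forallP/forall_inP => [H x xX|H x].
    apply/relFP => y yX yx; have /forallP/(_ y) := H x.
    by rewrite yX xX HA (negPf yx) sym.
  apply/forallP => y; rewrite HA.
  case: (boolP (y \in X)) => //= yX; case: (boolP (x \in X)) => //= xX.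
  have [//|yx] := eqVneq y x.
  by rewrite sym; move/relFP: (H x xX); apply.
- apply/forallP/forall_inP => [H z|H z].
    rewrite inE => zX; have := H z; rewrite (negPf zX) /= => /existsP[y /andP[yX]].
    by rewrite HA => yz; apply/relEPn; exists y; rewrite yX sym yz; split=> //;
      apply: contraNneq zX => <-.
  case: (boolP (z \in X)) => //= zX; have := H z; rewrite inE => /(_ zX) /relEPn[y [yX yz ezy]].
  by apply/existsP; exists y; rewrite yX HA sym.
- apply/existsP/existsP => -[z /andP[zX H]]; exists z; rewrite ?inE ?zX.
    apply/relFP => y yX yz; have /forallP/(_ y) := H.
    by rewrite yX HA sym.
  rewrite inE in zX; rewrite zX /=; apply/forallP => y; rewrite HA.
  case: (boolP (y \in X)) => //= yX; rewrite sym; move/relFP: H; apply=> //.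
  by apply: contraNneq zX => <-.
Qed.

Lemma models_ndc n (E : {set 'I_n * 'I_n}) :
  models_E12 (E :&: pairs n) (ndc_sentence (FAdj 0 1)) = ndc (gadj E).
Proof.
apply: eq_existsb => X; rewrite eval_reval adj_gadj; apply: reval_ndc_sentence => //.
  exact: gadj_sym.
exact: gadj_irr.
Qed.

Lemma models_ndc_crel n (E : {set 'I_n * 'I_n}) :
  models_E12 (E :&: pairs n) (ndc_sentence (FAnd (FNot (FEq 0 1)) (FNot (FAdj 0 1)))) =
  ndc (gadj (~: E)).
Proof.
apply: eq_existsb => X; rewrite eval_reval adj_gadj gadj_setC; apply: reval_ndc_sentence => //.
  exact: crel_sym (@gadj_sym _ E).
exact: crel_irr.
Qed.

(** * Critical probability: the first moment bound *)

Section FirstMoment.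
Variables (R : realType) (p : R).
Hypotheses (p0 : 0 < p) (p1 : p < 1) (pq : p = (1 - p) ^+ 2).
Let q : R := 1 - p.
Let q0 : 0 < q. Proof. by rewrite subr_gt0. Qed.
Let q1 : q < 1. Proof. by rewrite gtrBl. Qed.

(** Criticality makes the clique probability a power of q^k, the quantity that also governs
    domination. *)
Lemma pX_bin2 k : p ^+ 'C(k.+1, 2) = q ^+ k ^+ k.+1.
Proof.
by rewrite [X in X ^+ _]pq -/q -!exprM -mul_bin_diag bin1 mulnC.
Qed.

(** A union bound over the clique [D] and a vertex [v] extending it to a clique on k + 1
    vertices. *)
Lemma Pr_ndc_le n : (0 < n)%N ->
  Pr p (fun E : {set 'I_n * 'I_n} => ndc (gadj E)) <=
  \sum_(k < n) 'C(n, k)%:R * n%:R * (q ^+ k ^+ k.+1 * (1 - q ^+ k) ^+ (n - k.+1)).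
Proof.
move=> n0; have [p0' p1'] := (ltW p0, ltW p1).
pose P (Dv : {set 'I_n} * 'I_n) := Dv.2 \notin Dv.1.
apply: (@le_trans _ _ (\sum_(Dv | P Dv)
    Pr p (fun E => (edges (Dv.2 |: Dv.1) \subset E) && dominates Dv.1 (Dv.2 |: Dv.1) E))).
  apply: Pr_cup => // E /existsP[D /and3P[cD /forall_inP dD /exists_inP[v vD vF]]].
  rewrite inE in vD; exists (D, v) => //=; apply/andP; split.
    rewrite -clique_edges; apply/forall_inP => x xC; apply/relFP => y yC yx.
    move: xC yC yx; rewrite !inE => /orP[/eqP->|xD] /orP[/eqP->|yD] yx.
    - by rewrite eqxx in yx.
    - by move/relFP: vF; apply.
    - by rewrite gadj_sym; move/relFP: vF; apply=> //; rewrite eq_sym.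
    - by move/forall_inP: cD => /(_ x xD)/relFP; apply.
  by apply/forall_inP => w; rewrite !inE negb_or => /andP[_ wD]; apply: dD; rewrite inE.
pose G k : R := q ^+ k ^+ k.+1 * (1 - q ^+ k) ^+ (n - k.+1).
have G0 k : 0 <= G k.
  by rewrite mulr_ge0 ?exprn_ge0 ?subr_ge0 ?exprn_ile1 // ltW.
apply: (@le_trans _ _ (\sum_(Dv | P Dv) G #|Dv.1|)).
  apply: ler_sum => -[D v] /= vD; rewrite /P /= in vD.
  by rewrite Pr_clique_dominates ?subsetUr // cardsU1 vD add1n pX_bin2.
have ltn Dv : P Dv -> (#|Dv.1| < n)%N.
  case: Dv => D v /= vD; rewrite -[n in (_ < n)%N]card_ord -cardsT; apply: proper_card.
  by apply/properP; split; [exact: subsetT|exists v; rewrite ?inE].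
pose size1 (Dv : {set 'I_n} * 'I_n) : 'I_n := insubd (Ordinal n0) #|Dv.1|.
rewrite (partition_big size1 xpredT) //=.
apply: ler_sum => k _; rewrite (eq_bigr (fun=> G k)); last first.
  by move=> Dv /andP[/ltn Dn /eqP <-]; rewrite /size1 val_insubd Dn.
rewrite sumr_const -[leLHS]mulr_natl ler_wpM2r // -natrM ler_nat.
have -> : ('C(n, k) * n)%N = #|setX [set D : {set 'I_n} | #|D| == k] [set: 'I_n]|.
  by rewrite cardsX cardsT card_draws !card_ord.
apply: subset_leq_card; apply/subsetP => Dv; rewrite unfold_in !inE => /andP[/ltn Dn /eqP <-].
by rewrite /size1 val_insubd Dn eqxx.
Qed.

(** The term is at most e^A m^(k+1) e^-m / k!, where [A] absorbs the k + 1 missing factors. The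
    power of m is then bounded by one term of the series of e^(m/theta); [theta] is free, to be
    matched to the ratio m / k. *)
Lemma first_moment_term A n k theta : (k < n)%N -> 0 < theta -> k.+1%:R * q ^+ k <= A ->
  'C(n, k)%:R * n%:R * (q ^+ k ^+ k.+1 * (1 - q ^+ k) ^+ (n - k.+1)) <=
  expR A * (k.+1%:R * theta ^+ k.+1 * expR (n%:R * q ^+ k * (theta^-1 - 1))).
Proof.
move=> kn th0 HA; set m := n%:R * q ^+ k.
have qk0 : 0 < q ^+ k by rewrite exprn_gt0.
have qk1 : q ^+ k <= 1 by rewrite exprn_ile1 // ltW.
have qk1' : 0 <= 1 - q ^+ k by rewrite subr_ge0.
have [qk0' p1'] := (ltW qk0, ltW p1).
have m0 : 0 <= m by rewrite mulr_ge0 // ltW.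
have f0 : 0 < (k`!)%:R :> R by rewrite ltr0n fact_gt0.
have b1 : 'C(n, k)%:R <= n%:R ^+ k / (k`!)%:R :> R.
  by rewrite ler_pdivlMr // -natrX -natrM ler_nat bin_ffact leq_ffact_expn.
have b2 : (1 - q ^+ k) ^+ (n - k.+1) <= expR A * expR (- m).
  apply: le_trans (expr_le_expR _ (ltW qk0) qk1) _.
  by rewrite -exp.expRD ler_expR natrB // /m; lra.
have b3 : m ^+ k.+1 / (k`!)%:R <= k.+1%:R * (theta ^+ k.+1 * expR (m / theta)).
  have := @expR_ge1Dxn R (m / theta) k (divr_ge0 m0 (ltW th0)).
  rewrite exprMn exprVn => H.
  have thk : 0 < theta ^+ k.+1 by rewrite exprn_gt0.
  have {}H : m ^+ k.+1 / theta ^+ k.+1 / (k.+1`!)%:R <= expR (m / theta) by lra.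
  rewrite factS natrM invfM in H.
  have kk : 0 < k.+1%:R :> R by rewrite ltr0n.
  rewrite -ler_pdivrMl // -ler_pdivrMl //.
  by apply: le_trans H; rewrite le_eqVlt; apply/orP; left; apply/eqP; ring.
apply: (@le_trans _ _ (n%:R ^+ k / (k`!)%:R * n%:R * (q ^+ k ^+ k.+1 * (expR A * expR (- m))))).
  apply: ler_pM => //; rewrite ?mulr_ge0 ?exprn_ge0 ?subr_ge0 ?ler0n ?(ltW qk0) //.
    by rewrite ler_wpM2r.
  by rewrite ler_wpM2l ?exprn_ge0 // ltW.
have -> : n%:R ^+ k / (k`!)%:R * n%:R * (q ^+ k ^+ k.+1 * (expR A * expR (- m))) =
    expR A * (m ^+ k.+1 / (k`!)%:R * expR (- m)).
  by rewrite /m exprMn [n%:R ^+ k.+1]exprSr; ring.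
rewrite ler_wpM2l ?expR_ge0 //.
apply: le_trans (ler_wpM2r (expR_ge0 _) b3) _.
rewrite mulrBr mulr1 exp.expRD !mulrA //.
Qed.

Lemma xexpR_lt1 (x : R) : 0 < x -> x != 1 -> 0 < x * expR (1 - x) < 1.
Proof.
move=> x0 x1; rewrite mulr_gt0 ?expR_gt0 //=.
have xn : x - 1 != 0 by rewrite subr_eq0.
have := expR_gt1Dx xn => H.
rewrite -[X in _ < X](expRxMexpNx_1 (x - 1)) opprB ltr_pM2r ?expR_gt0 //; lra.
Qed.

Lemma card_ord_le n k : (#|[pred i : 'I_n | (i <= k)%N]| <= k.+1)%N.
Proof.
rewrite cardE -(size_map val) -[leqRHS](size_iota 0); apply: uniq_leq_size.
  by rewrite map_inj_uniq ?enum_uniq //; exact: val_inj.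
by move=> x /mapP[i]; rewrite mem_enum => ik ->; rewrite mem_iota /= add0n ltnS.
Qed.

(** The ratio jumps over 1 right after size k. Sizes i <= k have m >= theta k and are treated with
    [theta]; sizes i > k have m <= theta q k + 1 and are treated with [vt]. Both bases theta
    e^(1-theta) and vt e^(1-vt) are below 1. *)
Lemma ndc_first_moment theta : 1 < theta -> theta * q < 1 ->
  exists u : nat -> R, null u /\ forall n k, (0 < k)%N ->
    theta * k%:R <= n%:R * q ^+ k -> n%:R * q ^+ k <= theta * k%:R + 1 ->
    Pr p (fun E : {set 'I_n * 'I_n} => ndc (gadj E)) <= u k.
Proof.
move=> th1 thq; have th0 : 0 < theta by lra.
pose vt := theta * q; have vt0 : 0 < vt by rewrite mulr_gt0.
have q01 : 0 < q < 1 by rewrite q0.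
have [A1 A10 HA1] := mulrn_geometric_bounded q01.
pose A := A1 + 1.
have HA k : k.+1%:R * q ^+ k <= A.
  rewrite -natr1 mulrDl mul1r; by apply: lerD (HA1 k) _; rewrite exprn_ile1 ?(ltW q0) ?(ltW q1).
pose r := theta * expR (1 - theta); pose r' := vt * expR (1 - vt).
have r01 : 0 < r < 1 by apply: xexpR_lt1; rewrite // gt_eqF.
have r01' : 0 < r' < 1 by apply: xexpR_lt1; rewrite // lt_eqF.
have [r0 r1] := andP r01; have [r0' r1'] := andP r01'.
(* r'^(i+1) is split in two: one half absorbs the factor i + 1, and the other, split again by [si],
   yields decay in k and a series summable in i. *)
pose rho := Num.sqrt r'.
have rho0 : 0 < rho by rewrite sqrtr_gt0.
have rho2 : rho * rho = r' by rewrite -expr2 sqr_sqrtr // ltW.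
have rho1 : rho < 1 by rewrite -[X in _ < X]sqrtr1 ltr_sqrt.
pose si := Num.sqrt rho.
have si0 : 0 < si by rewrite sqrtr_gt0.
have si2 : si * si = rho by rewrite -expr2 sqr_sqrtr // ltW.
have si1 : si < 1 by rewrite -[X in _ < X]sqrtr1 ltr_sqrt.
have rho01 : 0 < rho < 1 by rewrite rho0.
have [B B0 HB] := mulrn_geometric_bounded rho01.
pose c1 := expR A * theta; pose c2 := expR A * expR (vt^-1 - 1) * B.
have c10 : 0 <= c1 by rewrite mulr_ge0 ?expR_ge0 // ltW.
have c20 : 0 <= c2 by rewrite !mulr_ge0 ?expR_ge0.
pose U (k : nat) : R := c1 * 4 * (k%:R ^+ 2 * r ^+ k) + c2 * (1 - si)^-1 * si ^+ k.
exists U; split.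
  apply: nullD; apply: nullZ.
  - by rewrite mulr_ge0.
  - exact: null_natX_geometric.
  - by rewrite mulr_ge0 // invr_ge0 subr_ge0 ltW.
  - by apply: null_geometric; rewrite si0.
move=> n k k0 h1 h2.
have kR : 1 <= k%:R :> R by rewrite ler1n.
have qk0 : 0 < q ^+ k by rewrite exprn_gt0.
have n0 : (0 < n)%N.
  rewrite -(ltr0n R) -(pmulr_lgt0 _ qk0); apply: lt_le_trans h1; rewrite mulr_gt0 //; lra.
apply: le_trans (Pr_ndc_le n0) _.
pose bnd (i : nat) := (if (i <= k)%N then c1 * (k.+1%:R * r ^+ k) else 0) + c2 * (si ^+ k * si ^+ i).
have rk0 : 0 <= r ^+ k by rewrite exprn_ge0 // ltW.
have ski i : 0 <= si ^+ i by rewrite exprn_ge0 // ltW.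
apply: (@le_trans _ _ (\sum_(i < n) bnd i)).
  apply: ler_sum => i _; rewrite /bnd; case: leqP => ik.
    apply: (@le_trans _ _ (c1 * (k.+1%:R * r ^+ k))); last first.
      by rewrite lerDl mulr_ge0 // mulr_ge0.
    apply: le_trans (first_moment_term (ltn_ord i) th0 (HA i)) _.
    rewrite /c1 -[leRHS]mulrA ler_wpM2l ?expR_ge0 //.
    have m1 : theta * k%:R <= n%:R * q ^+ i.
      by apply: le_trans h1 _; rewrite ler_wpM2l //; apply: ler_wiXn2l => //; exact: ltW.
    apply: (@le_trans _ _ (k.+1%:R * theta ^+ k.+1 * expR (k%:R * (1 - theta)))).
      apply: ler_pM; rewrite ?mulr_ge0 ?exprn_ge0 ?expR_ge0 ?(ltW th0) //.
        apply: ler_pM; rewrite ?exprn_ge0 ?(ltW th0) ?ler_nat //.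
        by apply: ler_weXn2l => //; exact: ltW.
      rewrite ler_expR.
      have -> : k%:R * (1 - theta) = theta * k%:R * (theta^-1 - 1) by field; rewrite gt_eqF.
      by rewrite ler_wnM2r // subr_le0 invf_le1 // ltW.
    rewrite expRM_natl /r exprMn exprS le_eqVlt; apply/orP; left; apply/eqP; ring.
  rewrite add0r.
  have HA' : i.+1%:R * q ^+ i <= A := HA i.
  apply: le_trans (first_moment_term (ltn_ord i) vt0 HA') _.
  rewrite /c2 -[leRHS]mulrA -[leRHS]mulrA ler_wpM2l ?expR_ge0 //.
  have m2 : n%:R * q ^+ i <= vt * k%:R + 1.
    apply: (@le_trans _ _ (n%:R * q ^+ k.+1)).
      by rewrite ler_wpM2l //; apply: ler_wiXn2l => //; exact: ltW.
    rewrite exprSr mulrA; apply: le_trans (ler_wpM2r (ltW q0) h2) _.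
    by rewrite /vt; have := q1; lra.
  have e1 : expR (n%:R * q ^+ i * (vt^-1 - 1)) <= expR (vt^-1 - 1) * expR (1 - vt) ^+ i.+1.
    rewrite -expRM_natl -exp.expRD ler_expR.
    have iv : 0 <= vt^-1 - 1 by rewrite subr_ge0 invf_ge1 // ltW.
    apply: le_trans (ler_wpM2r iv m2) _.
    have ikR : k%:R <= i.+1%:R :> R by rewrite ler_nat ltnW // ltnW.
    have E1 : (vt * k%:R + 1) * (vt^-1 - 1) = k%:R * (1 - vt) + (vt^-1 - 1) by field; rewrite gt_eqF.
    have v1 : 0 <= 1 - vt by rewrite subr_ge0 ltW.
    by rewrite E1; have := ler_wpM2r v1 ikR; lra.
  apply: (@le_trans _ _ (expR (vt^-1 - 1) * (i.+1%:R * r' ^+ i.+1))).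
    apply: le_trans (ler_wpM2l _ e1) _.
      by rewrite mulr_ge0 // exprn_ge0 // ltW.
    by rewrite /r' [(vt * _) ^+ _]exprMn mulrCA -[X in _ * X <= _]mulrA.
  rewrite ler_wpM2l ?expR_ge0 // -rho2 exprMn mulrA.
  apply: ler_pM; rewrite ?mulr_ge0 ?exprn_ge0 ?(ltW rho0) //.
  rewrite -si2 exprMn; apply: ler_pM; rewrite ?exprn_ge0 ?(ltW si0) //; apply: ler_wiXn2l; rewrite ?(ltW si0) ?(ltW si1) //.
  by rewrite ltnW // ltnW.
rewrite big_split /=; apply: lerD.
  rewrite -big_mkcond /= sumr_const -[leLHS]mulr_natl.
  apply: (@le_trans _ _ (k.+1%:R * (c1 * (k.+1%:R * r ^+ k)))).
    apply: ler_wpM2r; first by rewrite mulr_ge0 // mulr_ge0.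
    by rewrite ler_nat; exact: card_ord_le.
  rewrite -natr1 [leLHS](_ : _ = c1 * r ^+ k * (k%:R + 1) ^+ 2); last by ring.
  rewrite [leRHS](_ : _ = c1 * r ^+ k * (4 * k%:R ^+ 2)); last by ring.
  apply: ler_wpM2l; first exact: mulr_ge0.
  move: (k%:R : R) kR => x x1.
  have y1 : 0 <= x - 1 by lra.
  have y2 : 0 <= 3 * x + 1 by lra.
  by have := mulr_ge0 y1 y2; lra.
rewrite -!big_distrr /= -mulrA ler_wpM2l // mulrC ler_wpM2r //.
by apply: sum_geometric_le => //; exact: ltW.
Qed.

End FirstMoment.

(** * Elementary exponential and factorial bounds *)

Section ExpBounds.
Variable R : realType.

Lemma one_sub_ge_expR (x : R) : x < 1 -> expR (- (x / (1 - x))) <= 1 - x.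
Proof.
move=> x1; have d : 0 < 1 - x by lra.
rewrite expRN -[leRHS]invrK lef_pV2 ?posrE ?expR_gt0 ?invr_gt0 //.
apply: le_trans (expR_ge1Dx _); rewrite le_eqVlt; apply/orP; left; apply/eqP.
by field; rewrite gt_eqF.
Qed.

Lemma bernoulli_sub (x : R) m : 0 <= x -> x <= 1 -> 1 - m%:R * x <= (1 - x) ^+ m.
Proof.
move=> x0 x1; elim: m => [|m IH]; first by rewrite mul0r subr0 expr0.
rewrite exprS -natr1; have d : 0 <= 1 - x by lra.
have : 0 <= m%:R * x * x by rewrite !mulr_ge0.
by have := ler_wpM2l d IH; lra.
Qed.

(** A weak Stirling bound; the induction step rests on (1 + 1/K)^(K+1) >= e. *)
Lemma fact_expR_le K : (0 < K)%N ->
  (K`!)%:R * expR K%:R <= expR 1 * K%:R * K%:R ^+ K :> R.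
Proof.
elim: K => // -[_ _|K IH _]; first by rewrite factS fact0 mul1r expr1n !mulr1.
have {}IH := IH isT.
have K0 : 0 < K.+1%:R :> R by rewrite ltr0n.
have K0' : 0 < K.+2%:R :> R by rewrite ltr0n.
have e1 : expR 1 * K.+1%:R ^+ K.+2 <= K.+2%:R ^+ K.+2 :> R.
  have : expR (K.+2%:R^-1) <= K.+2%:R / K.+1%:R :> R.
    have := expR_ge1Dx (- (K.+2%:R^-1 : R)); rewrite expRN => H.
    have H' : K.+1%:R / K.+2%:R <= (expR (K.+2%:R^-1))^-1 :> R.
      apply: le_trans H; move: K0'; rewrite -[K.+2%:R]natr1; move: (K.+1%:R : R) => z z0.
      by rewrite le_eqVlt; apply/orP; left; apply/eqP; field; rewrite gt_eqF.
    by rewrite -lef_pV2 ?posrE ?expR_gt0 ?divr_gt0 // invf_div.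
  rewrite ler_pdivlMr // => H.
  have : (expR (K.+2%:R^-1) * K.+1%:R) ^+ K.+2 <= K.+2%:R ^+ K.+2 :> R.
    by apply: lerXn2r; rewrite ?nnegrE ?mulr_ge0 ?expR_ge0 ?ler0n.
  by rewrite exprMn -expRM_natl divff ?gt_eqF.
rewrite factS natrM -[X in expR X]natr1 exp.expRD.
apply: (@le_trans _ _ (K.+2%:R * expR 1 * (expR 1 * K.+1%:R * K.+1%:R ^+ K.+1))).
  rewrite [leLHS](_ : _ = K.+2%:R * expR 1 * ((K.+1)`!%:R * expR K.+1%:R)); last by ring.
  by rewrite ler_wpM2l ?mulr_ge0 ?expR_ge0.
rewrite [leLHS](_ : _ = expR 1 * K.+2%:R * (expR 1 * K.+1%:R ^+ K.+2)); last first.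
  by rewrite [K.+1%:R ^+ K.+2]exprS; move: (K.+1%:R ^+ K.+1) => z; ring.
by rewrite ler_wpM2l ?mulr_ge0 ?expR_ge0.
Qed.

End ExpBounds.

(** * Critical probability: the second moment bound *)

Section SecondMoment.
Variables (R : realType) (p : R) (n k : nat).
Hypotheses (p0 : 0 < p) (p1 : p < 1) (pq : p = (1 - p) ^+ 2).
Local Notation q := (1 - p).
Local Notation K := k.+1.
Local Notation x := (q ^+ k).
Local Notation h := (Num.sqrt q).
Local Notation y := (K%:R ^+ 3 * h ^+ K).
(** [lo] and [hi] place m = n q^k within one step of K = k + 1, where m^(k+1) e^-m is maximal; [c1]
    to [c4] hold for all large k. *)
Hypotheses (k0 : (0 < k)%N) (lo : K%:R <= n%:R * x) (hi : n%:R * x <= K%:R + x).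
Hypotheses (c1 : 8 * K%:R * x <= 1) (c2 : y <= 2^-1).
Hypotheses (c3 : (K%:R + 1) * h ^+ K <= q) (c4 : K%:R * expR (- (p * k%:R)) <= 1).
Implicit Types (C : {set 'I_n}) (E : {set 'I_n * 'I_n}).

Let q0 : 0 < q. Proof. by rewrite subr_gt0. Qed.
Let q1 : q < 1. Proof. by rewrite gtrBl. Qed.
Let x0 : 0 < x. Proof. by rewrite exprn_gt0. Qed.
Let KR : 2 <= K%:R :> R. Proof. by rewrite ler_nat. Qed.
Let x16 : 16 * x <= 1.
Proof. by apply: le_trans c1; rewrite ler_wpM2r ?(ltW x0) //; have := KR; lra. Qed.
Let h0 : 0 < h. Proof. by rewrite sqrtr_gt0. Qed.
Let h1 : h < 1. Proof. by rewrite -[X in _ < X]sqrtr1 ltr_sqrt. Qed.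
Let hh : h ^+ 2 = q. Proof. by rewrite sqr_sqrtr // ltW. Qed.
Let n2K : 2 * K%:R ^+ 2 <= n%:R :> R.
Proof.
rewrite -(ler_pM2r x0); apply: le_trans lo.
have := KR; have := x0; have := c1; move: (K%:R : R) (q ^+ k) => a b; nra.
Qed.
Let nK : (2 * K <= n)%N.
Proof.
rewrite -(ler_nat R) natrM; apply: le_trans n2K; have := KR; move: (K%:R : R) => a; nra.
Qed.

Definition weight : R := p ^+ 'C(K, 2) * (1 - x) ^+ (n - K).
Local Notation a := weight.

Definition ndcC C (v : 'I_n) E : bool := (edges C \subset E) && dominates (C :\ v) C E.

Lemma weight_gt0 : 0 < a.
Proof. by rewrite mulr_gt0 ?exprn_gt0 // subr_gt0; have := x16; have := x0; lra. Qed.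

Lemma Pr_ndcC C v : #|C| = K -> v \in C -> Pr p (ndcC C v) = a.
Proof.
move=> cC vC; rewrite Pr_clique_dominates ?subD1set // cC.
by have := cardsD1 v C; rewrite vC cC add1n => -[<-].
Qed.

Lemma ndcC_ndc C v E : #|C| = K -> v \in C -> ndcC C v E -> ndc (gadj E).
Proof.
move=> cC vC /andP[]; rewrite -clique_edges => /forall_inP cl /forall_inP dom.
have cD : #|C :\ v| = k by have := cardsD1 v C; rewrite vC cC add1n => -[<-].
have vF : relF (gadj E) (C :\ v) v.
  apply/relFP => z; rewrite !inE => /andP[zv zC] _.
  by move/relFP: (cl v vC); apply.
apply/existsP; exists (C :\ v); apply/and3P; split.
- apply/forall_inP => z; rewrite !inE => /andP[zv zC]; apply/relFP => w.
  by rewrite !inE => /andP[wv wC] wz; move/relFP: (cl z zC); apply.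
- apply/forall_inP => z; rewrite !inE negb_and negbK.
  have [->|zv] := eqVneq z v; last by move=> /= zC; apply: dom; rewrite inE.
  move=> _; have /card_gt0P[w wD] : (0 < #|C :\ v|)%N by rewrite cD.
  apply/relEPn; exists w; split=> //; first by move: wD; rewrite !inE => /andP[].
  by move/relFP: vF; apply=> //; move: wD; rewrite !inE => /andP[].
- by apply/exists_inP; exists v; rewrite ?inE ?eqxx.
Qed.

(** Correlation ratio at overlap j: q^-(j(j-1)) for the shared edges, and the exponential for
    vertices that both cliques fail to dominate, as n x is about K. The 2 pays for the vertices of
    the cliques themselves. *)
Definition corr (j : nat) : R := 2 / q ^+ (j * j.-1) * expR ((K%:R + 1) * q ^+ (k - j)).

Lemma dominates_sub (D C C' : {set 'I_n}) E : C \subset C' -> dominates D C E -> dominates D C' E.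
Proof.
move=> CC' /forall_inP H; apply/forall_inP => w; rewrite inE => wC; apply: H; rewrite inE.
by apply: contraNN wC; apply: (subsetP CC').
Qed.

Lemma pX_bin j : p ^+ 'C(j, 2) = q ^+ (j * j.-1).
Proof. by rewrite [X in X ^+ _]pq -!exprM -mul_bin_diag bin1. Qed.

Let hi2 : n%:R * x <= (K%:R + 1) * (1 - x) ^+ 2.
Proof.
apply: le_trans hi _; have := c1; have := KR; have := x0; have := x16.
move: (K%:R : R) (q ^+ k) => u z; nra.
Qed.

Lemma Pr_ndcC_pair C v C' v' : #|C| = K -> v \in C -> #|C'| = K -> v' \in C' -> C != C' ->
  Pr p (fun E => ndcC C v E && ndcC C' v' E) <= a ^+ 2 * corr #|C :&: C'|.
Proof.
move=> cC vC cC' vC' CC'; have [p0' p1'] := (ltW p0, ltW p1).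
set j := #|C :&: C'|; pose D := C :\ v; pose D' := C' :\ v'.
have cD : #|D| = k by have := cardsD1 v C; rewrite vC cC add1n => -[<-].
have cD' : #|D'| = k by have := cardsD1 v' C'; rewrite vC' cC' add1n => -[<-].
have jk : (j <= k)%N.
  rewrite -ltnS -cC; apply: proper_card; rewrite properEneq subsetIl andbT.
  apply: contraNneq CC' => E; rewrite eqEcard cC cC' leqnn andbT.
  by apply/setIidPl.
apply: (@le_trans _ _ (Pr p (fun E => [&& edges C \subset E, edges C' \subset E &
   dominates D (C :|: C') E && dominates D' (C :|: C') E]))).
  apply: le_Pr => // E /andP[/andP[-> d1] /andP[-> d2]] /=.
  by rewrite (dominates_sub (subsetUl _ _) d1) (dominates_sub (subsetUr _ _) d2).
rewrite Pr_clique_dominates2 ?subD1set // cC cC' -/j cD cD'.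
set base := _ - _ - _ + _.
(* [D] and [D'] share at most j vertices, so a vertex misses both with probability at most q^(2k-j),
   which is [z]. *)
pose z := x * q ^+ (k - j); pose beta := 1 - x - x + z.
have qkj0 : 0 < q ^+ (k - j) by rewrite exprn_gt0.
have qkj1 : q ^+ (k - j) <= 1 by rewrite exprn_ile1 // ltW.
have z0 : 0 < z by rewrite mulr_gt0.
have zx : z <= x by rewrite ger_pMr.
have b0 : 0 <= base.
  by rewrite /base addr_ge0 ?exprn_ge0 ?(ltW q0) //; have := x16; have := x0; lra.
have bb : base <= beta.
  rewrite lerD2l /z -exprD; apply: ler_wiXn2l; rewrite ?(ltW q0) ?(ltW q1) //.
  rewrite cardsU cD cD' addnBA //; apply: leq_sub2l; apply: subset_leq_card.
  by apply: setISS; exact: subD1set.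
have beta0 : 0 <= beta := le_trans b0 bb.
have b1 : beta <= 1 by rewrite /beta; have := x0; lra.
have cU : (#|C :|: C'| <= 2 * K)%N by rewrite cardsU cC cC' mul2n -addnn leq_subr.
have e1 : base ^+ (n - #|C :|: C'|) <= beta ^+ (n - 2 * K).
  apply: (@le_trans _ _ (beta ^+ (n - #|C :|: C'|))).
    by apply: lerXn2r.
  by apply: ler_wiXn2l => //; rewrite leq_sub2l.
have d0 : 0 < 1 - x by have := x16; have := x0; lra.
have d1 : 1 - x <= 1 by have := x0; lra.
have d2 : 0 < (1 - x) ^+ 2 by rewrite exprn_gt0.
have e2 : beta <= (1 - x) ^+ 2 * expR (z / (1 - x) ^+ 2).
  apply: (@le_trans _ _ ((1 - x) ^+ 2 * (1 + z / (1 - x) ^+ 2))); last first.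
    by rewrite ler_wpM2l ?(ltW d2) // expR_ge1Dx.
  rewrite mulrDr mulr1 mulrCA divff ?gt_eqF // mulr1 /beta lerD2r.
  by have := sqr_ge0 x; lra.
have e3 : beta ^+ (n - 2 * K) <= (1 - x) ^+ (2 * (n - 2 * K)) * expR ((K%:R + 1) * q ^+ (k - j)).
  apply: (@le_trans _ _ (((1 - x) ^+ 2 * expR (z / (1 - x) ^+ 2)) ^+ (n - 2 * K))).
    by apply: lerXn2r => //; rewrite nnegrE // mulr_ge0 ?expR_ge0 // ltW.
  rewrite exprMn -exprM -expRM_natl ler_wpM2l ?exprn_ge0 ?(ltW d0) // ler_expR.
  apply: (@le_trans _ _ (n%:R * (z / (1 - x) ^+ 2))).
    rewrite ler_wpM2r ?ler_nat ?leq_subr // divr_ge0 ?(ltW z0) ?(ltW d2) //.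
  rewrite /z mulrA mulrA [leLHS]mulrAC ler_wpM2r ?(ltW qkj0) //.
  by rewrite ler_pdivrMr.
have e4 : (1 - x) ^+ (2 * (n - 2 * K)) <= 2 * ((1 - x) ^+ (n - K) * (1 - x) ^+ (n - K)).
  have E1 : (1 - x) ^+ (n - K) * (1 - x) ^+ (n - K) =
      (1 - x) ^+ (2 * (n - 2 * K)) * (1 - x) ^+ (2 * K).
    by rewrite -!exprD; congr (_ ^+ _); clear -nK; lia.
  have E2 : 2^-1 <= (1 - x) ^+ (2 * K).
    apply: le_trans (bernoulli_sub _ (ltW x0) _); last by have := x16; have := x0; lra.
    by rewrite natrM; have := c1; lra.
  rewrite E1 mulrCA -[leLHS]mulr1 ler_wpM2l ?exprn_ge0 ?(ltW d0) //; lra.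
have cj : ('C(j, 2) <= 'C(K, 2))%N by apply: leq_bin2l; rewrite (leq_trans jk).
have pn0 : 0 < p ^+ 'C(j, 2) by rewrite exprn_gt0.
have E1 : p ^+ ('C(K, 2) + 'C(K, 2) - 'C(j, 2)) = p ^+ 'C(K, 2) * p ^+ 'C(K, 2) / p ^+ 'C(j, 2).
  apply: (mulIf (lt0r_neq0 pn0)); rewrite divfK ?lt0r_neq0 // -!exprD subnK //.
  by rewrite (leq_trans cj) // leq_addr.
rewrite E1 /a /corr -pX_bin.
apply: (@le_trans _ _ (p ^+ 'C(K, 2) * p ^+ 'C(K, 2) / p ^+ 'C(j, 2) *
   (2 * ((1 - x) ^+ (n - K) * (1 - x) ^+ (n - K)) * expR ((K%:R + 1) * q ^+ (k - j))))).
  apply: ler_wpM2l; first by rewrite !mulr_ge0 ?invr_ge0 ?exprn_ge0.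
  apply: le_trans e1 (le_trans e3 _).
  by rewrite ler_wpM2r ?expR_ge0.
move: (p ^+ 'C(K, 2)) (p ^+ 'C(j, 2)) pn0 ((1 - x) ^+ (n - K)) (expR _) => A B B0 F G.
by rewrite le_eqVlt; apply/orP; left; apply/eqP; field; rewrite gt_eqF.
Qed.

(** Here the union of [D] and [D'] is [C], and each outside vertex brings an extra factor at most 1
    - p x. Together these are at most e^(-pk) <= 1 / K, so the other pivots of [C] add at most one
    more [weight]. *)
Lemma Pr_ndcC_diag C v v' : #|C| = K -> v \in C -> v' \in C -> v != v' ->
  Pr p (fun E => ndcC C v E && ndcC C v' E) <= a / K%:R.
Proof.
move=> cC vC vC' vv; have [p0' p1'] := (ltW p0, ltW p1).
pose D := C :\ v; pose D' := C :\ v'.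
have cD : #|D| = k by have := cardsD1 v C; rewrite vC cC add1n => -[<-].
have cD' : #|D'| = k by have := cardsD1 v' C; rewrite vC' cC add1n => -[<-].
have DD : D :|: D' = C.
  apply/setP => w; rewrite !inE -andb_orl; case: (w \in C); rewrite ?andbF // andbT.
  by have [->|//] := eqVneq w v.
apply: (@le_trans _ _ (Pr p (fun E => [&& edges C \subset E, edges C \subset E &
   dominates D (C :|: C) E && dominates D' (C :|: C) E]))).
  by apply: le_Pr => // E /andP[/andP[-> d1] /andP[_ d2]] /=; rewrite setUid d1 d2.
rewrite Pr_clique_dominates2 ?subD1set // setUid setIid DD cC cD cD' addnK /a -mulrA.
rewrite ler_wpM2l ?exprn_ge0 //.
have d0 : 0 < 1 - x by have := x16; have := x0; lra.
have px0 : 0 <= p * x by rewrite mulr_ge0 // ltW.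
have px1 : p * x <= 1 by have := x16; have := x0; have := p1; have := p0; move: (q ^+ k) => z; nra.
apply: (@le_trans _ _ (((1 - x) * (1 - p * x)) ^+ (n - K))).
  apply: lerXn2r; rewrite ?nnegrE.
  - by rewrite addr_ge0 ?exprn_ge0 ?(ltW q0) //; have := x16; have := x0; lra.
  - by rewrite mulr_ge0 // ?(ltW d0) // subr_ge0.
  rewrite exprS; have : 0 <= x * x * p by rewrite !mulr_ge0 // ltW.
  by lra.
rewrite exprMn ler_wpM2l ?exprn_ge0 ?(ltW d0) //.
apply: le_trans (expr_le_expR _ px0 px1) _.
have K0 : 0 < K%:R :> R by rewrite ltr0n.
rewrite -(ler_pM2l K0) divff ?gt_eqF //; apply: le_trans c4; rewrite ler_pM2l // ler_expR lerN2.
rewrite mulrCA ler_wpM2l // natrB; last by clear -nK; lia.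
have : K%:R * x <= 1 by have := c1; have := x0; have := K0; nra.
by rewrite mulrBl; have := lo; rewrite -[K%:R]natr1; lra.
Qed.

Let K0 : 0 < K%:R :> R. Proof. by rewrite ltr0n. Qed.

Let nKR j : (j <= K)%N -> n%:R ^+ j <= 2 * (n - K)%:R ^+ j :> R.
Proof.
move=> jK; have n0 : 0 < n%:R :> R by apply: lt_le_trans n2K; rewrite mulr_gt0 ?exprn_gt0.
have -> : (n - K)%:R = n%:R * (1 - K%:R / n%:R) :> R.
  rewrite mulrBr mulr1 mulrCA divff ?gt_eqF // mulr1 natrB //.
  by apply: leq_trans nK; rewrite leq_pmull.
have r0 : 0 <= K%:R / n%:R :> R by rewrite divr_ge0.
have n2 := n2K.
have r1 : K%:R * (K%:R / n%:R) <= 2^-1 :> R.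
  by rewrite mulrA ler_pdivrMr // -expr2; lra.
have r2 : K%:R / n%:R <= 1 :> R.
  by rewrite ler_pdivrMr // mul1r ler_nat; apply: leq_trans nK; rewrite leq_pmull.
have b := bernoulli_sub j r0 r2.
have jK' : j%:R * (K%:R / n%:R) <= K%:R * (K%:R / n%:R) :> R by rewrite ler_wpM2r // ler_nat.
rewrite exprMn mulrCA -[leLHS]mulr1 ler_wpM2l ?exprn_ge0 //; lra.
Qed.

Lemma bin_sub_le j : (j <= K)%N ->
  'C(n, K - j)%:R * K%:R ^+ j <= 2 * ('C(n, K)%:R * (K ^_ j)%:R) * x ^+ j :> R.
Proof.
move=> jK.
have xj : 0 <= x ^+ j by rewrite exprn_ge0 // ltW.
apply: (@le_trans _ _ ('C(n, K - j)%:R * (2 * (n - K)%:R ^+ j * x ^+ j))).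
  rewrite ler_wpM2l //; apply: (@le_trans _ _ (n%:R ^+ j * x ^+ j)).
    by rewrite -exprMn; apply: lerXn2r; rewrite ?nnegrE // mulr_ge0 // ltW.
  by rewrite ler_wpM2r // nKR.
rewrite mulrA ler_wpM2r // mulrCA ler_wpM2l // -natrX -!natrM ler_nat.
exact: bin_falling_ratio.
Qed.

Let qX m : (K <= 2 * m)%N -> q ^+ m <= h ^+ K.
Proof.
move=> Km; rewrite -[X in X ^+ m]hh -exprM; apply: ler_wiXn2l => //; exact: ltW.
Qed.

(** For j <= K / 2 the exponential is bounded, and q^(j(K-j)) gives powers of h^K. For larger j it
    may reach e^(K+1), but the falling factorial is at most K!, and [fact_expR_le] cancels e^K;
    decay then comes in K - j. *)
Lemma corr_core j : (j <= k)%N ->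
  ('C(K, j) * K ^_ j)%:R * (q ^+ (j * (K - j)) * expR ((K%:R + 1) * q ^+ (k - j))) <=
  K%:R ^+ j * (expR 2 * (y ^+ j + y ^+ (K - j))).
Proof.
move=> jk; have [h0' h1'] := (ltW h0, ltW h1).
have hK0 : 0 <= h ^+ K by rewrite exprn_ge0.
have y0 : 0 <= y by rewrite mulr_ge0 // exprn_ge0.
have K1 : 1 <= K%:R :> R by rewrite ler1n.
have [jK|jK] := leqP (2 * j) K.
  have e1 : expR ((K%:R + 1) * q ^+ (k - j)) <= expR 2.
    rewrite ler_expR; apply: (@le_trans _ _ 1); last by lra.
    rewrite -(ler_pM2r q0) mul1r -mulrA -exprSr -subSn //; apply: le_trans c3.
    by rewrite ler_wpM2l ?addr_ge0 //; apply: qX; clear -jK; lia.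
  have e2 : q ^+ (j * (K - j)) <= h ^+ K ^+ j.
    rewrite mulnC exprM; apply: lerXn2r; rewrite ?nnegrE ?exprn_ge0 ?(ltW q0) //.
    by apply: qX; clear -jK; lia.
  have e3 : ('C(K, j) * K ^_ j)%:R <= K%:R ^+ j * K%:R ^+ 3 ^+ j :> R.
    rewrite mulnC natrM; apply: ler_pM => //; first by rewrite -natrX ler_nat leq_ffact_expn.
    rewrite -exprM; apply: (@le_trans _ _ (K%:R ^+ j)).
      by rewrite -natrX ler_nat leq_bin_expn.
    by apply: ler_weXn2l => //; clear; lia.
  apply: (@le_trans _ _ (K%:R ^+ j * K%:R ^+ 3 ^+ j * (h ^+ K ^+ j * expR 2))).
    apply: ler_pM => //; first by rewrite mulr_ge0 ?expR_ge0 ?exprn_ge0 // ltW.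
    by apply: ler_pM; rewrite ?expR_ge0 ?exprn_ge0 // ltW.
  rewrite -mulrA ler_wpM2l ?exprn_ge0 // mulrA -exprMn mulrC ler_wpM2l ?expR_ge0 //.
  by rewrite lerDl exprn_ge0.
set i := (K - j)%N; have i0 : (0 < i)%N by rewrite subn_gt0 ltnS.
have ijK : (j + i)%N = K by rewrite subnKC // ltnW.
have e1 : expR ((K%:R + 1) * q ^+ (k - j)) <= expR K%:R * expR 1.
  rewrite -exp.expRD ler_expR -[leRHS]mulr1 ler_wpM2l ?addr_ge0 // exprn_ile1 // ltW //.
have e2 : q ^+ (j * i) <= h ^+ K ^+ i.
  rewrite exprM; apply: lerXn2r; rewrite ?nnegrE ?exprn_ge0 ?(ltW q0) //.
  by apply: qX; rewrite ltnW.
have e3 : (K ^_ j)%:R * expR K%:R <= expR 1 * K%:R * (K%:R ^+ j * K%:R ^+ i) :> R.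
  rewrite -exprD ijK; apply: le_trans (fact_expR_le _ (ltn0Sn k)).
  rewrite ler_wpM2r ?expR_ge0 // ler_nat -(ffact_fact (leqW jk)).
  by rewrite leq_pmulr // fact_gt0.
have e4 : 'C(K, j)%:R <= K%:R ^+ i :> R.
  by rewrite -natrX ler_nat -bin_sub ?leq_bin_expn // ltnW.
have e5 : K%:R <= K%:R ^+ i :> R by rewrite -[leLHS]expr1; apply: ler_weXn2l.
have Ki0 : 0 <= K%:R ^+ i :> R by rewrite exprn_ge0.
have Kj0 : 0 <= K%:R ^+ j :> R by rewrite exprn_ge0.
have hi0 : 0 <= h ^+ K ^+ i by rewrite exprn_ge0.
have qji0 : 0 <= q ^+ (j * i) by rewrite exprn_ge0 // ltW.
have e0 : 0 <= expR 1 :> R by exact: expR_ge0.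
apply: (@le_trans _ _ (K%:R ^+ i * (expR 1 * K%:R * (K%:R ^+ j * K%:R ^+ i)) * (h ^+ K ^+ i * expR 1))).
  apply: (@le_trans _ _ ('C(K, j)%:R * ((K ^_ j)%:R * expR K%:R) * (q ^+ (j * i) * expR 1))).
    rewrite natrM.
    rewrite [leRHS](_ : _ = 'C(K, j)%:R * (K ^_ j)%:R * (q ^+ (j * i) * (expR K%:R * expR 1))); last first.
      by move: ('C(K, j)%:R : R) ((K ^_ j)%:R : R) (q ^+ (j * i)) (expR K%:R) => A B C D; ring.
    by rewrite ler_wpM2l ?mulr_ge0 // ler_wpM2l.
  apply: ler_pM; rewrite ?mulr_ge0 ?expR_ge0 //.
    by apply: ler_pM; rewrite ?mulr_ge0 ?expR_ge0.
  by rewrite ler_wpM2r.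
apply: (@le_trans _ _ (K%:R ^+ j * (expR 2 * y ^+ i))); last first.
  by rewrite ler_wpM2l // ler_wpM2l ?expR_ge0 // lerDr exprn_ge0.
have -> : y ^+ i = K%:R ^+ i ^+ 3 * h ^+ K ^+ i by rewrite exprMn -[_ ^+ 3 ^+ i]exprM mulnC exprM.
have -> : expR 2 = expR 1 * expR 1 :> R by rewrite -exp.expRD.
move: (K%:R ^+ i) (K%:R ^+ j) (h ^+ K ^+ i) (expR 1) e5 Ki0 Kj0 hi0 e0 => A B C D e5 A0 B0 C0 D0.
rewrite [leLHS](_ : _ = (B * (D * D) * (A * A) * C) * K%:R); last by ring.
rewrite [leRHS](_ : _ = (B * (D * D) * (A * A) * C) * A); last by ring.
by rewrite ler_wpM2l // !mulr_ge0.
Qed.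

Lemma corr_term j : (j <= k)%N ->
  ('C(K, j) * 'C(n, K - j))%:R * corr j <=
  'C(n, K)%:R * (4 * (expR 2 * (y ^+ j + y ^+ (K - j)))).
Proof.
move=> jk; have jK : (j <= K)%N := leqW jk.
have Kj0 : 0 < K%:R ^+ j :> R by rewrite exprn_gt0.
have Q0 : 0 < q ^+ (j * j.-1) by rewrite exprn_gt0.
(* The x^j from the binomial ratio outweighs the gain q^-(j(j-1)) from shared edges, leaving
   q^(j(K-j)). *)
have xE : x ^+ j = q ^+ (j * (K - j)) * q ^+ (j * j.-1).
  rewrite -exprM -exprD -mulnDr mulnC; congr (_ ^+ _).
  by case: (j) jk => // i ik; congr (_ * _)%N; rewrite subSS subnK // ltnW.
have B := bin_sub_le jK; have D := corr_core jk.
rewrite -(ler_pM2r Kj0) /corr natrM.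
set e := expR _ in D *; have e0 : 0 <= e by exact: expR_ge0.
apply: (@le_trans _ _ ('C(K, j)%:R * (2 * ('C(n, K)%:R * (K ^_ j)%:R) * x ^+ j) *
   (2 / q ^+ (j * j.-1) * e))).
  rewrite [leLHS](_ : _ = 'C(K, j)%:R * ('C(n, K - j)%:R * K%:R ^+ j) * (2 / q ^+ (j * j.-1) * e)).
    by rewrite ler_wpM2r ?ler_wpM2l // !mulr_ge0 // invr_ge0 ltW.
  move: ('C(K, j)%:R : R) ('C(n, K - j)%:R : R) (K%:R ^+ j) (2 / _ * e) => a1 a2 a3 a4; ring.
rewrite [leLHS](_ : _ = 'C(n, K)%:R * (4 *
   (('C(K, j) * K ^_ j)%:R * (q ^+ (j * (K - j)) * e)))); last first.
  rewrite xE natrM.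
  move: (q ^+ (j * j.-1)) Q0 ('C(K, j)%:R : R) ('C(n, K)%:R : R) ((K ^_ j)%:R : R) (q ^+ (j * (K - j))) => b b0 a1 a2 a3 a4.
  by field; rewrite gt_eqF.
rewrite -[leRHS]mulrA ler_wpM2l // -[leRHS]mulrA ler_wpM2l //.
by apply: le_trans D _; rewrite mulrC.
Qed.

Lemma sum_corr C : #|C| = K ->
  \sum_(C' : {set 'I_n} | (#|C'| == K) && (C' != C)) corr #|C :&: C'| <=
  'C(n, K)%:R * (16 * expR 2).
Proof.
(* Overlap K means C' = C; setting [f] to 0 there lets the sum run over all sets of size K. *)
move=> cC; pose f j := if (j <= k)%N then corr j else 0.
have corr0 j : 0 <= corr j by rewrite !mulr_ge0 ?invr_ge0 ?exprn_ge0 ?expR_ge0 // ltW.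
have f0 j : 0 <= f j by rewrite /f; case: ifP.
have y0 : 0 <= y by rewrite mulr_ge0 ?exprn_ge0 // ltW.
have y1 : y < 1 by apply: le_lt_trans c2 _; lra.
apply: (@le_trans _ _ (\sum_(C' : {set 'I_n} | (C' \subset setT) && (#|C'| == K)) f #|C :&: C'|)).
  rewrite big_mkcond [leRHS]big_mkcond; apply: ler_sum => C' _; rewrite subsetT /=.
  case: eqP => //= cC'; case: eqVneq => //= CC'.
  rewrite /f ifT // -ltnS -cC; apply: proper_card; rewrite properEneq subsetIl andbT.
  apply: contraNneq CC' => E; rewrite eq_sym eqEcard cC cC' leqnn andbT.
  by apply/setIidPl.
apply: le_trans (sum_card_setI_le K setT C f0) _; rewrite cC cardsT card_ord.
apply: (@le_trans _ _ (\sum_(j < K.+1) 'C(n, K)%:R * (4 * (expR 2 * (y ^+ j + y ^+ (K - j)))))).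
  apply: ler_sum => j _; rewrite /f; case: ifP => [|_]; first exact: corr_term.
  by rewrite mulr0 !mulr_ge0 ?expR_ge0 // addr_ge0 // exprn_ge0.
rewrite -!big_distrr /= ler_wpM2l // big_split /=.
have S : \sum_(j < K.+1) y ^+ j <= 2.
  apply: le_trans (sum_geometric_le _ y0 y1) _.
  by rewrite -[leRHS]invrK lef_pV2 ?posrE; have := c2; lra.
have S' : \sum_(j < K.+1) y ^+ (K - j) <= 2.
  rewrite (reindex_inj rev_ord_inj) /=; apply: le_trans S; apply: ler_sum => j _.
  by rewrite subSS subKn // -ltnS.
have e0 := expR_gt0 (2 : R).
rewrite [leRHS](_ : _ = 4 * (expR 2 * 4)); last by ring.
by rewrite ler_wpM2l // ler_wpM2l ?(ltW e0) //; lra.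
Qed.

Lemma ffact_ge j : (j <= K)%N -> ((n - K) ^ j <= n ^_ j)%N.
Proof.
elim: j => // j IH jK; rewrite expnSr ffactnSr leq_mul ?IH ?(ltnW jK) //.
by apply: leq_sub2l; exact: ltnW.
Qed.

(** The 2 comes from replacing n^K by falling factorials, one e from the Stirling bound and one from
    (1 - x)^(n-K) >= e^-(K+1). *)
Lemma expectation_ge : (2 * expR 2)^-1 <= 'C(n, K)%:R * K%:R * a.
Proof.
have d0 : 0 < 1 - x by have := x16; have := x0; lra.
have d1 : 1 - x <= 1 by have := x0; lra.
have f0 : 0 < (K`!)%:R :> R by rewrite ltr0n fact_gt0.
have KK0 : 0 < K%:R ^+ K :> R by rewrite exprn_gt0.
have s1 : K%:R ^+ K <= 2 * ('C(n, K)%:R * (K`!)%:R) * x ^+ K.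
  apply: (@le_trans _ _ (n%:R ^+ K * x ^+ K)).
    by rewrite -exprMn; apply: lerXn2r; rewrite ?nnegrE // mulr_ge0 // ltW.
  apply: ler_wpM2r; first by apply: exprn_ge0; exact: ltW x0.
  apply: le_trans (nKR (leqnn K)) _.
  by rewrite ler_wpM2l // -natrX -natrM ler_nat bin_ffact ffact_ge.
have s2 : expR (- (K%:R + 1)) <= (1 - x) ^+ (n - K).
  apply: (@le_trans _ _ ((1 - x) ^+ n)); last first.
    by apply: ler_wiXn2l; rewrite ?(ltW d0) // leq_subr.
  apply: (@le_trans _ _ (expR (- (x / (1 - x))) ^+ n)); last first.
    apply: lerXn2r; rewrite ?nnegrE ?expR_ge0 ?(ltW d0) //.
    by apply: one_sub_ge_expR; have := d0; lra.
  rewrite -expRM_natl ler_expR mulrN lerN2 mulrA ler_pdivrMr //.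
  apply: le_trans hi2 _; rewrite expr2 mulrA ler_piMr //.
  by apply: mulr_ge0; [rewrite addr_ge0|exact: ltW].
have s3 := fact_expR_le R (ltn0Sn k).
rewrite /a pX_bin /= mulnC exprM.
have e0 := expR_gt0 (1 : R); have eK := expR_gt0 (K%:R : R).
have E2 : expR 2 = expR 1 * expR 1 :> R by rewrite -exp.expRD.
have EK : expR (- (K%:R + 1)) = (expR K%:R * expR 1)^-1 :> R by rewrite expRN exp.expRD.
rewrite EK in s2; rewrite E2.
have x0' : 0 < x ^+ K by rewrite exprn_gt0.
have M0 : 0 < 'C(n, K)%:R :> R.
  by rewrite ltr0n bin_gt0 (leq_trans _ nK) // leq_pmull.
have K0' := K0.
move: (K%:R : R) ('C(n, K)%:R : R) ((K`!)%:R : R) (x ^+ K) (K%:R ^+ K) (expR (K%:R : R)) (expR (1 : R))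
  ((1 - x) ^+ (n - K)) f0 KK0 s1 s2 s3 e0 eK x0' M0 K0'.
move=> c M F X P EX e W F0 P0 s1 s2 s3 e0 EX0 X0 M0 c0.
apply: (@le_trans _ _ (M * c * (X * (EX * e)^-1))); last first.
  by rewrite ler_wpM2l ?mulr_ge0 ?(ltW M0) ?(ltW c0) // ler_wpM2l // ltW.
have t1 : P * EX * c <= 2 * M * X * (e * c * P) * c.
  rewrite ler_wpM2r ?(ltW c0) //.
  apply: (@le_trans _ _ (2 * (M * F) * X * EX)); first by rewrite ler_wpM2r // ltW.
  rewrite [leLHS](_ : _ = 2 * M * X * (F * EX)); last by ring.
  by rewrite ler_wpM2l // !mulr_ge0 // ltW.
have cP : 0 < c * P by rewrite mulr_gt0.
have t2 : EX <= 2 * M * X * e * c.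
  rewrite -(ler_pM2r cP) [leLHS](_ : _ = P * EX * c); last by ring.
  by rewrite [leRHS](_ : _ = 2 * M * X * (e * c * P) * c) //; ring.
have D0 : 0 < 2 * (e * e) * EX by rewrite !mulr_gt0.
rewrite -(ler_pM2r D0).
rewrite [leLHS](_ : _ = EX); last by field; rewrite gt_eqF.
rewrite [leRHS](_ : _ = 2 * M * X * e * c) //; by field; rewrite !gt_eqF.
Qed.

(** The second moment is at most 2 Z + 16 e^2 Z^2, and Z >= 1 / (2 e^2) turns 2 Z into at most 4 e^2
    Z^2; hence 20. *)
Lemma ndc_second_moment : (20 * expR 2)^-1 <= Pr p (fun E : {set 'I_n * 'I_n} => ndc (gadj E)).
Proof.
have [p0' p1'] := (ltW p0, ltW p1); have a0 := weight_gt0.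
pose P (Cv : {set 'I_n} * 'I_n) := (#|Cv.1| == K) && (Cv.2 \in Cv.1).
pose A (Cv : {set 'I_n} * 'I_n) := ndcC Cv.1 Cv.2.
have sm := Pr_second_moment p0' p1' P A.
set Z := \sum_(Cv | P Cv) Pr p (A Cv) in sm.
set Z2 := (X in _ <= _ * X) in sm.
pose M : R := 'C(n, K)%:R.
have cardK : (\sum_(C : {set 'I_n} | #|C| == K) 1 = M :> R).
  rewrite sumr_const /M -[in 'C(n, K)](card_ord n) -card_draws; congr _%:R.
  by apply: eq_card => C; rewrite inE.
have ZE : Z = M * K%:R * a.
  rewrite /Z -(pair_big_dep (fun C : {set 'I_n} => #|C| == K) (fun C v => v \in C)
     (fun C v => Pr p (ndcC C v))) /=.
  rewrite -cardK !mulr_suml; apply: eq_bigr => C /eqP cC.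
  rewrite (eq_bigr (fun=> a)); last by move=> v vC; rewrite Pr_ndcC.
  by rewrite sumr_const cC mul1r mulr_natl.
have Z2le : Z2 <= M * K%:R * (2 * a + K%:R * (a ^+ 2 * (M * (16 * expR 2)))).
  rewrite /Z2 -(pair_big_dep (fun C : {set 'I_n} => #|C| == K) (fun C v => v \in C)
     (fun C v => \sum_(Cv' | P Cv') Pr p (fun E => ndcC C v E && A Cv' E))) /=.
  rewrite -[in leRHS]mulrA -[X in _ <= X * _]cardK mulr_suml; apply: ler_sum => C /eqP cC; rewrite mul1r.
  rewrite -{1}cC mulr_natl -sumr_const; apply: ler_sum => v vC.
  rewrite -(pair_big_dep (fun C : {set 'I_n} => #|C| == K) (fun C v => v \in C)
     (fun C' v' => Pr p (fun E => ndcC C v E && ndcC C' v' E))) /=.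
  rewrite (bigD1 C) ?cC ?eqxx //=; apply: lerD.
    rewrite (bigD1 v) //= mulr2n mulrDl mul1r; apply: lerD.
      rewrite (@eq_Pr _ _ _ _ (ndcC C v)) ?Pr_ndcC // => E; exact: andbb.
    apply: (@le_trans _ _ (\sum_(v' in C) a / K%:R)).
      rewrite big_mkcond [leRHS]big_mkcond; apply: ler_sum => v' _.
      case: (boolP (v' \in C)) => //= vC'; case: eqVneq => //= vv; last first.
        by apply: Pr_ndcC_diag => //; rewrite eq_sym.
      by rewrite divr_ge0 // ltW.
    by rewrite sumr_const cC -[leLHS]mulr_natl mulrCA divff ?mulr1 // gt_eqF.
  apply: (@le_trans _ _ (\sum_(C' : {set 'I_n} | (#|C'| == K) && (C' != C))
      K%:R * (a ^+ 2 * corr #|C :&: C'|))).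
    apply: ler_sum => C' /andP[/eqP cC' CC'].
    rewrite -{1}cC' mulr_natl -sumr_const; apply: ler_sum => v' vC'.
    by apply: Pr_ndcC_pair => //; rewrite eq_sym.
  rewrite -!big_distrr /= ler_wpM2l // ler_wpM2l ?sqr_ge0 //; exact: sum_corr.
have Zge := expectation_ge; rewrite -/M -ZE in Zge.
have e0 := expR_gt0 (2 : R).
have Z0 : 0 < Z by apply: lt_le_trans Zge; rewrite invr_gt0 mulr_gt0.
set Q := Pr p _.
have Q0 : 0 <= Q by apply: Pr_ge0.
have sQ : Pr p (fun E => [exists i, P i && A i E]) <= Q.
  apply: le_Pr => // E /existsP[[C v] /andP[/andP[/eqP cC vC] AE]].
  exact: (ndcC_ndc cC vC AE).
have Z2e : Z2 <= 2 * Z + 16 * expR 2 * Z ^+ 2.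
  by apply: le_trans Z2le _; rewrite ZE le_eqVlt; apply/orP; left; apply/eqP; ring.
have Z2Z : 2 * Z + 16 * expR 2 * Z ^+ 2 <= 20 * expR 2 * Z ^+ 2.
  have : 1 <= 2 * expR 2 * Z.
    by rewrite -ler_pdivrMl ?mulr_gt0 // mulr1.
  by move=> H; have := ler_wpM2l (ltW Z0) H; lra.
have F : Z ^+ 2 <= Q * (20 * expR 2 * Z ^+ 2).
  apply: le_trans sm _; apply: (@le_trans _ _ (Q * Z2)).
    rewrite ler_wpM2r // /Z2; do 2!(apply: sumr_ge0 => ? _); exact: Pr_ge0.
  by rewrite ler_wpM2l // (le_trans Z2e).
have ZZ : 0 < Z ^+ 2 by rewrite exprn_gt0.
have E0 : 0 < 20 * expR 2 :> R by rewrite mulr_gt0.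
rewrite -div1r ler_pdivrMr // -(ler_pM2r ZZ) mul1r.
by apply: le_trans F _; rewrite mulrA.
Qed.

End SecondMoment.

Local Open Scope classical_set_scope.

(** * Limit laws *)

Lemma whp_kclq_typical (R : realType) (p : R) : 0 < p -> p < 1 -> p != (1 - p) ^+ 2 ->
  whp p (fun n e => kclq_typical ((1 - p) ^+ 2 < p) e).
Proof.
move=> p0 p1 ne; have [p0' p1'] := (ltW p0, ltW p1).
have w1 := whp_and p0' p1' (whp_extension6 p0 p1) (whp_kclq_FT p0 p1).
have [lt|lt|E] := ltgtP ((1 - p) ^+ 2) p; last by rewrite E eqxx in ne.
  have w2 := whp_and p0' p1' (whp_kclq_FF p0 p1 lt) (whp_kclq_TF p0 p1 lt).
  apply: whp_imply (whp_and p0' p1' w1 w2) => // n E /andP[/andP[e1 e2] /andP[e3 e4]].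
  by rewrite /kclq_typical e1 e2 e3 e4.
have w2 := whp_no_dominating_clique p0 p1 lt.
apply: whp_imply (whp_and p0' p1' w1 w2) => // n E /andP[/andP[e1 e2] /andP[e3 e4]].
by rewrite /kclq_typical e1 e2 (negPf e3) (negPf e4).
Qed.

Lemma whp_typical (R : realType) (p : R) : 0 < p -> p < 1 ->
  p != (1 - p) ^+ 2 -> 1 - p != p ^+ 2 ->
  exists b1 b2, whp p (fun n e => typical b1 b2 e).
Proof.
move=> p0 p1 ne1 ne2; have q0 : 0 < 1 - p by lra. have q1 : 1 - p < 1 by lra.
have pK : 1 - (1 - p) = p by rewrite opprB addrC subrK.
have w2 := @whp_kclq_typical R (1 - p) q0 q1; rewrite pK in w2.
exists ((1 - p) ^+ 2 < p), (p ^+ 2 < 1 - p).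
apply: (whp_and (ltW p0) (ltW p1) (whp_kclq_typical p0 p1 ne1)).
exact: (whp_crel (w2 ne2)).
Qed.

Lemma null_cvg (u : nat -> R) (c : R) : null (fun n => `|u n - c|) -> u @ \oo --> c.
Proof.
move=> nu; apply: (@cvgrPdist_le R R^o nat \oo _ u c).2 => eps e0; have [N HN] := nu eps e0.
by exists N => // n /= nN; rewrite distrC; apply: HN.
Qed.

Lemma cvg_dist (u : nat -> R) (c : R) : u @ \oo --> c -> null (fun n => `|u n - c|).
Proof.
move=> /(@cvgrPdist_le R R^o nat \oo _ u c).1 H eps e0; have [N _ HN] := H eps e0.
by exists N => n nN; rewrite distrC; apply: HN.
Qed.

(** All typical graphs, of whatever size, agree on [phi], so one typical graph [E0] decides the
    limit. It exists because typicality fails with probability at most 1/2 for some [N]. *)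
Lemma zero_one_law_noncritical (p : R) : 0 < p -> p < 1 ->
  p != (1 - p) ^+ 2 -> 1 - p != p ^+ 2 -> zero_one_law_E12 p.
Proof.
move=> p0 p1 ne1 ne2 phi ephi; have [p0' p1'] := (ltW p0, ltW p1).
have [b1 [b2 w]] := whp_typical p0 p1 ne1 ne2.
have [N HN] := w 2^-1 ltac:(lra).
have [E0 tE0] : exists E : {set 'I_N * 'I_N}, typical b1 b2 (gadj E).
  have [/existsP//|/existsPn H] := boolP [exists E : {set 'I_N * 'I_N}, typical b1 b2 (gadj E)].
  have := HN N (leqnn N); rewrite (@eq_Pr _ _ _ _ xpredT) ?Pr_predT; last by move=> E; rewrite H.
  by move=> ?; exfalso; lra.
have same n (E : {set 'I_n * 'I_n}) : typical b1 b2 (gadj E) ->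
    models_E12 (E :&: pairs n) phi = models_E12 (E0 :&: pairs N) phi.
  rewrite -adj_gadj => tE; rewrite -adj_gadj in tE0.
  by apply/idP/idP; apply: (typical_models (b1 := b1) (b2 := b2)) => //; rewrite subsetIr.
case: (boolP (models_E12 (E0 :&: pairs N) phi)) => m0.
  exists 1; split; first by right.
  apply: null_cvg; apply: (le_null (N0 := 0) w) => n _; rewrite probE12_Pr distrC.
  rewrite -PrC ger0_norm ?Pr_ge0 //; apply: le_Pr => // E; apply: contraNN => /same->.
  exact: m0.
exists 0; split; first by left.
apply: null_cvg; apply: (le_null (N0 := 0) w) => n _; rewrite probE12_Pr subr0.
rewrite ger0_norm ?Pr_ge0 //; apply: le_Pr => // E mE; apply: contraNN m0 => /same <-.
exact: mE.
Qed.

(** * Oscillation at the critical probability *)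

Section Oscillation.
Variables (R : realType) (p : R).
Hypotheses (p0 : 0 < p) (p1 : p < 1) (pq : p = (1 - p) ^+ 2).
Local Notation q := (1 - p).
Local Notation f n := (Pr p (fun E : {set 'I_n * 'I_n} => ndc (gadj E))).

Let q0 : 0 < q. Proof. by rewrite subr_gt0. Qed.
Let q1 : q < 1. Proof. by rewrite gtrBl. Qed.

Lemma exists_multiple_between (b x : R) : 0 <= b -> 0 < x ->
  exists n : nat, b <= n%:R * x <= b + x.
Proof.
move=> b0 x0; have bx : 0 <= b / x by rewrite divr_ge0 // ltW.
exists (Num.truncn (b / x)).+1; rewrite -ler_pdivrMr // ltW ?truncnS_gt //=.
have : (Num.truncn (b / x))%:R <= b / x by rewrite truncn_le.
by rewrite ler_pdivlMr // -natr1 mulrDl mul1r lerD2r.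
Qed.

Lemma leq_of_scaled (b : R) k n : k%:R <= b -> b <= n%:R * q ^+ k -> (k <= n)%N.
Proof.
move=> kb bn; rewrite -(ler_nat R); apply: le_trans kb (le_trans bn _).
by rewrite ler_piMr // exprn_ile1 // ltW.
Qed.

(** For every [k] some [n] puts n q^k within one step of k + 1; the other conditions of the second
    moment bound only ask that k be large. *)
Lemma ndc_often_likely : exists2 c, 0 < c & forall N, exists2 n, (N <= n)%N & c <= f n.
Proof.
have q01 : 0 < q < 1 by rewrite q0 q1.
have h0 : 0 < Num.sqrt q by rewrite sqrtr_gt0.
have h1 : Num.sqrt q < 1 by rewrite -[X in _ < X]sqrtr1 ltr_sqrt.
have h01 : 0 < Num.sqrt q < 1 by rewrite h0 h1.
have e01 : 0 < expR (- p) < 1 by rewrite expR_gt0 expR_lt1 oppr_lt0.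
have nshift d (r : R) : 0 < r < 1 -> null (fun k => k.+1%:R ^+ d * r ^+ k).
  move=> r01; have [r0 r1] := andP r01; have ir0 : 0 <= r^-1 by rewrite invr_ge0 ltW.
  move=> eps e0; have [N HN] := nullZ ir0 (null_natX_geometric d r01) e0.
  exists N => k Nk; apply: le_trans (HN k.+1 (leqW Nk)).
  by rewrite exprS mulrCA [r^-1 * _]mulrA mulVf ?gt_eqF // mul1r.
have [N1 H1] := nshift 1%N q q01 8^-1 ltac:(lra).
have [N2 H2] := nshift 3%N _ h01 2^-1 ltac:(lra).
have q2 : 0 < q / 2 by rewrite divr_gt0.
have [N3 H3] := nshift 1%N _ h01 _ q2.
have [N4 H4] := nshift 1%N _ e01 1 ltr01.
exists (20 * expR 2)^-1; first by rewrite invr_gt0 mulr_gt0 // expR_gt0.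
move=> N; pose k := (N + N1 + N2 + N3 + N4).+1.
have x0 : 0 < q ^+ k by rewrite exprn_gt0.
have [n /andP[lo hi]] := exists_multiple_between (ler0n R k.+1) x0.
have kR : 1 <= k.+1%:R :> R by rewrite ler1n.
exists n.
  apply: (@leq_trans k); first by rewrite /k; clear; lia.
  by apply: (leq_of_scaled _ lo); rewrite ler_nat.
have hk0 : 0 <= Num.sqrt q ^+ k by rewrite exprn_ge0 // ltW.
have hk1 : Num.sqrt q ^+ k.+1 <= Num.sqrt q ^+ k by rewrite exprS ler_piMl // ltW.
apply: (@ndc_second_moment R p n k) => //.
- have : k.+1%:R ^+ 1 * q ^+ k <= 8^-1 by apply: H1; rewrite /k; clear; lia.
  by rewrite expr1; lra.
- have H : k.+1%:R ^+ 3 * Num.sqrt q ^+ k <= 2^-1 by apply: H2; rewrite /k; clear; lia.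
  by apply: le_trans H; rewrite ler_wpM2l // exprn_ge0.
- have H : k.+1%:R ^+ 1 * Num.sqrt q ^+ k <= q / 2 by apply: H3; rewrite /k; clear; lia.
  rewrite expr1 in H; apply: (@le_trans _ _ (2 * (k.+1%:R * Num.sqrt q ^+ k))); last by lra.
  by rewrite mulrA; apply: ler_pM => //; [rewrite addr_ge0|rewrite exprn_ge0 // ltW|lra].
- have : k.+1%:R ^+ 1 * expR (- p) ^+ k <= 1 by apply: H4; rewrite /k; clear; lia.
  by rewrite expr1 -expRM_natr mulNr.
Qed.

Lemma ndc_often_unlikely eps N : 0 < eps -> exists2 n, (N <= n)%N & f n <= eps.
Proof.
(* The midpoint of 1 and 1 / q satisfies both theta > 1 and theta q < 1. *)
move=> e0; pose theta := (1 + q^-1) / 2.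
have iq : 1 < q^-1 by rewrite invf_gt1.
have th1 : 1 < theta by rewrite /theta; lra.
have thq : theta * q < 1.
  have : (1 + q^-1) * q < 2 by rewrite mulrDl mulVf ?gt_eqF // mul1r; have := q1; lra.
  by rewrite /theta; lra.
have [u [nu Hu]] := ndc_first_moment p0 p1 pq th1 thq.
have [M HM] := nu eps e0; pose k := (N + M).+1.
have x0 : 0 < q ^+ k by rewrite exprn_gt0.
have tk : 0 <= theta * k%:R by rewrite mulr_ge0 //; lra.
have [n /andP[lo hi]] := exists_multiple_between tk x0.
exists n.
  apply: (@leq_trans k); first by rewrite /k; clear; lia.
  by apply: (leq_of_scaled _ lo); rewrite ler_peMl // ltW.
have kM : (M <= k)%N by rewrite /k; clear; lia.
apply: le_trans (HM k kM); apply: Hu => //; apply: le_trans hi _.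
by rewrite lerD2l exprn_ile1 // ltW.
Qed.

End Oscillation.

Lemma ndc_not_cvg (p l : R) : 0 < p -> p < 1 -> p = (1 - p) ^+ 2 ->
  ~ ((fun n => Pr p (fun E : {set 'I_n * 'I_n} => ndc (gadj E))) @ \oo --> l).
Proof.
move=> p0 p1 pq /cvg_dist cv; have [c c0 often] := ndc_often_likely p0 p1 pq.
(* A limit would bring values at least c and values at most c / 4 within c / 4 of [l], hence within
   c / 2 of each other. *)
have c4 : 0 < c / 4 by lra.
have [N HN] := cv _ c4.
have [n Nn fn] := often N; have [m Nm fm] := ndc_often_unlikely p0 p1 pq N c4.
by have := HN n Nn; have := HN m Nm; rewrite !ler_norml => /andP[? ?] /andP[? ?]; lra.
Qed.

(** The roots of (1 - p)^2 = p are (3 - sqrt 5) / 2 and (3 + sqrt 5) / 2, and the latter exceeds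
    1. *)
Lemma golden_quadratic (p : R) : p < 1 ->
  (p == (3 - Num.sqrt 5) / 2) = (p == (1 - p) ^+ 2).
Proof.
move=> p1; have s5 : Num.sqrt 5 ^+ 2 = 5 :> R by rewrite sqr_sqrtr.
have s0 : 0 <= Num.sqrt 5 :> R by rewrite sqrtr_ge0.
have F : (1 - p) ^+ 2 - p = (p - (3 - Num.sqrt 5) / 2) * (p - (3 + Num.sqrt 5) / 2) by lra.
have n0 : p - (3 + Num.sqrt 5) / 2 != 0 by rewrite lt_eqF //; lra.
by rewrite [RHS]eq_sym -[RHS]subr_eq0 F mulf_eq0 (negPf n0) orbF subr_eq0.
Qed.

Lemma golden_quadratic_compl (p : R) : 0 < p ->
  (p == (Num.sqrt 5 - 1) / 2) = (1 - p == p ^+ 2).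
Proof.
move=> p0; have q1 : 1 - p < 1 by lra.
have pK : 1 - (1 - p) = p by lra.
have := golden_quadratic q1; rewrite pK => <-.
by apply/eqP/eqP; lra.
Qed.

Lemma no_convergence_critical (p : R) : 0 < p -> p < 1 ->
  p = (1 - p) ^+ 2 \/ 1 - p = p ^+ 2 -> ~ convergence_law_E12 p.
Proof.
move=> p0 p1 [pq|pq] cl.
  have [//|l Hl] := (cvg_ex _).1 (cl (ndc_sentence (FAdj 0 1)) _).
  apply: (@ndc_not_cvg p l p0 p1 pq).
  rewrite (_ : (fun n => _) = probE12 p (ndc_sentence (FAdj 0 1))) //.
  by apply/funext => n; rewrite probE12_Pr; apply: eq_Pr => E; rewrite models_ndc.
(* The complement of the random graph has edge probability 1 - p, so the sentence is stated about
   nonadjacency. *)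
pose phi := ndc_sentence (FAnd (FNot (FEq 0 1)) (FNot (FAdj 0 1))).
have [//|l Hl] := (cvg_ex _).1 (cl phi _).
have q0 : 0 < 1 - p by lra. have q1 : 1 - p < 1 by lra.
apply: (@ndc_not_cvg (1 - p) l q0 q1); first by rewrite (_ : 1 - (1 - p) = p) //; lra.
rewrite (_ : (fun n => _) = probE12 p phi) //.
apply/funext => n; rewrite probE12_Pr -Pr_setC; apply: eq_Pr => E.
by rewrite models_ndc_crel.
Qed.

Theorem theorem2 (p : R) (hp0 : 0 < p) (hp1 : p < 1) :
  (zero_one_law_E12 p <->
     (p != (3 - Num.sqrt 5) / 2 /\ p != (Num.sqrt 5 - 1) / 2))
  /\ ((p = (3 - Num.sqrt 5) / 2 \/ p = (Num.sqrt 5 - 1) / 2) ->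
      ~ convergence_law_E12 p).
Proof.
have crit : p = (3 - Num.sqrt 5) / 2 \/ p = (Num.sqrt 5 - 1) / 2 -> ~ convergence_law_E12 p.
  move=> pE; apply: no_convergence_critical => //.
  by case: pE => /eqP; [rewrite golden_quadratic // => /eqP; left|
    rewrite golden_quadratic_compl // => /eqP; right].
split=> //; split=> [zo|[]].
  have cl : convergence_law_E12 p.
    by move=> phi /zo[c [_ cc]]; apply/cvg_ex; exists c.
  by split; apply/eqP => pE; apply: crit cl; [left|right].
rewrite golden_quadratic // golden_quadratic_compl //; exact: zero_one_law_noncritical.
Qed.
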